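(* Let $G$ be a hyperbolic group, with a finite generating set $S$, with a nonelementary action by isometries on a separable hyperbolic metric space $X$, and let $x\in X$. Then there exists $L_1>0$ such that $$\frac{\#\{g\in B_n : d_X(gx,x)\ge L_1|g|\}}{\#B_n}\to 1\qquad\text{as } n\to\infty,$$ where $|g|$ is the word length of $g$ with respect to $S$ and $B_n=\{g\in G: |g|\le n\}$.
   Context: A hyperbolic metric space is a geodesic metric space that is $\delta$-hyperbolic for some $\delta\ge 0$; it is not assumed proper. The action is nonelementary if $G$ contains two loxodromic isometries of $X$ whose fixed point sets in the Gromov boundary $\partial X$ are disjoint. *)

(* Defs.v *)
From HB Require Import structures.
From mathcomp Require Import all_boot all_order all_algebra finmap.
From mathcomp Require Import all_classical all_reals topology normedtype sequences.

Set Implicit Arguments.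
Unset Strict Implicit.
Unset Printing Implicit Defensive.

Import Order.TTheory GRing.Theory Num.Theory.
Import numFieldNormedType.Exports.

Local Open Scope classical_set_scope.
Local Open Scope ring_scope.

Definition gromov_product (R : realType) (T : Type) (d : T -> T -> R)
    (o y z : T) : R :=
  (d y o + d z o - d y z) / 2.

(* Gromov's four-point condition, which applies both to geodesic spaces and to
   the discrete word metric of a group (the vertex set of its Cayley graph). *)
Definition delta_hyperbolic (R : realType) (T : Type) (d : T -> T -> R)
    (delta : R) : Prop :=
  forall o y z w : T,
    Num.min (gromov_product d o y z) (gromov_product d o z w) - delta
      <= gromov_product d o y w.

Definition gromov_hyperbolic (R : realType) (T : Type) (d : T -> T -> R) : Prop :=
  exists2 delta : R, 0 <= delta & delta_hyperbolic d delta.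

Definition is_word (G : groupType) (S : {fset G}) (w : seq G) : bool :=
  all (fun s => (s \in S) || ((s^-1)%g \in S)) w.

Definition generates (G : groupType) (S : {fset G}) : Prop :=
  forall g : G, exists2 w : seq G, is_word S w & (\prod_(s <- w) s)%g = g.

Definition word_sizes (G : groupType) (S : {fset G}) (g : G) : set nat :=
  [set size w | w in [set w | is_word S w /\ (\prod_(s <- w) s)%g = g]].

(* The least element of [word_sizes S g]; the default value 0 is only reached
   when [g] is not in the subgroup generated by [S]. *)
Definition word_length (G : groupType) (S : {fset G}) (g : G) : nat :=
  xget 0%N
    [set n | word_sizes S g n /\ forall m, word_sizes S g m -> (n <= m)%N].

Definition word_dist (R : realType) (G : groupType) (S : {fset G})
    (g h : G) : R :=
  (word_length S (g^-1 * h)%g)%:R.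

Definition hyperbolic_group (R : realType) (G : groupType) : Prop :=
  exists2 S : {fset G}, generates S & gromov_hyperbolic (@word_dist R G S).

Definition word_ball (G : groupType) (S : {fset G}) (n : nat) : set G :=
  [set g | (word_length S g <= n)%N].

Lemma word_lengthP (G : groupType) (S : {fset G}) (g : G) : generates S ->
  word_sizes S g (word_length S g) /\
  forall m, word_sizes S g m -> (word_length S g <= m)%N.
Proof.
move=> /(_ g)[w wS wg]; rewrite /word_length.
have ex : exists n, `[< word_sizes S g n >].
  by exists (size w); apply/asboolP; exists w.
case: xgetP => [n _ [] //|/(_ (ex_minn ex)) []].
case: ex_minnP => n /asboolP gn nmin; split=> // m gm.
exact/nmin/asboolP.
Qed.

(* Cardinalities of subsets of a ball are taken through [fset_set], which is
   the junk value [fset0] on infinite sets. *)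
Lemma finite_word_ball (G : groupType) (S : {fset G}) (n : nat) :
  generates S -> finite_set (word_ball S n).
Proof.
move=> genS; pose A : {fset G} := (S `|` [fset s^-1%g | s in S])%fset.
apply: (@sub_finite_set _ _
  ((fun t : {m : 'I_n.+1 & m.-tuple A} =>
      \prod_(s <- tagged t) val s)%g @` setT)); last first.
  exact/finite_image/finite_finset.
move=> g /= gn; have [[w [wS wg] wn] _] := word_lengthP g genS.
have wA : all (mem A) w.
  apply: sub_all wS => s /orP[sS|sS]; rewrite !inE ?sS//.
  by apply/orP; right; apply/imfsetP; exists (s^-1)%g; rewrite //= invgK.
have [v vw] : exists v : seq A, map val v = w.
  exists (pmap insub w); rewrite pmap_filter; last exact: insubK.
  by apply/all_filterP; apply: sub_all wA => s sA /=; rewrite insubT.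
have vn : (size v < n.+1)%N by rewrite -(size_map val) vw wn.
exists (Tagged (fun m : 'I_n.+1 => m.-tuple A)
  (in_tuple v : (Ordinal vn).-tuple A)) => //=.
by rewrite -wg -vw big_map.
Qed.

Definition geodesic_space (R : realType) (X : metricType R) : Prop :=
  forall y z : X, exists gamma : R -> X,
    [/\ gamma 0 = y, gamma (mdist y z) = z &
        forall s t, 0 <= s <= mdist y z -> 0 <= t <= mdist y z ->
          mdist (gamma s) (gamma t) = `|s - t|].

Definition hyperbolic_space (R : realType) (X : metricType R) : Prop :=
  geodesic_space X /\ gromov_hyperbolic (@mdist R X).

Definition separable (T : topologicalType) : Prop :=
  exists2 A : set T, countable A & dense A.

(* (u_i | v_j)_o --> +oo as i, j --> oo; quantifying over all basepoints [o]
   avoids choosing one, as the condition does not depend on it. *)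
Definition asymptotic (R : realType) (X : metricType R) (u v : nat -> X) : Prop :=
  forall o : X,
    gromov_product (@mdist R X) o (u p.1) (v p.2)
      @[p --> filter_prod \oo \oo] --> +oo.

Definition converges_to_infinity (R : realType) (X : metricType R)
    (u : nat -> X) : Prop :=
  asymptotic u u.

Definition boundary_class (R : realType) (X : metricType R) (u : nat -> X) :
    set (nat -> X) :=
  [set v | converges_to_infinity v /\ asymptotic u v].

(* [X] need not be proper, so boundary points are classes of sequences rather
   than of geodesic rays. *)
Definition gromov_boundary (R : realType) (X : metricType R) :
    set (set (nat -> X)) :=
  [set boundary_class u | u in @converges_to_infinity R X].

Definition boundary_map (R : realType) (X : metricType R) (f : X -> X)
    (xi : set (nat -> X)) : set (nat -> X) :=
  [set f \o u | u in xi].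

Definition boundary_fix (R : realType) (X : metricType R) (f : X -> X) :
    set (set (nat -> X)) :=
  [set xi | @gromov_boundary R X xi /\ boundary_map f xi = xi].

(* For an isometry [f] the limit exists, by subadditivity, and does not depend
   on [y]. *)
Definition is_translation_length (R : realType) (X : metricType R)
    (f : X -> X) (tau : R) : Prop :=
  forall y : X, mdist y (iter n f y) / n%:R @[n --> \oo] --> tau.

Definition loxodromic (R : realType) (X : metricType R) (f : X -> X) : Prop :=
  exists2 tau : R, 0 < tau & is_translation_length f tau.

Definition isometric_action (R : realType) (G : groupType) (X : metricType R)
    (act : G -> X -> X) : Prop :=
  [/\ forall y, act 1%g y = y,
      forall g h y, act (g * h)%g y = act g (act h y) &
      forall g y z, mdist (act g y) (act g z) = mdist y z].

Definition nonelementary (R : realType) (G : groupType) (X : metricType R)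
    (act : G -> X -> X) : Prop :=
  exists g h : G,
    [/\ loxodromic (act g), loxodromic (act h) &
        boundary_fix (act g) `&` boundary_fix (act h) = set0].

(* Main.v *)
Require Import Defs.
From mathcomp Require Import all_boot all_order all_algebra finmap.
From mathcomp Require Import all_classical all_reals topology normedtype sequences.
From mathcomp Require Import zify ring lra.

(** Both g |-> |g| and g |-> d(gx, x) are length functions on G satisfying the
    four-point condition, and elements of G are encoded by their shortlex minimal
    words, whose language is recognised by finitely many states.

    Two independent loxodromic elements yield a Schottky pair A, B for both
    lengths, and thereby a word u such that any two normal forms can be joined
    through u. Concatenating normal forms that avoid u through u gives a Kraft type
    inequality, so the forms avoiding u have a convergent growth series at the
    critical exponent: outside an exponentially small proportion, a normal form of
    length n meets a translate of u in a positive proportion of its blocks of a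
    fixed length b.

    Here u = A^(N+1) B A^(N+2) B ... A^(2N) B. A normal form running along a
    translate of u passes many times through the same state, so that its loops
    there can be permuted; the rotations of one such concatenation of loops are K
    subwords of equal length which may be exchanged inside the normal form without
    leaving the language, and which are in general
    position in X. Exchanging them freely at k places turns a normal form into K^k
    others, and a pivot argument shows that all but a proportion 2^-k of these
    displace x by at least k/6. Hence the proportion of slow elements in the sphere
    of radius n tends to zero, and averaging over spheres gives the theorem. *)

Set Implicit Arguments.
Unset Strict Implicit.
Unset Printing Implicit Defensive.

Import Order.TTheory GRing.Theory Num.Theory.
Import numFieldNormedType.Exports.

Local Open Scope classical_set_scope.
Local Open Scope ring_scope.

(** * Hyperbolic length functions *)

(** Displacement is only bounded above by a multiple of word length, so the lower bound has to be
    extracted from the uniform measure on a sphere. Exchanged subwords must therefore have equal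
    length and be accepted in the same contexts; rotations of a concatenation of loops at one state
    have both properties, and the fibres of the exchange then have exactly K^k elements.

    The exponents of A in u increase so that distinct rotations begin and end with different powers
    of A. Two rotations fork in X after at most about 2N times the displacement of A, while each of
    them has displacement at least about K tau N / 2, where tau is the growth rate of the powers of
    A. Both quantities are linear in N, so K is fixed first and N then absorbs all constants.

    For words avoiding u no smaller exponential growth rate has to be proved: convergence of their
    series at the critical exponent makes some block length b rare enough for an exponential moment
    bound. The family of exchangeable words varies from block to block, but within blocks of length
    b there are finitely many families, so one of them serves a positive proportion of the
    blocks. *)

Record hyplen (R : realType) (G : groupType) (l : G -> R) (delta : R) : Prop :=
  Hyplen {
    len1 : l 1%g = 0;
    lenV : forall g, l (g^-1)%g = l g;
    lenM : forall g h, l (g * h)%g <= l g + l h;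
    delta_ge0 : 0 <= delta;
    len_hyp : forall g h k,
      Num.min ((l g + l h - l (g^-1 * h)%g) / 2) ((l h + l k - l (h^-1 * k)%g) / 2)
        - delta <= (l g + l k - l (g^-1 * k)%g) / 2 }.

Definition gp (R : realType) (G : groupType) (l : G -> R) (g h : G) : R :=
  (l g + l h - l (g^-1 * h)%g) / 2.

Section Length.
Variables (R : realType) (G : groupType) (l : G -> R) (delta : R).
Hypothesis H : hyplen l delta.
Implicit Types (g h k e f : G) (es : seq G) (P D : R).

Lemma len_ge0 g : 0 <= l g.
Proof.
by have := lenM H g g^-1%g; rewrite mulgV (len1 H) (lenV H); lra.
Qed.

Lemma gpC g h : gp l g h = gp l h g.
Proof.
rewrite /gp; have -> : (h^-1 * g = (g^-1 * h)^-1)%g by rewrite invgM invgK.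
by rewrite (lenV H); lra.
Qed.

Lemma lenD g h : l (g * h)%g = l g + l h - 2 * gp l g^-1 h.
Proof. by rewrite /gp invgK (lenV H); lra. Qed.

Lemma gp_ge0 g h : 0 <= gp l g h.
Proof. by have := lenM H g^-1%g h; rewrite /gp (lenV H); lra. Qed.

Lemma gp_lel g h : gp l g h <= l g.
Proof. by have := lenM H g (g^-1 * h)%g; rewrite /gp mulVKg; lra. Qed.

Lemma gp_ler g h : gp l g h <= l h.
Proof. by rewrite gpC gp_lel. Qed.

Lemma gpK g h : gp l g (g * h) = l g - gp l g^-1 h.
Proof. by rewrite /gp mulKg invgK (lenV H); lra. Qed.

Lemma gpMl g h k : gp l (g * h) (g * k) <= l g + gp l h k.
Proof.
rewrite /gp (_ : (g * h)^-1 * (g * k) = h^-1 * k)%g; last first.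
  by rewrite invgM -mulgA mulKg.
by have := lenM H g h; have := lenM H g k; lra.
Qed.

Lemma len_sub g h : l g - l h <= l (g * h)%g.
Proof. by have := lenM H (g * h)%g h^-1%g; rewrite mulgK (lenV H); lra. Qed.

Lemma len_subl g h : l h - l g <= l (g * h)%g.
Proof. by have := lenM H g^-1%g (g * h)%g; rewrite mulKg (lenV H); lra. Qed.

Lemma gp_perturb g h e : gp l (g * e) h <= gp l g h + l e.
Proof.
rewrite /gp invgM -mulgA; have := lenM H g e.
by have := len_subl e^-1 (g^-1 * h)%g; rewrite (lenV H); lra.
Qed.

Lemma gp_perturbr g h e : gp l g (h * e) <= gp l g h + l e.
Proof. by rewrite ![gp l g _]gpC gp_perturb. Qed.

Lemma hyp4 g h k :
  gp l g h <= gp l g k + delta \/ gp l h k <= gp l g k + delta.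
Proof.
by have := len_hyp H g h k; rewrite minEle /gp; case: ifP => _; [left|right]; lra.
Qed.

Lemma hyp4_lt g h k c : c + delta < gp l g h -> gp l g k <= c -> gp l h k <= c + delta.
Proof. by move=> *; case: (hyp4 g h k); lra. Qed.

Definition gprod es : G := (\prod_(e <- es) e)%g.

Lemma gprod_nil : gprod [::] = 1%g. Proof. exact: big_nil. Qed.
Lemma gprod_cons e es : gprod (e :: es) = (e * gprod es)%g.
Proof. exact: big_cons. Qed.
Lemma gprod_cat es es' : gprod (es ++ es') = (gprod es * gprod es')%g.
Proof. exact: big_cat. Qed.

(** A broken path with turns at most [P]. Neither [e] nor the last entry of [es] has to be long, so
    that arbitrary group elements can stand at both ends. *)
Fixpoint chain P D e es : Prop :=
  if es is f :: es' then
    [/\ gp l e^-1 f <= P, nilp es' \/ D <= l f & chain P D f es']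
  else True.

(** Local-to-global principle, by induction from the far end: the product starting with [f] follows
    [f] for at least [D - P - delta], which exceeds [P + delta], so the four-point condition passes
    the bound on the turn from [f] to the whole product. *)
Lemma chain_head P D e es : 0 <= P -> 2 * P + 3 * delta < D -> chain P D e es ->
  gp l e^-1 (gprod es) <= P + delta.
Proof.
have d0 := delta_ge0 H; move=> P0 PD; elim: es e => [|f es IH] e /=.
  by rewrite gprod_nil; have := gp_ler e^-1 1%g; rewrite (len1 H); lra.
move=> [ef]; rewrite gprod_cons.
case: es IH => [_ _ _|f' es IH [//|fD] c].
  by rewrite gprod_nil mulg1; lra.
rewrite gpC; apply: (@hyp4_lt f); last by rewrite gpC.
by rewrite gpK; have := IH _ c; lra.
Qed.

Lemma gprod_chain P D e es : 0 <= P -> 2 * P + 3 * delta < D -> chain P D e es ->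
  l e + l (gprod es) - 2 * (P + delta) <= l (e * gprod es)%g.
Proof. by move=> P0 PD /chain_head c; rewrite lenD; have := c P0 PD; lra. Qed.

Lemma chain_step P D p e f : 2 * P + 3 * delta < D ->
  gp l p^-1 e <= P + delta -> D <= l e -> gp l e^-1 f <= P ->
  gp l (p * e)^-1 f <= P + delta.
Proof.
have d0 := delta_ge0 H; move=> PD pe eD ef.
apply: (@hyp4_lt e^-1); last exact: ef.
by rewrite invgM gpK invgK (lenV H) gpC; lra.
Qed.

(** The induction moves the cut forward: [p] collects the factors already passed, and [chain_step]
    keeps the turn after it at most [P + delta]. *)
Lemma chain_split P D p e es es' : 0 <= P -> 2 * P + 3 * delta < D ->
  gp l p^-1 e <= P + delta -> D <= l e -> chain P D e (es ++ es') ->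
  ~~ nilp es' ->
  gp l (p * e * gprod es)^-1 (gprod es') <= P + 2 * delta.
Proof.
have d0 := delta_ge0 H; move=> P0 PD; elim: es p e => [|f es IH] p e pe eD c n0.
  rewrite gprod_nil mulg1 gpC.
  have {}c := chain_head P0 PD c.
  suff : gp l (gprod es') (p * e)^-1 <= P + delta + delta by lra.
  rewrite gpC; case: (hyp4 e^-1 (p * e)^-1 (gprod es')) => [h|h]; last by lra.
  move: h; rewrite invgM gpK invgK (lenV H) [gp l e _]gpC => h; lra.
move: c => /= [ef [fnil|fD] c].
  by move: n0 fnil; rewrite /nilp size_cat addn_eq0 => /negPf->; rewrite andbF.
rewrite gprod_cons mulgA; apply: IH => //.
exact: chain_step PD pe eD ef.
Qed.

(** Mirror image of the head estimate: seen from its endpoint, the path runs back along its last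
    factor. *)
Lemma chain_last P D e es : 0 <= P -> 2 * P + 3 * delta < D ->
  D <= l e -> chain P D e es -> ~~ nilp es -> D <= l (last e es) ->
  D - P - delta <= gp l (e * gprod es)^-1 (last e es)^-1.
Proof.
have d0 := delta_ge0 H; move=> P0 PD.
have gen p : gp l p^-1 e <= P + delta -> D <= l e -> chain P D e es ->
   ~~ nilp es -> D <= l (last e es) ->
   D - P - delta <= gp l (p * e * gprod es)^-1 (last e es)^-1.
  elim: es p e => [//|f es IH] p e pe eD /= [ef fD c] _ lD.
  have pf := chain_step PD pe eD ef.
  have [es0|n0] := eqVneq es [::].
    move: lD; rewrite es0 /= gprod_cons gprod_nil mulg1 => lD.
    rewrite gpC (invgM _ f) gpK invgK (lenV H) [gp l f _]gpC.
    by have := pf; lra.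
  rewrite gprod_cons mulgA; apply: IH => //; last by rewrite /nilp size_eq0.
  by case: fD => //; rewrite /nilp size_eq0 (negPf n0).
move=> eD c n0 lD; have := gen 1%g; rewrite invg1 mul1g; apply=> //.
have := gp_lel 1%g e; rewrite (len1 H); lra.
Qed.

Lemma lenX a n : l (a ^+ n)%g <= n%:R * l a.
Proof.
elim: n => [|n IH]; first by rewrite expg0 (len1 H) mul0r.
by rewrite expgSr -natr1 mulrDl mul1r; have := lenM H (a ^+ n)%g a; lra.
Qed.

Lemma gprod_nseq n a : gprod (nseq n a) = (a ^+ n)%g.
Proof. by elim: n => [|n IH]; rewrite ?gprod_nil // gprod_cons IH expgS. Qed.
End Length.

Lemma affine_lt_exp2 (R : realType) (A B : R) : exists k, A + B * k%:R < 2 ^+ k.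
Proof.
pose M := Num.max 0 A + 2 * Num.max 0 B.
have [j Mj] : exists j : nat, M < j%:R by exists (Num.truncn M).+1; rewrite truncnS_gt.
exists (2 * j)%N; rewrite exprM.
have j2 : j.+1%:R <= 2 ^+ j :> R by rewrite -natrX ler_nat ltn_expl.
have A0 : A <= Num.max 0 A by rewrite le_max lexx orbT.
have B0 : B <= Num.max 0 B by rewrite le_max lexx orbT.
have A1 : 0 <= Num.max 0 A by rewrite le_max lexx.
have B1 : 0 <= Num.max 0 B by rewrite le_max lexx.
move: Mj; rewrite /M => Mj; move: A0 B0 A1 B1 Mj.
move: (Num.max 0 A) (Num.max 0 B) => a b A0 B0 A1 B1 Mj.
rewrite natrM -(exprM 2 2 j) mulnC exprM.
have : j.+1%:R ^+ 2 <= (2 ^+ j) ^+ 2 :> R.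
  by rewrite ler_pXn2r ?nnegrE ?exprn_ge0.
rewrite -natr1; move: (ler0n R j); move: (j%:R) Mj => x; nra.
Qed.

(** * Powers of an element with linear growth *)

Section Powers.
Variables (R : realType) (G : groupType) (l : G -> R) (delta : R).
Hypothesis H : hyplen l delta.

(** The lengths of [a ^+ (2 ^ k)] cannot grow by at most [3 * delta] at every doubling, since they
    are at least [tau * 2 ^ k]. A doubling with a larger gain yields a power [e] whose consecutive
    copies form a chain; exponents are then reduced modulo [N = 2 ^ k] at bounded cost. *)
Lemma power_gp a (tau : R) : 0 < tau -> (forall n, tau * n%:R <= l (a ^+ n)%g) ->
  exists2 C, 0 <= C & forall i j, gp l (a ^+ i)^-1 (a ^+ j) <= C.
Proof.
move=> tau0 atau; have d0 := delta_ge0 H.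
have [k kP] : exists k, l (a ^+ (2 ^ k))%g + 3 * delta < l (a ^+ (2 ^ k.+1))%g.
  apply/not_existsP => noK.
  have up k : l (a ^+ (2 ^ k))%g <= l a + 3 * delta * k%:R.
    elim: k => [|k IH]; first by rewrite expn0 expg1; lra.
    by have := noK k; rewrite -natr1 => /negP; rewrite -leNgt; lra.
  have [k] := affine_lt_exp2 (l a / tau) (3 * delta / tau).
  have := atau (2 ^ k)%N; have := up k; rewrite natrX.
  move: (2 ^+ k) (l _) => x y xy yx.
  rewrite -mulrAC -mulrDl ltr_pdivrMr //; lra.
set N := (2 ^ k)%N in kP; set e := (a ^+ N)%g in kP *.
have P0 := gp_ge0 H e^-1%g e; set P := gp l e^-1%g e in P0.
have PD : 2 * P + 3 * delta < l e.
  rewrite /P /gp invgK (lenV H).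
  by move: kP; rewrite expnSr expgnA -/e expgS expg1; lra.
have ech m : chain l P (l e) e (nseq m e).
  by elim: m => //= m IH; split=> //; right.
have eij i j : gp l (e ^+ i)^-1 (e ^+ j) <= P + 2 * delta.
  case: i => [|i].
    rewrite expg0 invg1; have := gp_lel H 1%g (e ^+ j)%g; rewrite (len1 H); lra.
  case: j => [|j].
    have := gp_ler H (e ^+ i.+1)^-1%g 1%g; rewrite (len1 H) expg0; lra.
  have /(_ _) := @chain_split _ _ _ _ H P (l e) 1%g e (nseq i e) (nseq j.+1 e) P0 PD.
  rewrite mul1g !gprod_nseq -expgS -nseqD; apply=> //.
  by rewrite invg1; have := gp_lel H 1%g e; rewrite (len1 H); lra.
have la := len_ge0 H a.
have Nl : 0 <= N%:R * l a by rewrite mulr_ge0.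
exists (P + 2 * delta + 2 * (N%:R * l a)); first by lra.
have N0 : (0 < N)%N by rewrite expn_gt0.
have rN i : l (a ^+ (i %% N))%g <= N%:R * l a.
  apply: (le_trans (lenX H _ _)); rewrite ler_wpM2r // ler_nat ltnW //.
  exact: ltn_pmod.
move=> i j; rewrite (divn_eq i N) (divn_eq j N) [(i %/ N * N)%N]mulnC.
rewrite [(j %/ N * N)%N]mulnC addnC [in X in gp l _ X]addnC.
rewrite expgnDr [in X in gp l _ X]addnC expgnDr !expgnA -/e invgM.
have := rN i; have := rN j; have := eij (i %/ N)%N (j %/ N)%N.
set x := (a ^+ (i %% N))%g; set y := (a ^+ (j %% N))%g.
set u := (e ^+ _)%g; set v := (e ^+ _)%g.
have := gp_perturb H u^-1%g (v * y)%g x^-1%g; rewrite (lenV H).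
have := gp_perturbr H u^-1%g v y; lra.
Qed.
End Powers.

(** * Quasi-isometry invariance of hyperbolicity *)

Lemma affine_lt_exp2_near (R : realType) (A B : R) : 0 <= A -> 0 <= B ->
  exists k0, forall k, (k0 <= k)%N -> A + B * k%:R < 2 ^+ k.
Proof.
move=> A0 B0; have [k0 k0P] := affine_lt_exp2 (A + B) B.
exists k0 => k /subnK <-; elim: (k - k0)%N => [|i IH]; first by rewrite add0n; lra.
rewrite addSn exprS -natr1; move: IH; have := ler0n R (i + k0).
have : k0%:R <= (i + k0)%:R :> R by rewrite ler_nat leq_addl.
case: (i + k0)%N => [|n]; last first.
  rewrite -natr1; have := ler0n R n; move: (n%:R) (2 ^+ _) => x y; nra.
by rewrite ler_nat leqn0 => /eqP k00; move: k0P; rewrite k00 expr0; lra.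
Qed.

Section DiscreteGeodesics.
Variables (R : realType) (T : Type).
Implicit Types (d : T -> T -> R).

Record pseudometric d : Prop := Pseudometric {
  dist0 : forall x, d x x = 0;
  distC : forall x y, d x y = d y x;
  distT : forall y x z, d x z <= d x y + d y z }.

Definition is_geod d (p : nat -> T) n :=
  forall i j, (i <= j <= n)%N -> d (p i) (p j) = (j - i)%:R.

Definition geod_connected d := forall x y, exists p n,
  [/\ p 0%N = x, p n = y & is_geod d p n].

Lemma dist_ge0 d x y : pseudometric d -> 0 <= d x y.
Proof.
by move=> m; have := distT m y x x; rewrite (dist0 m) (distC m y x); lra.
Qed.

(** Halving the path costs one [delta] per level, so the loss is only logarithmic in the number of
    steps; the Morse argument below rests on this. *)
Lemma gromov_chain d delta z (p : nat -> T) g k N : delta_hyperbolic d delta ->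
  (0 < N <= 2 ^ k)%N -> 0 <= delta ->
  (forall i, (i < N)%N -> g <= gromov_product d z (p i) (p i.+1)) ->
  g - k%:R * delta <= gromov_product d z (p 0%N) (p N).
Proof.
move=> hyp + d0; elim: k p N => [|k IH] p N.
  by rewrite expn0; case: N => [//|[|//]] _ /(_ 0%N isT); rewrite mul0r subr0.
move=> /andP[N0 Nk] gP; have kd : 0 <= k%:R * delta by rewrite mulr_ge0.
have [Nlt|ltN] := leqP N (2 ^ k).
  by have := IH p N _ gP; rewrite N0 Nlt => /(_ isT); rewrite -natr1; lra.
have h1 := IH p (2 ^ k)%N _ (fun i ik => gP i (ltn_trans ik ltN)).
have h2 := IH (fun i => p (2 ^ k + i)%N) (N - 2 ^ k)%N.
have k0 : (0 < 2 ^ k)%N by rewrite expn_gt0.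
have {}h1 := h1 (introT andP (conj k0 (leqnn _))).
have {h2} := h2 _ _; rewrite addn0 subnKC ?(ltnW ltN) // => h2.
have {h2} : g - k%:R * delta <= gromov_product d z (p (2 ^ k)%N) (p N).
  apply: h2 => [|i iN]; first by move: Nk; rewrite expnS; clear -ltN; lia.
  by rewrite addnS; apply: gP; move: iN; clear; lia.
have := hyp z (p 0%N) (p (2 ^ k)%N) (p N); rewrite minEle -natr1.
by case: ifP => _; lra.
Qed.

Lemma is_geod_rev d p n : pseudometric d -> is_geod d p n ->
  is_geod d (fun i => p (n - i)%N) n.
Proof.
move=> m g i j ij; rewrite (distC m) g; last by move: ij; clear; lia.
by congr (_%:R); move: ij; clear; lia.
Qed.
End DiscreteGeodesics.

Section QuasiIsometry.
Variables (R : realType) (T : Type) (d d' : T -> T -> R) (c delta : R).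
Hypotheses (m : pseudometric d) (m' : pseudometric d').
Hypotheses (dd' : forall x y, d x y <= c * d' x y) (d'd : forall x y, d' x y <= c * d x y).
Hypotheses (c1 : 1 <= c) (delta0 : 0 <= delta) (hyp : delta_hyperbolic d' delta).

(** One half of the Morse lemma. Around the point of [q] farthest from [p], at distance [r], a
    detour along [p] of length [O(r)] joins two points of [q] while staying at distance at least
    [r]. By [gromov_chain], [r] is then at most of the order of [log r]. *)
Lemma geod_near_path : exists2 R1, 0 <= R1 & forall p n q k,
  is_geod d p n -> is_geod d' q k -> q 0%N = p 0%N -> q k = p n ->
  forall j, (j <= k)%N -> exists2 t, (t <= n)%N & d' (q j) (p t) <= R1.
Proof.
have c1' := c1; have delta0' := delta0.
(* For a detour of at most [2 ^ (e + 1)] steps, the estimates below give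
   [r <= c / 2 + (e + 1) * delta] and [2 ^ e <= c * (6 * r + 4) + 4]. Eliminating [r] gives
   [2 ^ e <= A + B * e], which fails from [k0] on. *)
pose A := c * (6 * (c / 2 + delta) + 4) + 4; pose B := c * 6 * delta.
have A0 : 0 <= A by rewrite /A; nra.
have B0 : 0 <= B by rewrite /B !mulr_ge0 //; lra.
have [k0 k0P] := affine_lt_exp2_near A0 B0.
exists (2 ^+ k0); first by rewrite exprn_ge0.
move=> p n q k gp gq q0 qk j0 j0k.
pose f (j : nat) := d' (q j) (p [arg min_(t < ord0 : 'I_n.+1) d' (q j) (p t)]%O).
have fmin j t : (t <= n)%N -> f j <= d' (q j) (p t).
  rewrite /f -ltnS => tn; case: arg_minP => // i _ /(_ (Ordinal tn)); exact.
have fex j : exists2 t, (t <= n)%N & d' (q j) (p t) = f j.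
  by exists [arg min_(t < ord0 : 'I_n.+1) d' (q j) (p t)]%O => //; rewrite -ltnS.
suff fle : forall j, (j <= k)%N -> f j <= 2 ^+ k0.
  by have [t tn tE] := fex j0; exists t => //; rewrite tE fle.
pose j := [arg max_(j > ord0 : 'I_k.+1) f j]%O.
have fj i : (i <= k)%N -> f i <= f j.
  rewrite -ltnS => ik; rewrite /j; case: arg_maxP => // x _ /(_ (Ordinal ik)); exact.
move=> i /fj fij; apply: le_trans fij _; rewrite leNgt; apply/negP => big.
have jk : (j <= k)%N by rewrite -ltnS.
move: big fj jk; move: {i} (nat_of_ord j) => {}j big fj jk.
set r := f j in big fj; have r0 : 0 <= r.
  by rewrite /r; have [t _ <-] := fex j; apply: dist_ge0.
(* The window reaches at least [2 * r] to each side, so the step of length at most [r] from its end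
   to [p] still has Gromov product at least [r] seen from [q j]. If the window is cut off by an end
   of [q], that end lies on [p] itself. *)
pose a := (Num.truncn (2 * r)).+1.
have a1 : 2 * r <= a%:R by rewrite ltW // truncnS_gt.
have a2 : a%:R <= 2 * r + 1.
  by rewrite /a -natr1; have := @truncn_le R (2 * r); lra.
pose j1 := (j - a)%N; pose j2 := minn k (j + a)%N.
have j1k : (j1 <= k)%N by rewrite /j1; move: jk; clear; lia.
have j2k : (j2 <= k)%N by rewrite /j2; clear; lia.
have j1j : (j1 <= j)%N by rewrite /j1; clear; lia.
have jj2 : (j <= j2)%N by rewrite /j2; move: jk; clear; lia.
have ex1 : exists t, [/\ (t <= n)%N, d' (q j1) (p t) <= r &
    r <= gromov_product d' (q j) (q j1) (p t)].
  have [j1a|] := eqVneq j1 0%N.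
    exists 0%N; rewrite j1a q0 (dist0 m') /gromov_product (dist0 m') !(distC m' (p _)).
    by split=> //; have := fmin j 0%N isT; rewrite -/r; lra.
  move=> j10; have [t tn tE] := fex j1; exists t; split=> //; first by rewrite tE fj.
  rewrite /gromov_product tE gq ?j1j //.
  have -> : (j - j1 = a)%N by move: j10; rewrite /j1; clear; lia.
  by have := fj _ j1k; have := fmin j t tn; rewrite (distC m' (p t)) -/r; lra.
have ex2 : exists t, [/\ (t <= n)%N, d' (p t) (q j2) <= r &
    r <= gromov_product d' (q j) (p t) (q j2)].
  have [j2a|] := eqVneq j2 k.
    exists n; rewrite j2a qk (dist0 m') /gromov_product (dist0 m') !(distC m' (p _)).
    by split=> //; have := fmin j n (leqnn _); rewrite -/r; lra.
  move=> j20; have [t tn tE] := fex j2; exists t.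
  rewrite (distC m' (p t)) tE fj //; split=> //.
  rewrite /gromov_product !(distC m' _ (q j)) (distC m' (p t)) tE gq ?jj2 //.
  have -> : (j2 - j = a)%N by move: j20; rewrite /j2; clear; lia.
  by have := fj _ j2k; have := fmin j t tn; rewrite -/r; lra.
have [t1 [t1n t1r t1g]] := ex1; have [t2 [t2n t2r t2g]] := ex2.
pose N := ((t2 - t1) + (t1 - t2))%N.
have Nr : N%:R <= c * (6 * r + 4).
  have -> : N%:R = d (p t1) (p t2) :> R.
    have [t12|/ltnW t21] := leqP t1 t2.
      by rewrite gp ?t12 // /N; congr (_%:R); move: t12; clear; lia.
    by rewrite (distC m) gp ?t21 // /N; congr (_%:R); move: t21; clear; lia.
  apply: (le_trans (dd' _ _)); rewrite ler_wpM2l ?(le_trans _ c1) //.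
  have := distT m' (q j1) (p t1) (p t2); have := distT m' (q j2) (q j1) (p t2).
  rewrite (distC m' (q j2) (p t2)) (distC m' (p t1) (q j1)) gq ?(leq_trans j1j) //.
  have : (j2 - j1)%:R <= (a + a)%:R :> R by rewrite ler_nat /j1 /j2; clear; lia.
  by rewrite natrD; lra.
pose path i := if i is i'.+1 then
    if i == N.+2 then q j2 else
    if (t1 <= t2)%N then p (t1 + i')%N else p (t1 - i')%N
  else q j1.
have pathN : path N.+2 = q j2 by rewrite /path eqxx.
have step t : (t < n)%N -> r - c / 2 <= gromov_product d' (q j) (p t) (p t.+1).
  move=> tn; rewrite /gromov_product !(distC m' _ (q j)).
  have := fmin j t (ltnW tn); have := fmin j t.+1 tn; rewrite -/r.
  by have := d'd (p t) (p t.+1); rewrite gp ?leqnSn // subSnn mulr1; lra.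
have gpC (x y z : T) : gromov_product d' x y z = gromov_product d' x z y.
  by rewrite /gromov_product (distC m' y z); lra.
have pathP i : (i < N.+2)%N -> r - c / 2 <= gromov_product d' (q j) (path i) (path i.+1).
  case: i => [_|i].
    have -> : path 1%N = p t1 by rewrite /path /= addn0 subn0; case: ifP.
    by rewrite /path; lra.
  rewrite !ltnS leq_eqVlt => /orP[/eqP iN|iN].
    rewrite iN pathN; suff -> : path N.+1 = p t2 by lra.
    rewrite /path eqSS ltn_eqF // /N; case: leqP => t12; congr p; move: t12; clear; lia.
  rewrite /path !eqSS !ltn_eqF ?ltnS //; last by move: iN; clear; lia.
  case: leqP => t12.
    by rewrite addnS; apply: step; move: iN t12 t2n; rewrite /N; clear; lia.
  have -> : (t1 - i = (t1 - i.+1).+1)%N by move: iN t12; rewrite /N; clear; lia.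
  by rewrite gpC; apply: step; move: iN t12 t1n; rewrite /N; clear; lia.
have [e eN emin] : exists2 e, (N.+2 <= 2 ^ e)%N &
    forall i, (N.+2 <= 2 ^ i)%N -> (e <= i)%N.
  have ex : exists e, (N.+2 <= 2 ^ e)%N by exists N.+2; rewrite ltnW // ltn_expl.
  by case: (ex_minnP ex) => e eN emin; exists e.
have N0 : (0 < N.+2 <= 2 ^ e)%N by rewrite eN.
have := gromov_chain hyp N0 delta0 pathP.
rewrite pathN /path /=.
have -> : gromov_product d' (q j) (q j1) (q j2) = 0.
  rewrite /gromov_product (distC m' (q j2)) !gq ?j1j ?jj2 ?(leq_trans j1j) //.
  by rewrite (natrB _ j1j) (natrB _ jj2) (natrB _ (leq_trans j1j jj2)); lra.
move=> re; have NR : N%:R + 2 = N.+2%:R :> R by rewrite -[N.+2]addn2 natrD.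
case: e {N0} eN emin re => [|e] eN emin re; first by rewrite expn0 in eN.
have e2 : 2 ^+ e <= c * (6 * r + 4) + 4.
  have : (2 ^ e < N.+2)%N by rewrite ltnNge; apply/negP => /emin; rewrite ltnn.
  by rewrite -(ltr_nat R) natrX; lra.
have [/k0P ke|ek] := leqP k0 e.
  move: re ke; rewrite -(natr1 e) /A /B => re ke.
  by have := ler_wpM2l (le_trans ler01 c1) re; move: ke e2; lra.
have := k0P _ (leqnn k0); have : e.+1%:R * delta <= k0%:R * delta.
  by rewrite ler_wpM2r // ler_nat.
have : k0%:R * delta <= B * k0%:R.
  have kd : 0 <= k0%:R * delta by rewrite mulr_ge0.
  have : 0 <= (c - 1) * (k0%:R * delta) by rewrite mulr_ge0 // subr_ge0.
  by rewrite /B; move: kd; lra.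
have : c / 2 <= A.
  have : 0 <= c * (c / 2 + delta) by rewrite mulr_ge0; move: c1' delta0'; lra.
  by rewrite /A; move: c1'; lra.
by move: re big; lra.
Qed.

(** Discrete connectedness: if [q j] is the last point of [q] close to some [p s] with [s <= t],
    then [q j.+1] is close to some [p s'] with [t <= s']. So [p s] and [p s'] are at bounded
    distance, and [p t] lies between them. *)
Lemma path_near_geod : exists2 R2, 0 <= R2 & forall p n q k,
  is_geod d p n -> is_geod d' q k -> q 0%N = p 0%N -> q k = p n ->
  forall t, (t <= n)%N -> exists2 j, (j <= k)%N & d' (p t) (q j) <= R2.
Proof.
have [R1 R10 near] := geod_near_path; have c1' := c1.
exists (R1 + c * (c * (2 * R1 + 1))).
  by rewrite addr_ge0 // !mulr_ge0 //; lra.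
move=> p n q k gp gq q0 qk t tn.
pose P j := (j <= k)%N && `[< exists s, (s <= t)%N /\ d' (q j) (p s) <= R1 >].
have exP : exists j, P j.
  exists 0%N; apply/andP; split=> //; apply/asboolP; exists 0%N; split=> //.
  by rewrite q0 (dist0 m').
have bP j : P j -> (j <= k)%N by case/andP.
case: (ex_maxnP exP bP) => j /andP[jk /asboolP[s [st qs]]] jmax.
have cc x : 0 <= x -> x <= c * x by move=> x0; rewrite ler_peMl.
exists j => //; have [jk'|] := ltnP j k; last first.
  move=> kj; have jE : j = k by apply/eqP; rewrite eqn_leq jk.
  move: qs; rewrite jE qk => qs.
  have cge0 : 0 <= c by apply: le_trans c1.
  have h2 : d (p s) (p n) <= c * (2 * R1 + 1).
    by apply: (le_trans (dd' _ _)); rewrite ler_wpM2l // (distC m'); lra.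
  suff : d' (p t) (p n) <= c * (c * (2 * R1 + 1)) by lra.
  apply: (le_trans (d'd _ _)); rewrite ler_wpM2l //; apply: le_trans h2.
  by rewrite !gp ?tn ?leqnn ?(leq_trans st tn) // ler_nat leq_sub2l.
have [s' s'n qs'] := near _ _ _ _ gp gq q0 qk _ jk'.
have ts' : (t <= s')%N.
  rewrite leqNgt; apply/negP => s't.
  suff : (j.+1 <= j)%N by rewrite ltnn.
  by apply: jmax; rewrite /P jk'; apply/asboolP; exists s'; split=> //; apply: ltnW.
have ss' : d (p s) (p s') <= c * (2 * R1 + 1).
  apply: (le_trans (dd' _ _)); rewrite ler_wpM2l ?(le_trans _ c1) //.
  have := distT m' (q j) (p s) (p s'); have := distT m' (q j.+1) (q j) (p s').
  by rewrite gq ?leqnSn ?jk' // subSnn mulr1n (distC m' (p s) (q j)); lra.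
have st' : d' (p s) (p t) <= c * (c * (2 * R1 + 1)).
  apply: (le_trans (d'd _ _)); rewrite ler_wpM2l ?(le_trans _ c1) //.
  apply: le_trans ss'; rewrite !gp ?st ?(leq_trans st) //.
  by rewrite ler_nat leq_sub2r.
by have := distT m' (p s) (p t) (q j); rewrite (distC m' (p t) (p s)) (distC m' (p s) (q j)); lra.
Qed.

(** The witness is the point of [q1] at the same time [j], or the endpoint of [q1] if that comes
    earlier. *)
Lemma thin_side q q1 k k1 j : is_geod d' q k -> is_geod d' q1 k1 -> q1 0%N = q 0%N ->
  (j <= k)%N -> gromov_product d' (q j) (q 0%N) (q1 k1) <= delta ->
  exists2 i, (i <= k1)%N & d' (q j) (q1 i) <= 5 * delta.
Proof.
move=> gq gq1 q10 jk; rewrite /gromov_product !(distC m' _ (q j)) => gpj.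
have delta0' := delta0.
have dj : d' (q 0%N) (q j) = j%:R by rewrite gq ?subn0.
have dk1 : d' (q 0%N) (q1 k1) = k1%:R by rewrite -q10 gq1 ?subn0 ?leqnn.
exists (minn j k1); first exact: geq_minr.
have d1 : d' (q 0%N) (q1 (minn j k1)) = (minn j k1)%:R.
  by rewrite -q10 gq1 ?subn0 ?geq_minr.
have d2 : d' (q1 (minn j k1)) (q1 k1) = (k1 - minn j k1)%:R by rewrite gq1 ?geq_minr ?leqnn.
have := hyp (q 0%N) (q j) (q1 k1) (q1 (minn j k1)).
rewrite /gromov_product !(distC m' _ (q 0%N)) (distC m' (q1 k1)) dj dk1 d1 d2.
move: gpj; rewrite (distC m' (q j) (q 0%N)) dj dk1.
have := @natrB R _ _ (geq_minr j k1) => ->; rewrite minEle.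
have [_|/ltnW jk1] := leqP j k1; first by case: ifP => _; lra.
have : k1%:R <= j%:R :> R by rewrite ler_nat.
by case: ifP => _; lra.
Qed.

Hypothesis gd' : geod_connected d'.

Lemma path_thin : exists2 r, 0 <= r & forall p n p1 n1 p2 n2,
  is_geod d p n -> is_geod d p1 n1 -> is_geod d p2 n2 ->
  p1 0%N = p 0%N -> p2 0%N = p n -> p2 n2 = p1 n1 ->
  forall t, (t <= n)%N ->
    (exists2 i, (i <= n1)%N & d (p t) (p1 i) <= r) \/
    (exists2 i, (i <= n2)%N & d (p t) (p2 i) <= r).
Proof.
have [R1 R10 near] := geod_near_path; have [R2 R20 near'] := path_near_geod.
have c1' := c1; have delta0' := delta0.
exists (c * (R2 + 5 * delta + R1)); first by rewrite mulr_ge0; lra.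
move=> p n p1 n1 p2 n2 gp gp1 gp2 p10 p20 p2n t tn.
have [q [k [q0 qk gq]]] := gd' (p 0%N) (p n).
have [q1 [k1 [q10 q1k gq1]]] := gd' (p 0%N) (p1 n1).
have [q2 [k2 [q20 q2k gq2]]] := gd' (p n) (p1 n1).
have [j jk ptj] := near' _ _ _ _ gp gq q0 qk _ tn.
have side q' k' p' n' : is_geod d' q' k' -> is_geod d p' n' ->
    q' 0%N = p' 0%N -> q' k' = p' n' ->
    (exists2 i, (i <= k')%N & d' (q j) (q' i) <= 5 * delta) ->
    exists2 i, (i <= n')%N & d (p t) (p' i) <= c * (R2 + 5 * delta + R1).
  move=> gq' gp' q'0 q'k [i ik qi].
  have [s sn qs] := near _ _ _ _ gp' gq' q'0 q'k _ ik.
  exists s => //; apply: (le_trans (dd' _ _)); rewrite ler_wpM2l ?(le_trans _ c1) //.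
  by have := distT m' (q j) (p t) (p' s); have := distT m' (q' i) (q j) (p' s); lra.
have := hyp (q j) (q 0%N) (q1 k1) (q k).
have -> : gromov_product d' (q j) (q 0%N) (q k) = 0.
  rewrite /gromov_product (distC m' (q k) (q j)) !gq ?jk ?leqnn //.
  by rewrite !subn0 (natrB _ jk); lra.
rewrite minEle; case: ifP => _ h; [left|right].
  apply: (side q1 k1) => //; rewrite ?q10 ?p10 //.
  by apply: (@thin_side q q1 k k1 j) => //; [rewrite q10 q0|lra].
apply: (side q2 k2) => //; rewrite ?q20 ?p20 ?p2n //.
have := @thin_side (fun i => q (k - i)%N) q2 k k2 (k - j)%N.
rewrite subKn // subn0; apply => //; rewrite ?leq_subr ?q20 ?qk //.
  exact: is_geod_rev.
by move: h; rewrite /gromov_product q1k q2k qk (distC m' (p1 n1) (p n)); lra.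
Qed.

Hypothesis gd : geod_connected d.

(** Slim triangles give back the four-point condition because the Gromov product at [o] is, up to
    [2 * r + 1], the distance from [o] to a geodesic; this is the content of [low] and [up]. *)
Theorem quasi_isometry_hyperbolic : exists2 delta', 0 <= delta' & delta_hyperbolic d delta'.
Proof.
have [r r0 thin] := path_thin.
have low o p n t : is_geod d p n -> (t <= n)%N -> 
    gromov_product d o (p 0%N) (p n) <= d o (p t).
  move=> gp tn; rewrite /gromov_product.
  have := distT m (p t) (p 0%N) o; have := distT m (p t) (p n) o.
  rewrite (distC m (p n) (p t)) !gp ?tn ?leqnn // (distC m (p t) o).
  by rewrite !subn0 natrB //; lra.
have up o p n : is_geod d p n -> exists2 t, (t <= n)%N &
    d o (p t) <= gromov_product d o (p 0%N) (p n) + 2 * r + 1.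
  move=> gp; have [p1 [n1 [p10 p1n gp1]]] := gd (p 0%N) o.
  have [p2 [n2 [p20 p2n gp2]]] := gd (p n) o.
  have {}thin := thin _ _ _ _ _ _ gp gp1 gp2 p10 p20 (etrans p2n (esym p1n)).
  have one p' n' i t : is_geod d p' n' -> p' n' = o -> (i <= n')%N ->
      d (p t) (p' i) <= r -> d (p' 0%N) (p t) + d o (p t) <= d (p' 0%N) o + 2 * r.
    move=> gp' p'n i_n pti; have : d (p' 0%N) (p' i) + d (p' i) o = d (p' 0%N) o.
      by rewrite -p'n !gp' ?i_n ?leqnn // !subn0 natrB //; lra.
    have := distT m (p' i) (p' 0%N) (p t); have := distT m (p' i) o (p t).
    by rewrite (distC m (p' i) (p t)) (distC m o (p' i)); lra.
  (* At the last vertex of [p] close to the side [p1], either this vertex ends [p] or its successor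
     is close to the side [p2]. Up to bounded error, such a vertex lies near both sides issuing from
     [o], which bounds its distance to [o]. *)
  pose P t := (t <= n)%N && `[< exists2 i, (i <= n1)%N & d (p t) (p1 i) <= r >].
  have exP : exists t, P t.
    by exists 0%N; apply/andP; split=> //; apply/asboolP; exists 0%N; rewrite ?p10 ?(dist0 m).
  have bP t : P t -> (t <= n)%N by case/andP.
  case: (ex_maxnP exP bP) => t /andP[tn /asboolP[i i1 pti]] tmax.
  exists t => //; have := one _ _ _ _ gp1 p1n i1 pti; rewrite p10.
  have [s [sn st stp [i' i'2 psi']]] : exists s, [/\ (s <= n)%N, (t <= s)%N,
      (s <= t.+1)%N & exists2 i, (i <= n2)%N & d (p s) (p2 i) <= r].
    have [tn'|nt] := ltnP t n; last first.
      have -> : t = n by apply/eqP; rewrite eqn_leq tn.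
      by exists n; split=> //; exists 0%N; rewrite ?p20 ?(dist0 m).
    exists t.+1; split=> //; have [h|//] := thin _ tn'.
    suff : (t.+1 <= t)%N by rewrite ltnn.
    by apply: tmax; rewrite /P tn'; apply/asboolP.
  have := one _ _ _ _ gp2 p2n i'2 psi'; rewrite p20.
  have : d (p t) (p s) <= 1 by rewrite gp ?st // (_ : 1 = 1%:R) // ler_nat; move: stp; clear; lia.
  have := distT m (p s) o (p t); have := distT m (p s) (p n) (p t).
  rewrite /gromov_product (distC m (p s) (p t)) (distC m (p n) (p t)) (distC m (p n) (p s)).
  rewrite !gp ?st ?sn ?tn ?leqnn ?leq0n // !subn0 (natrB _ sn) (natrB _ tn) (natrB _ st).
  by rewrite (distC m (p 0%N) o) (distC m (p n) o); lra.
exists (3 * r + 1); first by lra.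
move=> o x y z; rewrite lerBlDr ge_min.
have [p [n [p0 pn gp]]] := gd x z; have [t tn pt] := up o p n gp.
have [p1 [n1 [p10 p1n gp1]]] := gd x y; have [p2 [n2 [p20 p2n gp2]]] := gd z y.
move: pt; rewrite p0 pn => pt.
case: (thin _ _ _ _ _ _ gp gp1 gp2 (etrans p10 (esym p0)) (etrans p20 (esym pn))
  (etrans p2n (esym p1n)) t tn) => [[i i1 ti]|[i i2 ti]]; apply/orP; [left|right].
  by have := low o _ _ _ gp1 i1; rewrite p10 p1n; have := distT m (p t) o (p1 i); lra.
have := low o _ _ _ gp2 i2; rewrite p20 p2n; have := distT m (p t) o (p2 i).
by rewrite /gromov_product (distC m z y); move: pt; rewrite /gromov_product; lra.
Qed.
End QuasiIsometry.

(** * Shortlex normal forms *)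

(** Letters are ordinals, so that they are ordered and the words of a given length form a finite
    type. The length is a field, characterised as a minimum by the last two fields, so that a given
    word length can be used as it stands. *)
Record marking (G : groupType) : Type := Marking {
  rank : nat;
  letter : 'I_rank -> G;
  wlen : G -> nat;
  wlen_ex : forall g, exists2 w, gprod (map letter w) = g & size w = wlen g;
  wlen_le : forall w, (wlen (gprod (map letter w)) <= size w)%N }.

Section Shortlex.
Variables (G : groupType) (M : marking G).
Local Notation k := (rank M).
Local Notation word := (seq 'I_k).
Implicit Types (w v z : word) (g h : G).

Definition ev w : G := gprod (map (@letter G M) w).

Lemma ev_nil : ev [::] = 1%g. Proof. exact: gprod_nil. Qed.
Lemma ev_cat w v : ev (w ++ v) = (ev w * ev v)%g.
Proof. by rewrite /ev map_cat gprod_cat. Qed.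
Lemma ev_rcons w i : ev (rcons w i) = (ev w * ev [:: i])%g.
Proof. by rewrite -cats1 ev_cat. Qed.

Lemma wlen_ev w : (wlen M (ev w) <= size w)%N. Proof. exact: wlen_le. Qed.

(* Bijective numeration in base k, which enumerates words in shortlex order;
   [lo n] is the smallest code of a word of length n. *)
Definition code w : nat := foldl (fun n (i : 'I_k) => n * k + i.+1)%N 0%N w.
Fixpoint lo n : nat := if n is n'.+1 then (1 + k * lo n')%N else 0%N.

Lemma code_rcons w i : code (rcons w i) = (code w * k + i.+1)%N.
Proof. by rewrite /code foldl_rcons. Qed.

Lemma code_cat w z : code (w ++ z) = (code w * k ^ size z + code z)%N.
Proof.
elim/last_ind: z => [|z i IH]; first by rewrite cats0 expn0 muln1 addn0.
by rewrite -rcons_cat !code_rcons IH size_rcons expnSr mulnDl -mulnA addnA.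
Qed.

Lemma loS n : lo n.+1 = (lo n + k ^ n)%N.
Proof.
by elim: n => [|n IH]; [rewrite /= muln0 | rewrite -[lo n.+2]/(1 + k * lo n.+1)%N {1}IH mulnDr addnA expnS].
Qed.

Lemma code_bounds w : (lo (size w) <= code w < lo (size w).+1)%N.
Proof.
elim/last_ind: w => [//|w i /andP[IH1 IH2]].
rewrite code_rcons size_rcons [lo _.+2]/=; move: IH2; rewrite /= => IH2.
move: (code w) (lo (size w)) IH1 IH2 (ltn_ord i) => c l h1 h2 h3.
by apply/andP; split; nia.
Qed.

Lemma leq_lo m n : (m <= n)%N -> (lo m <= lo n)%N.
Proof.
move=> /subnK <-; elim: (n - m)%N => [//|j IH].
by rewrite addSn loS (leq_trans IH) // leq_addr.
Qed.

Lemma size_code w v : (code w <= code v)%N -> (size w <= size v)%N.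
Proof.
move=> wv; rewrite leqNgt; apply/negP => vw.
have /andP[_ v2] := code_bounds v; have /andP[w1 _] := code_bounds w.
by have := leq_lo vw; move: wv v2 w1; clear; lia.
Qed.

Lemma code_inj w v : code w = code v -> w = v.
Proof.
elim/last_ind: w v => [|w i IH] v wv.
  by have /size_code : (code v <= code [::])%N by [rewrite -wv]; case: v {wv}.
case/lastP: v wv => [|v j] wv.
  by have /size_code : (code (rcons w i) <= code [::])%N; rewrite ?wv // size_rcons.
move: wv; rewrite !code_rcons => wv; have ik := ltn_ord i; have jk := ltn_ord j.
have wv' : code w = code v by move: (code w) (code v) wv => x y; nia.
rewrite (IH _ wv'); congr rcons; apply: val_inj => /=.
by move: wv; rewrite wv' => /addnI [].
Qed.

Lemma code_cat_lt w w' z z' : (code w' < code w)%N -> (size z' <= size z)%N ->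
  (code (w' ++ z') < code (w ++ z))%N.
Proof.
move=> ww' zz'; rewrite !code_cat.
have k0 : (0 < k)%N.
  by case: w ww' => [//|[i ik] w] _; apply: leq_ltn_trans ik.
have /andP[_] := code_bounds z'; rewrite loS => z2; have /andP[z1 _] := code_bounds z.
have := leq_lo zz'; have : (k ^ size z' <= k ^ size z)%N by rewrite leq_pexp2l.
move: (k ^ _)%N (k ^ _)%N (code w) (code w') (lo _) (lo _) (code z) (code z') z2 z1 ww'.
move=> q p c c' b a d d' z2 z1 cc' pq ab.
have : (c'.+1 * p <= c * q)%N by rewrite leq_mul.
by rewrite mulSn; move: z2 z1 ab; lia.
Qed.

Lemma code_cat_le w z z' : (code z' < code z)%N -> (code (w ++ z') < code (w ++ z))%N.
Proof.
case: w => [//|i w] zz'; rewrite !code_cat.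
have k0 : (0 < k)%N by case: i => [i ik]; apply: leq_ltn_trans ik.
have : (k ^ size z' <= k ^ size z)%N by rewrite leq_pexp2l // size_code // ltnW.
move: (k ^ _)%N (k ^ _)%N (code (i :: w)) zz' => q p c zz' pq.
by rewrite (leq_ltn_trans (leq_add (leq_mul (leqnn c) pq) (leqnn _))) // ltn_add2l.
Qed.

Definition slex w : bool := `[< forall v, ev v = ev w -> (code w <= code v)%N >].

Lemma slexP w : reflect (forall v, ev v = ev w -> (code w <= code v)%N) (slex w).
Proof. exact: asboolP. Qed.

Lemma nf_ex g : exists w, ev w = g /\ slex w.
Proof.
have ex : exists n, `[< exists2 w, ev w = g & code w = n >].
  by have [w wg _] := wlen_ex M g; exists (code w); apply/asboolP; exists w.
case: (ex_minnP ex) => n /asboolP[w wg wn] nmin; exists w; split=> //.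
by apply/slexP => v vw; rewrite wn; apply: nmin; apply/asboolP; exists v; rewrite ?vw.
Qed.

Definition nf g : word := sval (cid (nf_ex g)).
Lemma ev_nf g : ev (nf g) = g. Proof. by rewrite /nf; case: cid => w []. Qed.
Lemma slex_nf g : slex (nf g). Proof. by rewrite /nf; case: cid => w []. Qed.

Lemma slex_inj w v : slex w -> slex v -> ev w = ev v -> w = v.
Proof.
move=> /slexP lw /slexP lv wv; apply/code_inj/eqP.
by rewrite eqn_leq lw // lv.
Qed.

Lemma nf_slex w : slex w -> nf (ev w) = w.
Proof. by move=> lw; apply: slex_inj (slex_nf _) lw _; rewrite ev_nf. Qed.

Lemma size_slex w : slex w -> size w = wlen M (ev w).
Proof.
move=> /slexP lw; apply/eqP; rewrite eqn_leq wlen_ev andbT.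
by have [v vw <-] := wlen_ex M (ev w); apply/size_code/lw.
Qed.

Lemma size_nf g : size (nf g) = wlen M g.
Proof. by rewrite size_slex ?slex_nf // ev_nf. Qed.

Lemma slex_catl w z : slex (w ++ z) -> slex w.
Proof.
move=> /slexP lwz; apply/slexP => v vw; rewrite leqNgt; apply/negP => lt.
have /lwz : ev (v ++ z) = ev (w ++ z) by rewrite !ev_cat vw.
by rewrite leqNgt code_cat_lt.
Qed.

Lemma slex_catr w z : slex (w ++ z) -> slex z.
Proof.
move=> /slexP lwz; apply/slexP => v vz; rewrite leqNgt; apply/negP => lt.
have /lwz : ev (w ++ v) = ev (w ++ z) by rewrite !ev_cat vz.
by rewrite leqNgt code_cat_le.
Qed.

Lemma wlenM g h : (wlen M (g * h)%g <= wlen M g + wlen M h)%N.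
Proof.
by rewrite -[g in X in (X <= _)%N]ev_nf -[h in X in (X <= _)%N]ev_nf -ev_cat
  (leq_trans (wlen_ev _)) // size_cat !size_nf.
Qed.

Definition words n : seq word := [seq val t | t <- enum {: n.-tuple 'I_k}].

Lemma mem_words n w : (w \in words n) = (size w == n).
Proof.
apply/mapP/eqP => [[t _ ->]|<-]; first exact: size_tuple.
by exists (in_tuple w); rewrite ?mem_enum.
Qed.

Lemma uniq_words n : uniq (words n).
Proof. by rewrite map_inj_uniq ?enum_uniq //; apply: val_inj. Qed.

Definition ball n : seq G :=
  undup (flatten [seq [seq ev w | w <- words m] | m <- iota 0 n.+1]).

Lemma mem_ball n g : (g \in ball n) = (wlen M g <= n)%N.
Proof.
rewrite mem_undup; apply/flattenP/idP => [[s /mapP[m + ->] /mapP[w + ->]]|gn].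
  rewrite mem_iota add0n ltnS mem_words => mn /eqP wm.
  by rewrite (leq_trans (wlen_ev _)) // wm.
exists [seq ev w | w <- words (wlen M g)].
  by apply/mapP; exists (wlen M g); rewrite ?mem_iota.
by apply/mapP; exists (nf g); rewrite ?ev_nf // mem_words size_nf.
Qed.

Variables (R : realType) (delta : R).
Hypothesis H : hyplen (fun g => (wlen M g)%:R : R) delta.

(** Prefixes of two normal forms, with lengths differing by at most 2 and final endpoints at
    distance at most 1, are at distance at most [2 * delta + 4]; the radius exceeds this. *)
Let r : nat := (Num.truncn (2 * delta + 6)).+1.

Lemma wlenV g : wlen M g^-1%g = wlen M g.
Proof. by apply/eqP; rewrite -(eqr_nat R); apply/eqP/(lenV H). Qed.

Lemma slex_cat_closeness w z v1 v2 : slex (w ++ z) -> slex (v1 ++ v2) ->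
  (wlen M ((ev (w ++ z))^-1 * ev (v1 ++ v2))%g <= 1)%N ->
  (size v1 <= size w + 2)%N -> (size w <= size v1 + 2)%N ->
  (wlen M ((ev w)^-1 * ev v1)%g <= r)%N.
Proof.
move=> lwz lv e1 s1 s2; have lw := slex_catl lwz; have lv1 := slex_catl lv.
have lz := slex_catr lwz; have lv2 := slex_catr lv.
pose l g : R := (wlen M g)%:R.
have d0 := delta_ge0 H.
have ga : gp l (ev (w ++ z)) (ev w) = (size w)%:R.
  rewrite /gp /l -(size_slex lwz) size_cat ev_cat invgM mulgVK -(size_slex lw).
  by rewrite (lenV H) -(size_slex lz) natrD; lra.
have gb : gp l (ev (v1 ++ v2)) (ev v1) = (size v1)%:R.
  rewrite /gp /l -(size_slex lv) size_cat ev_cat invgM mulgVK -(size_slex lv1).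
  by rewrite (lenV H) -(size_slex lv2) natrD; lra.
have ga' : (size w)%:R - 1 <= gp l (ev w) (ev (v1 ++ v2)).
  have := gp_perturbr H (ev w) (ev (v1 ++ v2)) ((ev (v1 ++ v2))^-1 * ev (w ++ z))%g.
  rewrite mulVKg (gpC H _ (ev (w ++ z))) -/l ga.
  have : l ((ev (v1 ++ v2))^-1 * ev (w ++ z))%g <= 1.
    by rewrite /l -wlenV invgM invgK -[X in _ <= X]/(1%:R) ler_nat.
  lra.
have : (size w)%:R <= (size v1 + 2)%:R :> R by rewrite ler_nat.
have : (size v1)%:R <= (size w + 2)%:R :> R by rewrite ler_nat.
rewrite !natrD -(ler_nat R) => h1 h2.
apply: (@le_trans _ _ (2 * delta + 6)); last by rewrite ltW // truncnS_gt.
have : l ((ev w)^-1 * ev v1)%g = l (ev w) + l (ev v1) - 2 * gp l (ev w) (ev v1).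
  by rewrite /gp /l; lra.
rewrite {2 3}/l -(size_slex lw) -(size_slex lv1) -/(l _) => ->.
by case: (hyp4 H (ev w) (ev (v1 ++ v2)) (ev v1)); rewrite -/l ?gb; lra.
Qed.

(** The prefix [w] matters only through the elements of [ball r] leading to smaller prefixes. When a
    last letter is added to [z1], a smaller word [v] for the same element ends one letter away from
    the normal form [w ++ z1], hence fellow-travels it, and cutting [v] next to [w] produces such an
    element. *)
Lemma slex_cat_iff w z : slex w ->
  slex (w ++ z) <-> slex z /\
   (forall h, h \in ball r -> (code (nf (ev w * h)%g) < code w)%N ->
     (size z < wlen M (h^-1 * ev z)%g)%N).
Proof.
move=> lw; split=> [lwz|].
  split; first exact: slex_catr lwz.
  move=> h _ hw; rewrite ltnNge; apply/negP => hz.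
  have := slexP _ lwz (nf (ev w * h)%g ++ nf (h^-1 * ev z)%g).
  rewrite !ev_cat !ev_nf mulgA mulgK leqNgt code_cat_lt ?size_nf //.
  by move=> /(_ erefl).
elim/last_ind: z => [|z1 i IH]; first by rewrite cats0.
move=> [lz hz]; apply: contraT => nl.
have {IH} lwz1 : slex (w ++ z1).
  apply: IH; split=> [|h hr hw]; first by move: lz; rewrite -cats1 => /slex_catl.
  have := hz h hr hw; rewrite size_rcons ev_rcons mulgA => h1.
  have := wlenM (h^-1 * ev z1) (ev [:: i]); have := wlen_ev [:: i].
  by move: h1 => /=; move: (wlen M _) (wlen M _) (wlen M _) => a b c; lia.
pose v := nf (ev (w ++ rcons z1 i)); have lv : slex v := slex_nf _.
have vE : ev v = ev (w ++ rcons z1 i) := ev_nf _.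
have cv : (code v < code (w ++ rcons z1 i))%N.
  rewrite ltn_neqAle (slexP _ lv) ?vE // andbT; apply/eqP => /code_inj vw.
  by rewrite -vw lv in nl.
have sv := size_code (ltnW cv); rewrite size_cat size_rcons in sv.
have e1 : (wlen M ((ev (w ++ z1))^-1 * ev v)%g <= 1)%N.
  by rewrite vE -rcons_cat ev_rcons mulKg; apply: wlen_ev.
have sv' : (size w + size z1 <= size v + 1)%N.
  rewrite -size_cat (size_slex lwz1) (size_slex lv).
  have := wlenM (ev v) ((ev v)^-1 * ev (w ++ z1))%g; rewrite mulVKg => h1.
  rewrite (leq_trans h1) // leq_add2l.
  by rewrite -wlenV invgM invgK.
have [zv|vz] := leqP (size z1).+1 (size v).
  (* The cut leaves [size z1 + 1] letters, the length of the suffix [rcons z1 i] with which [v2] is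
     compared. *)
  pose v1 := take (size v - (size z1).+1) v; pose v2 := drop (size v - (size z1).+1) v.
  have v12 : v1 ++ v2 = v by apply: cat_take_drop.
  have s2 : size v2 = (size z1).+1 by rewrite /v2 size_drop subKn.
  have s1 : (size v1 + (size z1).+1 = size v)%N by rewrite -v12 size_cat s2.
  have lv1 : slex v1 by move: lv; rewrite -v12 => /slex_catl.
  have hr : ((ev w)^-1 * ev v1)%g \in ball r.
    rewrite mem_ball; apply: (@slex_cat_closeness w z1 v1 v2); rewrite ?v12 //.
      by move: sv s1; clear; lia.
    by move: sv' s1; clear; lia.
  have e2 : ev v2 = (((ev w)^-1 * ev v1)^-1 * ev (rcons z1 i))%g.
    have := vE; rewrite -v12 !ev_cat => e; rewrite invgM invgK -mulgA.
    by rewrite -e mulKg.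
  have := hz _ hr; rewrite mulVKg nf_slex // -e2 size_rcons -s2 => hz'.
  have [/hz'|ww] := ltnP (code v1) (code w).
    by rewrite ltnNge wlen_ev.
  move: ww; rewrite leq_eqVlt => /orP[/eqP/code_inj wv1|ww].
    move: cv; rewrite -v12 -wv1 !code_cat s2 size_rcons ltn_add2l ltnNge.
    move/slexP: lz => ->//.
    by apply: (@mulgI _ (ev w)); rewrite -!ev_cat -vE -v12 wv1.
  move: cv; rewrite -v12 ltnNge ltnW // code_cat_lt //.
  by rewrite s2 size_rcons.
(* [v] is too short to be cut there only if [w] has at most one letter. The competing prefix is then
   the empty word, reached by the inverse of [ev w]. *)
have s1 : (size w <= 1)%N by move: sv' vz; clear; lia.
have [w0|[j wj]] : w = [::] \/ exists j, w = [:: j].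
  by case: (w) s1 => [|j [|]] // _; [left|right; exists j].
  by move: nl; rewrite w0 lz.
have := hz (ev w)^-1%g; rewrite mem_ball wlenV (leq_trans (wlen_ev _)) ?(leq_trans s1) //.
rewrite mulgV (_ : nf 1%g = [::]); last first.
  by rewrite -ev_nil nf_slex //; apply/slexP.
rewrite invgK -ev_cat -vE -size_slex // size_rcons => /(_ isT).
rewrite {1}wj [code [:: j]]/= => /(_ isT).
by rewrite ltnNge ltnW.
Qed.

(** The states of a finite automaton: by [slex_cat_iff] these bits determine which continuations of
    a normal form [w] are again normal forms. *)
Definition state w : (size (ball r)).-tuple bool :=
  map_tuple (fun h => code (nf (ev w * h)%g) < code w)%N (in_tuple (ball r)).

Lemma state_residual w w' z : slex w -> slex w' -> state w = state w' ->
  slex (w ++ z) = slex (w' ++ z).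
Proof.
move=> lw lw' ss; have sh h : h \in ball r ->
    (code (nf (ev w * h)%g) < code w)%N = (code (nf (ev w' * h)%g) < code w')%N.
  move=> hr; have hi : (index h (ball r) < size (ball r))%N by rewrite index_mem.
  have := congr1 (fun t => nth false (val t) (index h (ball r))) ss.
  by rewrite /= !(nth_map 1%g) // nth_index.
by apply/idP/idP => /slex_cat_iff h; apply/slex_cat_iff => //; have [] := h _ => // lz hz;
  split=> // g gr gw; apply: hz => //; move: gw; rewrite sh.
Qed.
End Shortlex.

(** * Schottky pairs *)

(** The exponent is [x.2 + 1], so that no syllable is an empty power and only positive powers
    occur. *)
Definition syl (G : groupType) (A B : G) (x : bool * nat) : G :=
  ((if x.1 then A else B) ^+ x.2.+1)%g.

(** Ping-pong for the positive semigroup: syllables do not backtrack into each other, and powers of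
    [A] and of [B] fork at their start ([sch_pos]) and, read backwards, at their end ([sch_neg]). *)
Record schottky (R : realType) (G : groupType) (l : G -> R) (A B : G) (P D : R) : Prop :=
  Schottky {
    sch_turn : forall x y, gp l (syl A B x)^-1 (syl A B y) <= P;
    sch_pos : forall i j, gp l (A ^+ i.+1)%g (B ^+ j.+1)%g <= P;
    sch_neg : forall i j, gp l (A ^+ i.+1)^-1%g (B ^+ j.+1)^-1%g <= P;
    sch_len : forall x, D <= l (syl A B x) }.

Section Syllables.
Variables (R : realType) (G : groupType) (l : G -> R) (delta : R).
Hypothesis H : hyplen l delta.
Variables (A B : G) (P D : R).
Hypothesis S : schottky l A B P D.
Hypotheses (P0 : 0 <= P) (PD : 4 * P + 20 * delta < D).
Local Notation syl := (syl A B).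

Definition sylp (s : seq (bool * nat)) : G := gprod (map syl s).

Lemma sylp_cat s s' : sylp (s ++ s') = (sylp s * sylp s')%g.
Proof. by rewrite /sylp map_cat gprod_cat. Qed.
Lemma sylp_cons x s : sylp (x :: s) = (syl x * sylp s)%g.
Proof. exact: gprod_cons. Qed.

Let d0 := delta_ge0 H.
Let PD3 : 2 * P + 3 * delta < D.
Proof. by have d0' := d0; have P0' := P0; have PD' := PD; lra. Qed.

Lemma chain_syl x s h : gp l (syl (last x s))^-1 h <= P + delta ->
  chain l (P + delta) D (syl x) (map syl s ++ [:: h]).
Proof.
have d0' := d0; elim: s x => [|y s IH] x /= xh; first by split=> //; left.
split; [|by right; apply: (sch_len S)|exact: IH].
by have := sch_turn S x y; lra.
Qed.

Lemma chain_syl0 x s : chain l P D (syl x) (map syl s).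
Proof.
elim: s x => //= y s IH x; split=> //; first exact: (sch_turn S).
by right; apply: (sch_len S).
Qed.

Lemma gp_sylp_head x s : D - P - delta <= gp l (syl x) (sylp (x :: s)).
Proof.
have d0' := d0; have P0' := P0; have PD' := PD.
rewrite sylp_cons (gpK H).
have := chain_head H P0 PD3 (chain_syl0 x s); have := sch_len S x.
by rewrite -/(sylp s); lra.
Qed.

Lemma gp_sylp_last x s : D - P - delta <= gp l (sylp (x :: s))^-1 (syl (last x s))^-1.
Proof.
have d0' := d0; have P0' := P0; have PD' := PD.
case: s => [|y s].
  rewrite /sylp /= gprod_cons gprod_nil mulg1; have := sch_len S x.
  by rewrite /gp invgK mulgV (len1 H) !(lenV H) /=; lra.
rewrite sylp_cons -[X in (_ <= gp l _ X^-1)%R]/(syl (last y s)) -last_map.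
apply: (@chain_last _ _ _ _ H P D (syl x) (map syl (y :: s))) => //; try lra.
- exact: (sch_len S).
- exact: chain_syl0.
- by rewrite (last_map syl (y :: s) x); apply: (sch_len S).
Qed.

Lemma len_sylp_ge s : (\sum_(x <- s) l (syl x)) / 2 <= l (sylp s).
Proof.
have d0' := d0; have P0' := P0; have PD' := PD.
elim: s => [|x s IH]; first by rewrite big_nil mul0r (len_ge0 H).
rewrite big_cons sylp_cons mulrDl; have xD := sch_len S x.
by have := gprod_chain H P0 PD3 (chain_syl0 x s); rewrite -/(sylp s); lra.
Qed.

(** By [sch_pos] no element runs far along both [A] and [B], so one of the two can follow the
    inverse of [h] with a bounded turn. *)
Lemma left_connector h : exists b : bool, gp l h (syl (b, 0%N)) <= P + delta.
Proof.
have := sch_pos S 0 0; have := hyp4 H (A ^+ 1)%g h (B ^+ 1)%g.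
rewrite (gpC H (A ^+ 1)%g h) => -[h1|h1] h2; [exists true|exists false].
  by rewrite /syl /=; lra.
by rewrite /syl /=; lra.
Qed.

Lemma right_connector h : exists b : bool, gp l (syl (b, 0%N))^-1 h <= P + delta.
Proof.
have := sch_neg S 0 0; have := hyp4 H (A ^+ 1)^-1%g h (B ^+ 1)^-1%g.
rewrite (gpC H h) => -[h1|h1] h2; [exists true|exists false].
  by rewrite /syl /=; lra.
by rewrite /syl /=; lra.
Qed.

Lemma connected_gp g h b b' s1 s2 : gp l g^-1 (syl (b, 0%N)) <= P + delta ->
  gp l (syl (b', 0%N))^-1 h <= P + delta ->
  gp l (g * sylp ((b, 0%N) :: s1))^-1 (sylp (rcons s2 (b', 0%N)) * h)
    <= P + 3 * delta.
Proof.
have d0' := d0; have P0' := P0; have PD' := PD => gb bh.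
have := @chain_split _ _ _ _ H (P + delta) D g (syl (b, 0%N)) (map syl s1)
  (map syl (rcons s2 (b', 0%N)) ++ [:: h]).
rewrite gprod_cat gprod_cons gprod_nil mulg1 -/(sylp _) -/(sylp s1) -mulgA.
rewrite -sylp_cons => c.
apply: (@le_trans _ _ (P + delta + 2 * delta)); last by lra.
apply: c; try lra.
- exact: (sch_len S).
- by rewrite catA -map_cat; apply: chain_syl; rewrite last_cat last_rcons.
- by rewrite /nilp size_cat addn1.
Qed.

Lemma connected_gp0 g h b b' s : gp l g^-1 (syl (b, 0%N)) <= P + delta ->
  gp l (syl (b', 0%N))^-1 h <= P + delta ->
  gp l g^-1 (sylp (rcons ((b, 0%N) :: s) (b', 0%N)) * h) <= P + 3 * delta.
Proof.
have d0' := d0; have P0' := P0; have PD' := PD => gb bh.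
have := @chain_head _ _ _ _ H (P + delta) D g
   (map syl (rcons ((b, 0%N) :: s) (b', 0%N)) ++ [:: h]).
rewrite gprod_cat gprod_cons gprod_nil mulg1 -/(sylp _) => c.
apply: (@le_trans _ _ (P + delta + delta)); last by lra.
apply: c; try lra.
rewrite rcons_cons map_cons cat_cons; split=> //.
  by right; apply: (sch_len S).
by apply: chain_syl; rewrite last_rcons.
Qed.

(** Supplies the order of the two ends of a translate that [occurs_between] asks for. *)
Lemma len_connected_le g b s : gp l g^-1 (syl (b, 0%N)) <= P + delta ->
  l (g * syl (b, 0%N))%g <= l (g * sylp ((b, 0%N) :: s))%g.
Proof.
have d0' := d0; have P0' := P0; have PD' := PD => gb.
case: s => [|y s]; first by rewrite /sylp /= gprod_cons gprod_nil mulg1.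
have := @chain_split _ _ _ _ H (P + delta) D g (syl (b, 0%N)) [::]
  (map syl (y :: s)).
rewrite gprod_nil mulg1 -/(sylp _) => c.
rewrite sylp_cons mulgA [leRHS](lenD H).
have ly : D / 2 <= l (sylp (y :: s)).
  apply: le_trans (len_sylp_ge _); rewrite ler_pM2r ?invr_gt0 // big_cons.
  rewrite -[D]addr0 lerD ?(sch_len S) // sumr_ge0 // => i _.
  exact: (len_ge0 H).
suff : gp l (g * syl (b, 0%N))^-1 (sylp (y :: s)) <= l (sylp (y :: s)) / 2 by lra.
apply: (@le_trans _ _ (P + delta + 2 * delta)).
  apply: c; try lra; first exact: (sch_len S).
  rewrite [_ ++ _]/=; split; [by have := sch_turn S (b, 0%N) y; lra|by right; apply: (sch_len S)|].
  case/lastP: s {ly} => // s z; rewrite map_rcons -cats1; apply: chain_syl.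
    by have := sch_turn S (last y s) z; lra.
  by [].
by move: ly; lra.
Qed.
End Syllables.

(** * Points near a geodesic and occurrences of a translate *)

Section Betweenness.
Variables (R : realType) (G : groupType) (l : G -> R) (delta : R).
Hypothesis H : hyplen l delta.
Implicit Types a c g : G.

(* The Gromov product of 1 and g seen from a: up to an additive constant, the
   distance from a to a geodesic joining 1 to g. *)
Definition btw a g : R := gp l a^-1 (a^-1 * g).

Lemma gp_btw a g : gp l a g = l a - btw a g.
Proof. by rewrite /btw /gp invgK mulVKg (lenV H); lra. Qed.

(** The gap in length excludes the branch of the four-point condition in which, seen from [a], the
    points [c] and [g] lie in different directions. *)
Lemma btw_before a c g Q : btw a g <= Q -> btw c g <= Q ->
  l a + 2 * Q + delta < l c -> btw a c <= Q + delta.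
Proof.
move=> ag cg ac; have := hyp4 H a^-1%g (a^-1 * c)%g (a^-1 * g)%g.
rewrite -/(btw a g) -/(btw a c) => -[h|h]; last first.
  move: h cg; rewrite /btw /gp !invgK invgM !invgK -mulgA !mulVKg (lenV H).
  have := len_subl H a^-1%g c; have := len_subl H a^-1%g g; rewrite !(lenV H).
  by move: ag; rewrite /btw /gp invgK mulVKg (lenV H); lra.
by lra.
Qed.

Lemma btw_close a c g Q r : btw a g <= Q -> btw c g <= Q -> `|l a - l c| <= r ->
  l (a^-1 * c)%g <= r + 2 * Q + 2 * delta.
Proof.
rewrite ler_norml => ag cg /andP[r1 r2]; have := gp_btw a g; have := gp_btw c g.
have e : 2 * gp l a c = l a + l c - l (a^-1 * c)%g by rewrite /gp; lra.
by rewrite (gpC H c); case: (hyp4 H a g c); lra.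
Qed.
End Betweenness.

Section Occurrences.
Variables (R : realType) (G : groupType) (M : marking G) (delta : R).
Local Notation l := (fun g => (wlen M g)%:R : R).
Hypothesis H : hyplen l delta.

Implicit Types (w c : seq 'I_(rank M)).

(** The prefix of the same length as [z] is the point to compare with; it is cut off at the end of
    [w] because [z] may overshoot. *)
Lemma btw_near w z Q (r : nat) : slex w -> btw l z (ev w) <= Q ->
  2 * Q + 2 * delta <= r%:R ->
  (wlen M (z^-1 * ev (take (minn (wlen M z) (size w)) w))%g <= r)%N.
Proof.
move=> lw zw Qr; have d0 := delta_ge0 H.
have Q0 : 0 <= Q by apply: le_trans zw; apply: (gp_ge0 H).
set t := minn _ _; have lt : slex (take t w) by move: lw; rewrite -{1}(cat_take_drop t w) => /slex_catl.
have tw : (t <= size w)%N by apply: geq_minr.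
have zt : l (ev (take t w)) = t%:R by rewrite /= -size_slex // size_takel.
have g1 := gp_btw H z (ev w).
have g2 : gp l (ev w) (ev (take t w)) = t%:R.
  have e : ev w = (ev (take t w) * ev (drop t w))%g by rewrite -ev_cat cat_take_drop.
  rewrite e (gpC H) (gpK H) zt.
  have := lenD H (ev (take t w)) (ev (drop t w)); rewrite -e.
  rewrite -(size_slex lw) zt /= -(@size_slex _ _ (drop t w)); last first.
    by move: lw; rewrite -{1}(cat_take_drop t w) => /slex_catr.
  by rewrite size_drop natrB //; lra.
have e : 2 * gp l z (ev (take t w)) = (wlen M z)%:R + t%:R - l (z^-1 * ev (take t w))%g.
  by rewrite -zt /gp; lra.
rewrite -(ler_nat R); apply: le_trans Qr.
have [zs|sz] := leqP (wlen M z) (size w).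
  have tE : t = wlen M z by rewrite /t (minn_idPl zs).
  have tR : t%:R = (wlen M z)%:R :> R by rewrite tE.
  by case: (hyp4 H z (ev w) (ev (take t w))); move: g1 g2 e tR; clearbody t;
    move=> /= *; lra.
have tE : t = size w by rewrite /t (minn_idPr (ltnW sz)).
have : (size w)%:R <= (wlen M z)%:R :> R by rewrite ler_nat ltnW.
by move: g1 e; rewrite tE take_size /=; lra.
Qed.

(** The word need not spell [u]: its path passes within [r] of both ends of a translate of [u], a
    condition stable under the estimates of hyperbolic geometry. *)
Definition occurs (r : nat) (u : G) (w : seq 'I_(rank M)) : Prop :=
  exists f a b, [/\ infix f w, (wlen M a <= r)%N, (wlen M b <= r)%N &
    ev f = (a * u * b)%g].

Lemma occurs_between a u c Q (r : nat) : slex c ->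
  btw l a (ev c) <= Q -> btw l (a * u)%g (ev c) <= Q ->
  (wlen M a <= wlen M (a * u)%g)%N -> 2 * Q + 2 * delta <= r%:R -> occurs r u c.
Proof.
move=> lc ac auc aau Qr; have h1 := btw_near lc ac Qr; have h2 := btw_near lc auc Qr.
move: h1 h2; set s := minn _ _; set t := minn _ _ => h1 h2.
have st : (s <= t)%N by rewrite /s /t leq_min geq_minr andbT (leq_trans (geq_minl _ _)).
pose f := drop s (take t c).
have e : take t c = take s c ++ f by rewrite /f -[LHS](cat_take_drop s) take_takel.
exists f, ((ev (take s c))^-1 * a)%g, ((a * u)^-1 * ev (take t c))%g; split=> //.
- apply/infixP; exists (take s c), (drop t c).
  by rewrite -{1}(cat_take_drop t c) e catA.
- by rewrite -(wlenV H) invgM invgK.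
- by rewrite -(mulgA _ a u) -(mulgA _ (a * u)%g) mulVKg e ev_cat mulKg.
Qed.
End Occurrences.

(** * Joining arbitrary elements through a fixed word *)

Section Connectors.
Variables (R : realType) (G : groupType) (M : marking G) (delta : R).
Local Notation l := (fun g => (wlen M g)%:R : R).
Hypothesis H : hyplen l delta.
Variables (A B : G) (P D : R).
Hypothesis S : schottky l A B P D.
Hypotheses (P0 : 0 <= P) (PD : 4 * P + 20 * delta < D).
Variable s : seq (bool * nat).
Implicit Types (w v : seq 'I_(rank M)) (g h : G).

Let lb g := sval (cid (left_connector H S g^-1)).
Let rb h := sval (cid (right_connector H S h)).
Let lbP g : gp l g^-1 (syl A B (lb g, 0%N)) <= P + delta.
Proof. by rewrite (gpC H) /lb; case: cid => b /=; rewrite (gpC H). Qed.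
Let rbP h : gp l (syl A B (rb h, 0%N))^-1 h <= P + delta.
Proof. by rewrite /rb; case: cid. Qed.

Let cw b b' := sylp A B (rcons ((b, 0%N) :: s) (b', 0%N)).

(** The outer letters of the middle word are chosen according to [g] and [h], to make both junctions
    turn little; only four middle words can arise. *)
Definition conn g h : G := (g * cw (lb g) (rb h) * h)%g.

Definition connectors : seq G := [seq cw b b' | b <- [:: true; false], b' <- [:: true; false]].

Lemma connE g h : exists2 c, c \in connectors & conn g h = (g * c * h)%g.
Proof.
exists (cw (lb g) (rb h)) => //; apply/allpairsP.
by exists (lb g, rb h); split=> //=; [case: (lb g) | case: (rb h)].
Qed.

Let Q := P + 3 * delta.

Lemma btw_conn g h : btw l g (conn g h) <= Q.
Proof.
rewrite /btw /conn -mulgA mulKg.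
exact: (connected_gp0 H S P0 PD s (lbP g) (rbP h)).
Qed.

Lemma btw_conn_syl g h : btw l (g * syl A B (lb g, 0%N))%g (conn g h) <= Q.
Proof.
have := connected_gp H S P0 PD [::] s (lbP g) (rbP h).
rewrite /btw /conn sylp_cons {1}/sylp gprod_nil mulg1 => h1.
rewrite /cw rcons_cons sylp_cons; set x := syl _ _ _ in h1 *.
by rewrite (_ : g * (x * _) * h = g * x * (sylp A B (rcons s (rb h, 0%N)) * h))%g
  ?mulKg // !mulgA.
Qed.

Lemma btw_conn_occ g h :
  btw l (g * syl A B (lb g, 0%N) * sylp A B s)%g (conn g h) <= Q.
Proof.
have := connected_gp H S P0 PD s [::] (lbP g) (rbP h).
rewrite /btw /conn sylp_cons mulgA => h1.
rewrite /cw rcons_cons sylp_cons -cats1 sylp_cat; set x := syl _ _ _ in h1 *.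
set y := sylp _ _ [:: _] in h1 *; set u := sylp _ _ s in h1 *.
by rewrite (_ : g * (x * (u * y)) * h = g * x * u * (y * h))%g ?mulKg // !mulgA.
Qed.

(** Both [ev w] and [ev v] lie near a geodesic to the common product. If [v] were much longer than
    [w], this geodesic would follow the translate inserted after [w] before reaching [v], and the
    translate would occur in [v]. Hence the lengths are comparable and the two points are close:
    concatenation is unambiguous up to bounded error. *)
Lemma conn_step (r : nat) : 2 * Q + 4 * delta <= r%:R -> exists n2 : nat,
  forall w v g h, slex w -> slex v ->
    size w = size v \/ (~ occurs r (sylp A B s) w /\ ~ occurs r (sylp A B s) v) ->
    conn (ev w) g = conn (ev v) h -> (wlen M ((ev w)^-1 * ev v)%g <= n2)%N.
Proof.
have d0 := delta_ge0 H; have P0' := P0 => Qr.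
(* Bounds the length from [w] to the end of the translate, plus the margin [2 * Q + delta] required
   by [btw_before]. *)
pose c := l A + l B + l (sylp A B s) + 2 * Q + delta.
have Q0 : 0 <= Q by rewrite /Q; lra.
have lge0 g : 0 <= l g by apply: (len_ge0 H).
have key w v g h : slex w -> slex v -> ~ occurs r (sylp A B s) v ->
    conn (ev w) g = conn (ev v) h -> l (ev v) - l (ev w) <= c.
  move=> lw lv nv e; rewrite leNgt; apply/negP => big; apply: nv.
  have b1 := btw_conn_syl (ev w) g; have b2 := btw_conn_occ (ev w) g.
  have b3 := btw_conn (ev v) h; rewrite -e in b3.
  set a := (ev w * _)%g in b1 b2.
  have la : l a <= l (a * sylp A B s)%g.
    by have := len_connected_le H S P0 PD s (lbP (ev w)); rewrite sylp_cons mulgA.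
  have la' : l (a * sylp A B s)%g <= l (ev w) + l A + l B + l (sylp A B s).
    have := lenM H a (sylp A B s); have := lenM H (ev w) (syl A B (lb (ev w), 0%N)).
    rewrite -/a /syl /= expg1; have := lge0 A; have := lge0 B.
    by case: (lb _); lra.
  apply: (occurs_between H lv (btw_before H b1 b3 _) (btw_before H b2 b3 _)).
  - by move: big; rewrite /c; lra.
  - by move: big; rewrite /c; lra.
  - by rewrite -(ler_nat R).
  - by move: Qr; lra.
exists (Num.truncn (c + 2 * Q + 2 * delta)).+1 => w v g h lw lv cond e.
rewrite -(ler_nat R); apply: (@le_trans _ _ (c + 2 * Q + 2 * delta)); last first.
  by rewrite ltW // truncnS_gt.
have c0 : 0 <= c.
  have := lge0 A; have := lge0 B; have := lge0 (sylp A B s); rewrite /c; lra.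
have b1 := btw_conn (ev w) g; have b2 := btw_conn (ev v) h; rewrite -e in b2.
apply: (btw_close H b1 b2); rewrite ler_norml.
case: cond => [sE|[nw nv]].
  by rewrite -!size_slex // sE; apply/andP; split; lra.
have := key _ _ _ _ lw lv nv e; have := key _ _ _ _ lv lw nw (esym e).
by move=> h1 h2; apply/andP; split; lra.
Qed.
End Connectors.

(** * Growth of the language of normal forms *)

Section Kraft.
Variables (R : realType) (G : groupType) (M : marking G).
Variables (cn : G -> G -> G) (cs : seq G) (n2 c0 : nat).
Hypothesis cnE : forall g h, exists2 c, c \in cs & cn g h = (g * c * h)%g.
Hypothesis cs_le : forall c, c \in cs -> (wlen M c <= c0)%N.
Variable E : seq (seq 'I_(rank M)).
Hypotheses (uE : uniq E) (lE : all (@slex G M) E).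
Hypothesis stepE : forall w v g h, w \in E -> v \in E ->
  cn (ev w) g = cn (ev v) h -> (wlen M ((ev w)^-1 * ev v)%g <= n2)%N.

(* For z below the critical value the powers of the weight of E are, up to the
   multiplicity m ^ j, partial sums of the convergent growth series; letting j
   grow bounds the weight itself by m. *)
Let m := (size (ball M n2) * size cs)%N.

Fixpoint concatenations j : seq G :=
  if j is j'.+1 then [seq cn (ev w) h | w <- E, h <- concatenations j'] else [:: 1%g].

(** Each step contributes a factor [m]: the first normal form lies within [n2] of a fixed one, the
    connector is one of [cs], and together with [g] these determine the value of the remaining
    factor. *)
Lemma count_concatenations j g : (count_mem g (concatenations j) <= m ^ j)%N.
Proof.
elim: j g => [|j IH] g; first by rewrite expn0 /= addn0; case: (_ == _).
rewrite expnS /= count_flatten -map_comp sumnE big_map.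
have [|] := boolP (has (fun w => has (fun h => cn (ev w) h == g) (concatenations j)) E);
    last first.
  move=> /hasPn no; rewrite big_seq big1 // => w wE /=; rewrite count_map.
  by apply/eqP; rewrite -leqn0 leqNgt -has_count; exact: no.
move=> /hasP[w0 w0E /hasP[h0 _ /eqP g0]].
have bnd w : w \in E -> (count_mem g [seq cn (ev w) h | h <- concatenations j] <=
    (((ev w0)^-1 * ev w)%g \in ball M n2) * (size cs * m ^ j))%N.
  move=> wE; rewrite count_map; case: (boolP (_ \in _)) => [_|nb]; last first.
    rewrite leqn0 -leqn0 leqNgt -has_count; apply/hasPn => h _ /=.
    apply: contra nb => /eqP e; rewrite mem_ball.
    by apply: (stepE w0E wE (g := h0) (h := h)); rewrite e g0.
  rewrite mul1n; apply: (@leq_trans (\sum_(c <- cs)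
     count_mem (c^-1 * ((ev w)^-1 * g))%g (concatenations j))%N); last first.
    by rewrite -sum1_size big_distrl /=; apply: leq_sum => c _; rewrite mul1n IH.
  elim: (concatenations j) => [|h hs IHs]; first by rewrite /= leq0n.
  rewrite /= big_split /=; apply: leq_add => //.
  case: eqP => // e; have [c cin cE] := cnE (ev w) h.
  rewrite (big_rem c) //= (_ : _ == _) // -e cE -!mulgA !mulKg.
  by apply/eqP.
rewrite big_seq (leq_trans (leq_sum _ bnd)) // -big_seq -big_distrl /=.
rewrite mulnA leq_mul2r; apply/orP; right.
rewrite leq_mul2r; apply/orP; right.
rewrite (_ : \sum_(w <- E) _ = count (fun w => (ev w0)^-1 * ev w \in ball M n2)%g E)%N;
  last first.
  by rewrite -sum1_count [RHS]big_mkcond; apply: eq_bigr => w _; case: (_ \in _).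
rewrite -size_filter -(size_map (fun w => (ev w0)^-1 * ev w)%g); apply: uniq_leq_size.
  rewrite map_inj_in_uniq ?filter_uniq // => w v; rewrite !mem_filter.
  move=> /andP[_ wE] /andP[_ vE] /mulgI; apply: slex_inj; exact: (allP lE).
by move=> g1 /mapP[w]; rewrite mem_filter => /andP[wb _] ->.
Qed.

Lemma concatenations_weight z j : 0 <= z <= 1 ->
  (z ^+ c0 * \sum_(w <- E) z ^+ size w) ^+ j <=
    \sum_(g <- concatenations j) z ^+ wlen M g :> R.
Proof.
move=> /andP[z0 z1]; elim: j => [|j IH].
  rewrite expr0 big_seq1 (_ : wlen M 1 = 0)%N ?expr0 //.
  by apply/eqP; have := wlen_ev (M := M) [::]; rewrite ev_nil leqn0.
rewrite exprS (le_trans (ler_wpM2l _ IH)) //.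
  by rewrite mulr_ge0 ?exprn_ge0 // sumr_ge0 // => w _; rewrite exprn_ge0.
rewrite /= big_allpairs_dep -mulrA mulr_suml mulr_sumr ler_sum // => w _.
rewrite !mulr_sumr ler_sum // => h _; rewrite mulrA -!exprD ler_wiXn2l //.
have [c cin ->] := cnE (ev w) h.
rewrite (leq_trans (wlenM _ _ _)) // leq_add2r (leq_trans (wlenM _ _ _)) // addnC.
by rewrite leq_add ?cs_le ?wlen_ev.
Qed.

Lemma kraft (z T : R) : 0 <= z <= 1 ->
  (forall gs : seq G, uniq gs -> \sum_(g <- gs) z ^+ wlen M g <= T) ->
  z ^+ c0 * \sum_(w <- E) z ^+ size w <= m%:R.
Proof.
move=> z01 zT; have z0 : 0 <= z by case/andP: z01.
have up j : (z ^+ c0 * \sum_(w <- E) z ^+ size w) ^+ j <= m%:R ^+ j * T.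
  apply: (le_trans (concatenations_weight j z01)).
  rewrite -(perm_big _ (perm_count_undup _)) /= big_flatten big_map.
  have /zT uT := undup_uniq (concatenations j).
  apply: le_trans (ler_wpM2l (exprn_ge0 _ (ler0n R m)) uT).
  rewrite mulr_sumr big_seq [leRHS]big_seq ler_sum // => g _.
  rewrite big_nseq iter_addr_0 -[leLHS]mulr_natl.
  by rewrite ler_wpM2r ?exprn_ge0 // -natrX ler_nat count_concatenations.
rewrite leNgt; apply/negP; move: up; move: (_ * \sum_(w <- E) _) => x up mx.
have m0 := ler0n R m.
have [m00|m1] := eqVneq m 0%N.
  have := up 1%N; rewrite m00 !expr1 mul0r; move: mx; rewrite m00; lra.
have {m1} m1 : 0 < m%:R :> R by rewrite ltr0n lt0n.
(* If the weight exceeded [m], its ratio to [m] would be [1 + e] with [e > 0], and by Bernoulli's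
   inequality the powers of this ratio would outgrow [T]. *)
pose e := x / m%:R - 1; have e0 : 0 < e by rewrite subr_gt0 ltr_pdivlMr // mul1r.
have bern j : 1 + j%:R * e <= (x / m%:R) ^+ j.
  elim: j => [|j IHj]; first by rewrite mul0r addr0 expr0.
  rewrite exprS -natr1; have : 0 <= j%:R * e * e by rewrite !mulr_ge0 // ltW.
  have -> : x / m%:R = 1 + e by rewrite /e; ring.
  by move: IHj; have -> : x / m%:R = 1 + e by [rewrite /e; ring]; nra.
have [j jT] : exists j : nat, (T / e) < j%:R by exists (Num.truncn (T / e)).+1; rewrite truncnS_gt.
have := bern j; rewrite expr_div_n ler_pdivlMr ?exprn_gt0 // => b.
have := le_trans b (up j); rewrite mulrC ler_pM2l ?exprn_gt0 //.
by move: jT; rewrite ltr_pdivrMr //; lra.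
Qed.
End Kraft.

Lemma ler_sum_subset (R : realDomainType) (T : eqType) (s1 s2 : seq T) (F : T -> R) :
  uniq s1 -> uniq s2 -> {subset s1 <= s2} -> (forall x, 0 <= F x) ->
  \sum_(x <- s1) F x <= \sum_(x <- s2) F x.
Proof.
move=> u1 u2 s12 F0; have e : perm_eq [seq x <- s2 | x \in s1] s1.
  apply: uniq_perm; rewrite ?filter_uniq // => x; rewrite mem_filter.
  by case: (boolP (x \in s1)) => // /s12.
rewrite [leRHS](bigID (mem s1)) /= -[X in _ <= X + _]big_filter (perm_big _ e) /=.
by rewrite lerDl sumr_ge0.
Qed.

Lemma bernoulli (R : realDomainType) (x : R) n : x <= 1 -> 1 - n%:R * x <= (1 - x) ^+ n.
Proof.
move=> x1; elim: n => [|n IH]; first by rewrite mul0r subr0 expr0.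
rewrite exprS -natr1; apply: (@le_trans _ _ ((1 - x) * (1 - n%:R * x))); last first.
  by rewrite ler_wpM2l // subr_ge0.
have : 0 <= n%:R * x ^+ 2 by rewrite mulr_ge0 // sqr_ge0.
by rewrite expr2; lra.
Qed.

(** * Growth series and the critical exponent *)

Section Growth.
Variables (R : realType) (G : groupType) (M : marking G).
Local Notation word := (seq 'I_(rank M)).
Implicit Types (w v : word) (f : word -> R).

Definition lw n : seq word := [seq w <- words M n | slex w].
Definition nu n : nat := size (lw n).

Lemma mem_lw n w : (w \in lw n) = slex w && (size w == n).
Proof. by rewrite mem_filter mem_words. Qed.

Lemma uniq_lw n : uniq (lw n).
Proof. by rewrite filter_uniq ?uniq_words. Qed.

(** Cutting after [a] letters embeds normal forms into pairs of normal forms; not every pair arises,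
    hence only an inequality. *)
Lemma sum_lw_cat a n f (g : word -> R) : (forall w, 0 <= f w) -> (forall w, 0 <= g w) ->
  \sum_(w <- lw (a + n)) f (take a w) * g (drop a w) <=
  (\sum_(w <- lw a) f w) * (\sum_(w <- lw n) g w).
Proof.
move=> f0 g0; rewrite mulr_suml; under [leRHS]eq_bigr do rewrite mulr_sumr.
rewrite -(big_allpairs (F := fun x => f x.1 * g x.2)).
rewrite -(big_map (fun w => (take a w, drop a w)) xpredT (fun x => f x.1 * g x.2)).
apply: ler_sum_subset => [||x|x]; last by rewrite mulr_ge0.
- rewrite map_inj_uniq ?uniq_lw // => w v [t d].
  by rewrite -(cat_take_drop a w) t d cat_take_drop.
- by rewrite allpairs_uniq ?uniq_lw // => -[? ?] [? ?].
- move=> /mapP[w]; rewrite mem_lw => /andP[lw' /eqP sw] ->.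
  apply/allpairsP; exists (take a w, drop a w); split=> //=; rewrite mem_lw.
    rewrite size_takel ?sw ?leq_addr // eqxx andbT.
    by move: lw'; rewrite -{1}(cat_take_drop a w) => /slex_catl.
  rewrite size_drop sw addKn eqxx andbT.
  by move: lw'; rewrite -{1}(cat_take_drop a w) => /slex_catr.
Qed.

Lemma sum_nu n : \sum_(w <- lw n) (1 : R) = (nu n)%:R.
Proof. by rewrite big_const_seq count_predT iter_addr_0. Qed.

Lemma nuD a n : (nu (a + n))%:R <= (nu a)%:R * (nu n)%:R :> R.
Proof.
rewrite -!sum_nu; apply: le_trans (sum_lw_cat _ _ _ _) => //.
by under [leRHS]eq_bigr do rewrite mulr1.
Qed.

Lemma sum_wlen_le (z : R) (gs : seq G) n : 0 <= z -> uniq gs ->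
  (forall g, g \in gs -> (wlen M g < n)%N) ->
  \sum_(g <- gs) z ^+ wlen M g <= \sum_(i < n) (nu i)%:R * z ^+ i.
Proof.
move=> z0; elim: n gs => [|n IH] gs ugs gn.
  by case: gs gn {ugs} => [|g gs] => [_|/(_ g (mem_head _ _))//]; rewrite big_nil big_ord0.
rewrite (bigID (fun g => wlen M g < n)%N) /= big_ord_recr /= lerD //.
  rewrite -big_filter IH ?filter_uniq // => g; by rewrite mem_filter => /andP[].
rewrite -big_filter; set gs' := [seq _ <- gs | _].
have gs'n g : g \in gs' -> wlen M g = n.
  rewrite mem_filter -leqNgt => /andP[ng /gn]; rewrite ltnS => gn'.
  by apply/eqP; rewrite eqn_leq gn'.
rewrite big_seq (eq_bigr (fun=> z ^+ n)); last by move=> g /gs'n ->.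
rewrite -big_seq big_const_seq count_predT iter_addr_0 -[leLHS]mulr_natl.
rewrite ler_wpM2r ?exprn_ge0 // ler_nat -(size_map (@nf G M)).
apply: uniq_leq_size => [|w /mapP[g ggs ->]].
  rewrite map_inj_in_uniq ?filter_uniq // => g h _ _ e.
  by rewrite -(ev_nf M g) e ev_nf.
by rewrite mem_lw slex_nf size_nf (gs'n _ ggs) eqxx.
Qed.

Hypothesis unb : forall n, exists g, (n <= wlen M g)%N.

Lemma nu_ge1 n : (1 <= nu n)%N.
Proof.
have [h ng] := unb n; rewrite -has_predT; apply/hasP; exists (take n (nf M h)) => //.
rewrite mem_lw size_takel ?size_nf // eqxx andbT.
by have := slex_nf M h; rewrite -{1}(cat_take_drop n (nf M h)) => /slex_catl.
Qed.

(** [zs] is the supremum of the z at which some term of positive index of the growth series is below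
    1. By submultiplicativity one such term makes the series converge geometrically, block by block.
    At [zs] itself no term is below 1, as a slightly larger z would then still be admissible. *)
Lemma critical_exponent : exists zs : R, [/\ 0 < zs <= 1,
  forall n, 1 <= (nu n)%:R * zs ^+ n &
  forall z, 0 <= z < zs -> exists T, forall gs : seq G, uniq gs ->
    \sum_(g <- gs) z ^+ wlen M g <= T].
Proof.
pose Z := [set z : R | 0 <= z /\ exists2 n, (0 < n)%N & (nu n)%:R * z ^+ n < 1].
have nu1 n : 1 <= (nu n)%:R :> R by rewrite ler1n nu_ge1.
have Zub : ubound Z 1.
  move=> z [z0 [n n0]]; apply: contraTT; rewrite -leNgt -ltNge => z1.
  by rewrite mulr_ege1 // exprn_ege1 // ltW.
have Zpos : Z (1 / ((nu 1)%:R + 1)).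
  have n1 := nu1 1%N; split; first by rewrite divr_ge0 //; lra.
  by exists 1%N => //; rewrite expr1 mulrA mulr1 ltr_pdivrMr; lra.
have Zsup : has_sup Z by split; [exists (1 / ((nu 1)%:R + 1)) | exists 1].
have zs0 : 0 < sup Z.
  apply: (@lt_le_trans _ _ (1 / ((nu 1)%:R + 1))); last exact: ub_le_sup Zsup.2 _ _.
  by rewrite divr_gt0 // ltr_wpDl.
exists (sup Z); split.
- by rewrite zs0 /=; apply: ge_sup Zsup.1 _.
- move=> n; have [->|] := eqVneq n 0%N; first by rewrite expr0 mulr1.
  rewrite -lt0n leNgt => n0; apply/negP => y1.
  set y := (_ * _) in y1; have y0 : 0 < y.
    by rewrite mulr_gt0 ?exprn_gt0 // ltr0n nu_ge1.
  have nR : 1 <= n%:R :> R by rewrite ler1n.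
  (* Chosen so that [(1 - x) ^+ n] is at least [1 - n * x = (1 + y) / 2], which exceeds [y]; this
     puts [sup Z / (1 - x)] into [Z]. *)
  pose x := (1 - y) / (2 * n%:R).
  have nx : n%:R * x = (1 - y) / 2 by rewrite /x; field; lra.
  have x0 : 0 < x by rewrite /x divr_gt0 //; lra.
  have x1 : x <= 1 by move: nx; have := ler_wpM2r (ltW x0) nR; lra.
  have xn1 : x < 1 by move: nx; have := ler_wpM2r (ltW x0) nR; lra.
  have b := bernoulli n x1; have xp : 0 < (1 - x) ^+ n by rewrite exprn_gt0 // subr_gt0.
  have : Z (sup Z / (1 - x)).
    split; first by rewrite divr_ge0 ?subr_ge0 // ltW.
    exists n => //; rewrite expr_div_n mulrA ltr_pdivrMr // mul1r -/y.
    by apply: lt_le_trans b; rewrite nx; lra.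
  move=> /(ub_le_sup Zsup.2); rewrite ler_pdivrMr ?subr_gt0 //.
  by have := mulr_gt0 zs0 x0; lra.
- move=> z /andP[z0 zlt].
  have e0 : 0 < sup Z - z by rewrite subr_gt0.
  have [z1 [z10 [n n0 nz1]]] := sup_adherent e0 Zsup; rewrite subKr => zz1.
  have nzn : (nu n)%:R * z ^+ n < 1.
    by apply: le_lt_trans nz1; rewrite ler_wpM2l // lerXn2r ?nnegrE //; lra.
  pose S m := \sum_(i < m) (nu i)%:R * z ^+ i.
  have t0 i : 0 <= (nu i)%:R * z ^+ i by rewrite mulr_ge0 ?exprn_ge0.
  have SD m p : S (m + p)%N = S m + \sum_(i < p) (nu (m + i))%:R * z ^+ (m + i).
    by rewrite /S big_split_ord.
  have S0 m : 0 <= S m by rewrite sumr_ge0.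
  have Sle m : S m <= S n / (1 - (nu n)%:R * z ^+ n).
    rewrite ler_pdivlMr ?subr_gt0 // mulrBr mulr1 lerBlDr.
    apply: (@le_trans _ _ (S (m + n)%N)); first by rewrite SD lerDl sumr_ge0.
    rewrite addnC SD lerD2l mulr_suml ler_sum // => i _.
    apply: (le_trans (ler_wpM2r (exprn_ge0 (n + i) z0) (nuD n i))).
    by rewrite exprD mulrACA mulrC.
  exists (S n / (1 - (nu n)%:R * z ^+ n)) => gs ugs.
  pose m := (\max_(g <- gs) wlen M g).+1.
  apply: le_trans (Sle m); apply: sum_wlen_le => // g ggs.
  by rewrite ltnS; apply: leq_bigmax_seq.
Qed.

Section Few.
Variables (zs : R) (free : pred word) (C : R).
Hypotheses (zs0 : 0 < zs <= 1) (nuzs : forall n, 1 <= (nu n)%:R * zs ^+ n) (C1 : 1 <= C).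
Hypothesis nuC : forall n, (nu n)%:R * zs ^+ n <= C.
Hypothesis freeC : forall N, \sum_(b < N) (count free (lw b))%:R * zs ^+ b <= C.

Fixpoint fcount b m (w : word) : nat :=
  if m is m'.+1 then (free (take b w) + fcount b m' (drop b w))%N else 0%N.

Lemma rare_free theta : 0 < theta ->
  exists2 b, (0 < b)%N & (count free (lw b))%:R * zs ^+ b <= theta.
Proof.
have z0 : 0 < zs by case/andP: zs0.
move=> t0; apply: contrapT => no.
have big b : (0 < b)%N -> theta <= (count free (lw b))%:R * zs ^+ b.
  by move=> b0; rewrite leNgt; apply/negP => lt; apply: no; exists b => //; apply: ltW.
have [n nC] : exists n : nat, C / theta < n%:R.
  by exists (Num.truncn (C / theta)).+1; rewrite truncnS_gt.
have := freeC n.+1; rewrite leNgt => /negP[].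
rewrite big_ord_recl /= (@lt_le_trans _ _ (n%:R * theta)) //.
  by rewrite -ltr_pdivrMr.
have zp i : 0 <= zs ^+ i by rewrite exprn_ge0 // ltW.
rewrite -[leLHS]add0r lerD ?mulr_ge0 //.
rewrite mulr_natl -[n in theta *+ n]card_ord -sumr_const ler_sum // => i _.
exact: big.
Qed.

(** An exponential moment bound: free blocks receive an extra weight, the weighted sum factors over
    blocks by [sum_lw_cat], and Markov's inequality concludes. *)
Lemma few_occurrences : exists2 b, (0 < b)%N & forall m p,
  (count (fun w => m <= 2 * fcount b m w)%N (lw (m * b + p)))%:R * 2 ^+ m <=
    C * (nu (m * b + p))%:R.
Proof.
have [z0 z1] := andP zs0; have C1' := C1.
(* With [theta = C / y ^ 2], free blocks weighted by [y ^ 2] contribute at most [C] at [zs], so a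
   block has total weight at most [2 * C]. A word with [m <= 2 * fcount] weighs at least [y ^ m],
   and [2 * C / y = 1 / 2] is the gain per block. *)
pose y := 4 * C; have y1 : 1 <= y by rewrite /y; lra.
have y0 : 0 < y by lra.
have th0 : 0 < C / y ^+ 2 by rewrite divr_gt0 ?exprn_gt0 //; lra.
have [b b0 bt] := rare_free th0; exists b => // m p.
pose q := (nu b)%:R + y ^+ 2 * (count free (lw b))%:R.
have qz : q * zs ^+ b <= 2 * C.
  rewrite mulrDl; have := nuC b; move: bt; rewrite ler_pdivlMr ?exprn_gt0 //.
  by move: (zs ^+ b) => x; lra.
have q0 : 0 <= q by rewrite addr_ge0 // mulr_ge0 // exprn_ge0 // ltW.
have sumq : \sum_(w <- lw b) y ^+ (2 * free w) <= q.
  apply: (@le_trans _ _ (\sum_(w <- lw b) (1 + y ^+ 2 * (free w)%:R))).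
    rewrite ler_sum // => w _; case: (free w); rewrite ?muln1 ?muln0 ?mulr1 ?mulr0.
      by rewrite lerDr.
    by rewrite expr0 addr0.
  rewrite big_split /= sum_nu -mulr_sumr -natr_sum /q -sum1_count [in leRHS]big_mkcond /=.
  by rewrite lerD2l ler_wpM2l ?lexx // exprn_ge0 // ltW.
have wsum : \sum_(w <- lw (m * b + p)) y ^+ (2 * fcount b m w) <= q ^+ m * (nu p)%:R.
  elim: m => [|m IH].
    by rewrite expr0 mul1r -sum_nu; under eq_bigr do rewrite muln0 expr0.
  rewrite mulSn -addnA exprS -mulrA; apply: (@le_trans _ _
    ((\sum_(w <- lw b) y ^+ (2 * free w)) *
     (\sum_(w <- lw (m * b + p)) y ^+ (2 * fcount b m w)))); last first.
    by rewrite ler_pM // sumr_ge0 // => w _; rewrite exprn_ge0 // ltW.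
  apply: le_trans (sum_lw_cat _ _ _ _); last 2 first.
  - by move=> w; rewrite exprn_ge0 // ltW.
  - by move=> w; rewrite exprn_ge0 // ltW.
  by under eq_bigr do rewrite /= mulnDr exprD.
set cnt := count _ _; set n := (m * b + p)%N in cnt wsum *.
have cy : cnt%:R * y ^+ m <= q ^+ m * (nu p)%:R.
  apply: le_trans wsum; rewrite /cnt -sum1_count natr_sum mulr_suml.
  rewrite big_mkcond /= ler_sum // => w _; case: ifP => [h|_].
    by rewrite mul1r ler_weXn2l.
  by rewrite exprn_ge0 // ltW.
have h1 : cnt%:R * y ^+ m * zs ^+ n <= (2 * C) ^+ m * C.
  apply: (le_trans (ler_wpM2r (exprn_ge0 _ (ltW z0)) cy)).
  rewrite /n exprD mulrACA mulnC exprM -exprMn ler_pM //.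
  - by rewrite exprn_ge0 // mulr_ge0 // exprn_ge0 // ltW.
  - by rewrite mulr_ge0 // exprn_ge0 // ltW.
  - by rewrite lerXn2r ?nnegrE // ?mulr_ge0 ?exprn_ge0 //; lra.
have h2 : cnt%:R * 2 ^+ m * zs ^+ n <= C.
  rewrite -(ler_pM2l (_ : 0 < (2 * C) ^+ m)); last by rewrite exprn_gt0 //; lra.
  apply: le_trans h1; rewrite (_ : y = (2 * C) * 2); last by rewrite /y; ring.
  rewrite [in leRHS]exprMn; move: cnt%:R (zs ^+ n) (2 ^+ m) ((2 * C) ^+ m) => x1 x2 x3 x4.
  by rewrite le_eqVlt; apply/orP; left; apply/eqP; ring.
have zn0 : 0 < zs ^+ n by rewrite exprn_gt0.
by rewrite -(ler_pM2r zn0) (le_trans h2) // -mulrA ler_peMr //; lra.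
Qed.
End Few.
End Growth.

(** * Pivots *)

Record separated (R : realType) (G : groupType) (l : G -> R) (delta : R)
    (K : nat) (F : 'I_K -> G) (C D : R) : Prop := Separated {
  sep_fwd : forall i j, i != j -> gp l (F i) (F j) <= C;
  sep_bwd : forall i j, i != j -> gp l (F i)^-1 (F j)^-1 <= C;
  sep_len : forall i, D <= l (F i);
  sep_big : 20 * (C + delta) <= D }.

Section Pivots.
Variables (R : realType) (G : groupType) (l : G -> R) (delta : R).
Hypothesis H : hyplen l delta.
Variables (K : nat) (F : 'I_K -> G) (C D : R).
Hypotheses (SF : separated l delta F C D) (C0 : 0 <= C) (D0 : 0 < D).
Variables (g0 : G) (g : nat -> G).
Implicit Types (s t : nat -> 'I_K) (st : seq nat).

Let C' := C + delta.

(** An element runs far along at most one [F i]. This and its mirror image below are what makes a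
    failed push, or a pop, leave no freedom in the choice of the factor. *)
Lemma fwd_unique h i j : C' < gp l h (F i) -> C' < gp l h (F j) -> i = j.
Proof.
move=> hi hj; apply/eqP; apply: contraT => /(sep_fwd SF) ij.
by have := hyp4 H (F i) h (F j); rewrite (gpC H (F i) h); move: hi hj; rewrite /C' => ? ?; case; lra.
Qed.

Lemma bwd_unique h i j : C' < gp l (F i)^-1 h -> C' < gp l (F j)^-1 h -> i = j.
Proof.
move=> hi hj; apply/eqP; apply: contraT => /(sep_bwd SF) ij.
by have := hyp4 H (F i)^-1%g h (F j)^-1%g; rewrite (gpC H h); move: hi hj; rewrite /C' => ? ?; case; lra.
Qed.

Fixpoint pos s n : G :=
  if n is n'.+1 then (pos s n' * F (s n') * g n')%g else g0.

Fixpoint after s p d : G :=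
  if d is d'.+1 then (after s p d' * F (s (p + d'.+1)%N) * g (p + d'.+1)%N)%g else g p.

Lemma pos_after s p d : pos s (p + d).+1 = (pos s p * F (s p) * after s p d)%g.
Proof.
elim: d => [|d IH]; rewrite ?addn0 // addnS.
by rewrite -[pos s _.+2]/(pos s (p + d).+1 * _ * _)%g IH /= addnS !mulgA.
Qed.

(* A stack of pivots: times p such that the part of the product following the
   factor F (s p) has not backtracked through that factor. The position of the
   last pivot serves as the base point for testing whether n becomes a pivot. *)
Definition ref s st : G := if st is p :: _ then pos s p else 1%g.
Definition pushes s st n : bool := gp l ((ref s st)^-1 * pos s n)^-1 (F (s n)) <= C'.
Definition pops s p n : bool := C' < gp l (F (s p))^-1 ((F (s p))^-1 * ((pos s p)^-1 * pos s n)).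

Fixpoint unwind s n st : seq nat :=
  if st is p :: st' then if pops s p n then unwind s n st' else st else [::].

Fixpoint pivots s n : seq nat :=
  if n is n'.+1 then
    unwind s n (if pushes s (pivots s n') n' then n' :: pivots s n' else pivots s n')
  else [::].

Definition pushed s n := pushes s (pivots s n) n.
Definition extended s n := if pushed s n then n :: pivots s n else pivots s n.
Definition npops s n : nat := (size (extended s n) - size (pivots s n.+1))%N.

Lemma popsE s p d : pops s p (p + d).+1 = (C' < gp l (F (s p))^-1 (after s p d)).
Proof. by rewrite /pops pos_after -!mulgA !mulKg. Qed.

Fixpoint well_stacked s st n : Prop :=
  if st is p :: st' then
    [/\ (p < n)%N, ~~ pops s p n, pushes s st' p & well_stacked s st' p]
  else True.

Lemma well_stacked_unwind s st m n : (m <= n)%N -> well_stacked s st m ->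
  well_stacked s (unwind s n st) n.
Proof.
elim: st m => //= p st IH m mn [pm _ pp wst].
have pn := leq_trans pm mn; case: ifP => [_|/negbT np]; first exact: IH (ltnW pn) wst.
by split.
Qed.

Lemma well_stacked_pivots s n : well_stacked s (pivots s n) n.
Proof.
elim: n => //= n IH; case: ifP => [pn|_]; last exact: well_stacked_unwind (leqnSn n) IH.
rewrite /=; case: ifP => [_|/negbT np]; first exact: well_stacked_unwind (leqnSn n) IH.
by split.
Qed.

(** The three estimates are carried together: the step from one pivot to the next is long and turns
    little, which lets the following pivot add another [D / 2]. The alternatives [st = [::]] cover
    the bottom of the stack, whose base point is the identity. *)
Lemma len_well_stacked s st n : well_stacked s st n ->
  [/\ (size st)%:R * (D / 2) <= l (pos s n),
      D - 2 * C' <= l ((ref s st)^-1 * pos s n)%g \/ st = [::] &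
      gp l (ref s st)^-1 ((ref s st)^-1 * pos s n) <= C' + 2 * delta \/ st = [::]].
Proof.
have d0 := delta_ge0 H; have C0' := C0; have D0' := D0; have big := sep_big SF.
elim: st n => [|p st IH] n /=.
  by move=> _; rewrite mul0r; split; [exact: (len_ge0 H)|right|right].
case=> pn; rewrite -(subnKC pn) addSn => np pp /IH[lp dp gpp].
move: (n - p.+1)%N np => d; rewrite popsE -leNgt => np.
have e : ((pos s p)^-1 * pos s (p + d).+1 = F (s p) * after s p d)%g.
  by rewrite pos_after -!mulgA mulKg.
rewrite e; have sD := sep_len SF (s p).
have h1 : gp l (pos s p)^-1 (F (s p)) <= C' + delta.
  move: pp; rewrite /pushes; case: dp gpp => [dp|st0]; last first.
    by move=> _; rewrite st0 /= invg1 mul1g; lra.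
  case=> [gpp|st0]; last by rewrite st0 /= invg1 mul1g; lra.
  set q := ref s st in dp gpp *; rewrite invgM invgK => pp.
  apply: (@hyp4_lt _ _ _ _ H ((pos s p)^-1 * q)%g) => //.
  rewrite (gpC H) (gpK H) invgK (lenV H).
  have e' : l ((pos s p)^-1 * q)%g = l (q^-1 * pos s p)%g by rewrite -(lenV H) invgM invgK.
  by move: gpp dp; rewrite /gp invgK mulVKg (lenV H) e' /C'; lra.
have h2 : gp l (pos s p)^-1 (F (s p) * after s p d) <= C' + 2 * delta.
  rewrite (gpC H); apply: (@le_trans _ _ (C' + delta + delta)); last by lra.
  apply: (@hyp4_lt _ _ _ _ H (F (s p))); last by rewrite (gpC H).
  by rewrite (gpK H); move: np; rewrite /C'; lra.
have h3 : D - 2 * C' <= l (F (s p) * after s p d)%g.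
  by rewrite (lenD H); have := len_ge0 H (after s p d); lra.
split; [|by left|by left].
rewrite pos_after -mulgA (lenD H) -(natr1 (size st)); move: h3 lp; rewrite /C' => h3 lp.
by move: h2; rewrite /C'; lra.
Qed.

Lemma pos_local s t n : (forall i, (i < n)%N -> s i = t i) -> pos s n = pos t n.
Proof.
elim: n => //= n IH st; rewrite st // IH // => i i_n.
by rewrite st // ltnW.
Qed.

Lemma after_local s t p d : (forall i, (p < i <= p + d)%N -> s i = t i) ->
  after s p d = after t p d.
Proof.
elim: d => //= d IH st; rewrite st ?addnS ?ltnS ?leq_addr ?leqnn // IH // => i /andP[pi id].
by rewrite st // pi addnS ltnW.
Qed.

Lemma sub_unwind s n st : {subset unwind s n st <= st}.
Proof.
elim: st => //= p st IH; case: ifP => _ // q /IH.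
by rewrite inE => ->; rewrite orbT.
Qed.

Lemma mem_pivots s n p : p \in pivots s n -> (p < n)%N && pushed s p.
Proof.
elim: n => //= n IH /sub_unwind; case: ifP => [pn|_]; last first.
  by move=> /IH /andP[pn ->]; rewrite ltnW.
by rewrite inE => /orP[/eqP->|/IH /andP[pn' ->]]; [rewrite ltnSn|rewrite ltnW].
Qed.

Lemma unwind_drop s n st :
  unwind s n st = drop (size st - size (unwind s n st)) st.
Proof.
elim: st => //= p st IH; case: ifP => _; last by rewrite subnn.
by rewrite subSn /= // IH size_drop leq_subr.
Qed.

Lemma uniq_pivots s n : uniq (pivots s n).
Proof.
elim: n => //= n IH; rewrite unwind_drop drop_uniq //.
case: ifP => //= _; rewrite IH andbT; apply/negP => /mem_pivots.
by rewrite ltnn.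
Qed.

Lemma unwind_popped s n st p : p \in st -> p \notin unwind s n st -> pops s p n.
Proof.
elim: st => //= q st IH; rewrite inE; case: ifP => [qn|_].
  by move=> /orP[/eqP->//|/IH].
by rewrite inE => ->.
Qed.

Lemma pivots_local s t n : (forall i, (i < n)%N -> s i = t i) -> pivots s n = pivots t n.
Proof.
elim: n => // n IH st; have {}IH : pivots s n = pivots t n.
  by apply: IH => i i_n; rewrite st // ltnW.
have posE i : (i <= n.+1)%N -> pos s i = pos t i.
  by move=> i_n; apply: pos_local => j ji; rewrite st // (leq_trans ji).
have unw S : all (ltn^~ n.+1) S -> unwind s n.+1 S = unwind t n.+1 S.
  elim: S => //= p S IHS /andP[pn /IHS ->].
  by rewrite /pops st // !posE // ltnW.
have refE S : all (ltn^~ n.+1) S -> ref s S = ref t S.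
  by case: S => //= p S /andP[pn _]; rewrite posE // ltnW.
have all_n : all (ltn^~ n.+1) (pivots t n).
  by apply/allP => p /mem_pivots /andP[pn _]; rewrite /= ltnW.
rewrite /= IH; have -> : pushes s (pivots t n) n = pushes t (pivots t n) n.
  by rewrite /pushes refE // posE // st.
by rewrite unw //; case: ifP => //= _; rewrite ltnSn.
Qed.

(** Pops only shorten the stack from the top, so the pattern of pushes and the numbers of pops
    reconstruct every stack. *)
Lemma pivots_shape s t k : (forall n, (n < k)%N -> pushed s n = pushed t n) ->
  (forall n, (n < k)%N -> npops s n = npops t n) ->
  forall n, (n <= k)%N -> pivots s n = pivots t n.
Proof.
move=> hp hn; elim=> // n IH nk; have {}IH := IH (ltnW nk).
have := hn n nk; rewrite /npops /extended /= hp //.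
move: (hp n nk); rewrite /pushed IH => ->.
set S := (if _ then _ else _) => e.
by rewrite [LHS]unwind_drop [RHS]unwind_drop e.
Qed.

Lemma sub_extended s n : {subset pivots s n <= extended s n}.
Proof. by move=> p; rewrite /extended; case: ifP => // _; rewrite inE => ->; rewrite orbT. Qed.

Lemma popped_time s p k : (p < k)%N -> pushed s p -> p \notin pivots s k ->
  exists n, [/\ (p <= n < k)%N, p \in extended s n & p \notin pivots s n.+1].
Proof.
move=> pk pp; apply: contraNP => no.
have ext n : (p <= n < k)%N -> p \in extended s n -> p \in pivots s n.+1.
  by move=> pn en; apply: contraT => nn; case: no; exists n.
have : forall d, (p + d < k)%N -> p \in pivots s (p + d).+1.
  elim=> [|d IH] pd.
    by rewrite addn0; apply: ext; [rewrite leqnn|rewrite /extended pp mem_head].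
  rewrite addnS; apply: ext; first by rewrite -addnS leq_addr.
  by apply/sub_extended/IH; rewrite ltnW // -addnS.
move=> /(_ (k - p.+1)%N); rewrite -addSn subnKC //; apply.
by move: pk; clear; lia.
Qed.

Lemma sum_npops s k :
  (\sum_(n < k) npops s n + size (pivots s k) = \sum_(n < k) pushed s n)%N.
Proof.
have le n : (size (pivots s n.+1) <= size (extended s n))%N.
  by rewrite -[pivots s n.+1]/(unwind s n.+1 (extended s n)) unwind_drop size_drop leq_subr.
have ext n : size (extended s n) = (pushed s n + size (pivots s n))%N.
  by rewrite /extended; case: ifP.
rewrite -(big_mkord xpredT (npops s)) -(big_mkord xpredT (fun n => nat_of_bool (pushed s n))).
elim: k => [|k IH]; first by rewrite !big_geq.
rewrite !big_nat_recr // -IH; have := ext k; have := le k; rewrite /npops.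
move: (size (pivots s k.+1)) (size (pivots s k)) (\sum_(0 <= n < k) _)%N => a b c /= *.
by lia.
Qed.

Lemma pushed_unique s t n : (forall i, (i < n)%N -> s i = t i) ->
  ~~ pushed s n -> ~~ pushed t n -> s n = t n.
Proof.
move=> st; rewrite /pushed /pushes (pivots_local st) (pos_local st).
have -> : ref s (pivots t n) = ref t (pivots t n).
  case e : (pivots t n) => [|p S] //=; apply: pos_local => i ip; apply: st.
  have /mem_pivots/andP[pn _] : p \in pivots t n by rewrite e mem_head.
  exact: ltn_trans ip pn.
rewrite -!ltNge; exact: fwd_unique.
Qed.

Lemma popped_unique s t p k : (forall n, (n <= k)%N -> pivots s n = pivots t n) ->
  (forall n, (n < k)%N -> pushed s n = pushed t n) ->
  (forall i, (p < i < k)%N -> s i = t i) -> (p < k)%N -> pushed s p ->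
  p \notin pivots s k -> s p = t p.
Proof.
move=> hp hb st pk pp pn; have [n [/andP[p_n nk] ex nx]] := popped_time pk pp pn.
have ext : p \in extended t n.
  by move: ex; rewrite /extended hb // hp // ltnW.
have := unwind_popped ex nx; have nxt := nx; rewrite hp // in nxt.
have := unwind_popped ext nxt; rewrite -(subnKC p_n) !popsE.
rewrite (@after_local s t p) => [h1 h2|i /andP[pi]]; first exact: bwd_unique h2 h1.
by rewrite subnKC // => i_n; rewrite st // pi (leq_ltn_trans i_n).
Qed.
End Pivots.

Local Close Scope classical_set_scope.

(* A set of words over X in which the letter at every position of J is
   determined by the letters at positions of smaller rank. *)
Lemma card_determined (X : finType) k (r : 'I_k -> nat) (J : {set 'I_k})
    (A : {set {ffun 'I_k -> X}}) : injective r ->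
  (forall s t j, s \in A -> t \in A -> j \in J ->
     (forall i, (r i < r j)%N -> s i = t i) -> s j = t j) ->
  (#|A| <= #|X| ^ (k - #|J|))%N.
Proof.
move=> rI det; have [->|[s0 s0A]] := set_0Vmem A; first by rewrite cards0.
pose f (s : {ffun 'I_k -> X}) := [ffun i => if i \in J then s0 i else s i].
have fI : {in A &, injective f}.
  move=> s t sA tA fst; apply/ffunP => i; apply/eqP; apply: contraT => neq.
  have ex : exists i, s i != t i by exists i.
  have [j0 j0neq] := ex.
  case: (@arg_minnP _ j0 (fun i => s i != t i) r j0neq) => j jneq jmin.
  case/eqP: (jneq); have [jJ|jJ] := boolP (j \in J).
    apply: det jJ _ => // i' ij; apply/eqP; apply: contraLR ij => /jmin.
    by rewrite -leqNgt.
  by have := congr1 (fun h : {ffun _ -> _} => h j) fst; rewrite /f !ffunE (negPf jJ).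
rewrite -(card_in_imset fI).
pose g (u : {ffun 'I_k -> X}) : {ffun {i | i \notin J} -> X} := [ffun i => u (val i)].
have gI : {in f @: A &, injective g}.
  move=> _ _ /imsetP[s sA ->] /imsetP[t tA ->] gst; apply/ffunP => i.
  have [iJ|iJ] := boolP (i \in J); first by rewrite /f !ffunE iJ.
  have := congr1 (fun h : {ffun {i | i \notin J} -> X} => h (exist _ i iJ)) gst.
  by rewrite /g /f !ffunE /=.
rewrite -(card_in_imset gI) (leq_trans (max_card _)) // card_ffun leq_eqVlt.
apply/orP; left; apply/eqP; congr (_ ^ _)%N.
rewrite card_sig; have cJ := etrans (cardC (mem J)) (card_ord k).
suff -> : #|[pred x | x \notin J]| = #|[predC J]| by rewrite -[X in (X - _)%N]cJ addKn.
by apply: eq_card => i; rewrite !inE.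
Qed.

(** Generating function at 1/2: each such tuple has weight at least [2 ^ (- k)], and all tuples
    together weigh at most [2 ^ k]. *)
Lemma card_bounded_sum k :
  (#|[set c : {ffun 'I_k -> 'I_k.+1} | (\sum_i c i <= k)%N]| <= 4 ^ k)%N.
Proof.
pose S := [set c : {ffun 'I_k -> 'I_k.+1} | (\sum_i c i <= k)%N].
have h2 i : (\sum_(j < i) (2^-1 : rat) ^+ j <= 2)%R.
  suff -> : \sum_(j < i) (2^-1 : rat) ^+ j = 2 - 2 * 2^-1 ^+ i by rewrite gerBl mulr_ge0 // exprn_ge0.
  elim: i => [|i IH]; first by rewrite big_ord0 expr0; ring.
  by rewrite big_ord_recr /= IH exprS; field.
have : #|S|%:R * 2^-1 ^+ k <= 2 ^+ k :> rat.
  apply: (@le_trans _ _ (\sum_(c : {ffun 'I_k -> 'I_k.+1}) \prod_i (2^-1 : rat) ^+ c i)).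
    rewrite -sum1_card natr_sum mulr_suml big_mkcond /= ler_sum // => c _.
    rewrite prodrXr inE; case: ifP => [h|_]; last by rewrite exprn_ge0.
    by rewrite mul1r ler_wiXn2l // invf_le1.
  rewrite -(bigA_distr_bigA (fun (_ : 'I_k) (j : 'I_k.+1) => (2^-1 : rat) ^+ j)) /=.
  by rewrite prodr_const card_ord lerXn2r ?nnegrE ?h2 // sumr_ge0 // => j _; rewrite exprn_ge0.
rewrite exprVn ler_pdivrMr ?exprn_gt0 // -exprMn -natrM -natrX ler_nat.
by [].
Qed.

Section PivotCount.
Variables (R : realType) (G : groupType) (l : G -> R) (delta : R).
Hypothesis H : hyplen l delta.
Variables (K : nat) (F : 'I_K -> G) (C D : R).
Hypotheses (SF : separated l delta F C D) (C0 : 0 <= C) (D0 : 0 < D).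
Variables (g0 : G) (g : nat -> G) (i0 : 'I_K).

(** The default [i0] beyond position [k] has no influence on [pos] and [pivots] up to [k], by
    locality. *)
Definition extend k (s : {ffun 'I_k -> 'I_K}) (n : nat) : 'I_K :=
  oapp s i0 (insub n).

Lemma extendE k (s : {ffun 'I_k -> 'I_K}) (i : 'I_k) : extend s i = s i.
Proof. by rewrite /extend valK. Qed.

(* A factor that is not pushed is determined by the factors preceding it, and one
   that is popped by those following it, so for a given pattern of pushes and pops
   few pivots leave few free choices; there are at most 8 ^ k patterns. *)
Theorem few_pivots k :
  (#|[set s : {ffun 'I_k -> 'I_K} |
      3 * size (pivots l delta F C g0 g (extend s) k) <= k]|%N ^ 3 <= (8 ^ k) ^ 3 * K ^ (2 * k))%N.
Proof.
(* The bound meant is [8 ^ k * K ^ (2 * k / 3)]; the cubes avoid a fractional exponent. *)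
pose piv (s : {ffun 'I_k -> 'I_K}) n := pivots l delta F C g0 g (extend s) n.
pose psh (s : {ffun 'I_k -> 'I_K}) n := pushed l delta F C g0 g (extend s) n.
pose np (s : {ffun 'I_k -> 'I_K}) n := npops l delta F C g0 g (extend s) n.
set A := [set s | _].
pose shape (s : {ffun 'I_k -> 'I_K}) : {ffun 'I_k -> bool} * {ffun 'I_k -> 'I_k.+1} :=
  ([ffun i : 'I_k => psh s i], [ffun i : 'I_k => inord (np s i)]).
have snp s : (\sum_(i < k) np s i <= k)%N.
  have h : (\sum_(n < k) np s n + size (piv s k) = \sum_(n < k) psh s n)%N.
    exact: sum_npops.
  apply: (@leq_trans (\sum_(n < k) psh s n)%N); first by rewrite -h leq_addr.
  by rewrite -[leqRHS](card_ord k) -sum1_card leq_sum // => i _; case: (psh s i).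
have npk s (i : 'I_k) : (np s i < k.+1)%N.
  by rewrite ltnS (leq_trans _ (snp s)) // (bigD1 i) //= leq_addr.
have one tau : (#|[set s in A | shape s == tau]| ^ 3 <= K ^ (2 * k))%N.
  set At := [set s in A | _].
  have [->|[s0 s0A]] := set_0Vmem At; first by rewrite cards0 exp0n.
  have same s : s \in At -> (forall n, (n < k)%N -> psh s n = psh s0 n) /\
      (forall n, (n <= k)%N -> piv s n = piv s0 n).
    rewrite !inE in s0A; case/andP: s0A => _ /eqP s0t.
    rewrite !inE => /andP[_ /eqP st]; have e : shape s = shape s0 by rewrite st.
    have hp n : (n < k)%N -> psh s n = psh s0 n.
      move=> nk; have := congr1 (fun h : {ffun 'I_k -> bool} * _ => h.1 (Ordinal nk)) e.
      by rewrite !ffunE.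
    split=> //; apply: pivots_shape hp _ => n nk.
    have := congr1 (fun h : {ffun 'I_k -> bool} * {ffun _ -> 'I_k.+1} =>
       val (h.2 (Ordinal nk))) e.
    by rewrite /= !ffunE /= !inordK ?(npk _ (Ordinal nk)).
  (* Factors never pushed, and factors pushed but later popped. Together with the surviving pivots,
     at most [k / 3] in number, they exhaust all [k] positions, so one of [J1] and [J2] has at least
     [k / 3] elements. *)
  pose J1 := [set i : 'I_k | ~~ psh s0 i].
  pose J2 := [set i : 'I_k | psh s0 i && (val i \notin piv s0 k)].
  have c1 : (#|At| <= K ^ (k - #|J1|))%N.
    rewrite -[K in (K ^ _)%N]card_ord; apply: (@card_determined _ _ val) => // s t j sA tA.
    have [hs _] := same _ sA; have [ht _] := same _ tA.
    rewrite inE => j1 st; rewrite -!extendE; apply: (pushed_unique H SF (g0 := g0) (g := g)).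
    - by move=> i ij; have := st (Ordinal (ltn_trans ij (ltn_ord j))) ij; rewrite -!extendE.
    - by move: j1; rewrite -hs.
    - by move: j1; rewrite -ht.
  have c2 : (#|At| <= K ^ (k - #|J2|))%N.
    rewrite -[K in (K ^ _)%N]card_ord.
    (* Popped factors are determined by later ones, hence the reversed ranking. *)
    apply: (@card_determined _ _ (fun i : 'I_k => (k - i)%N)) => [i j|s t j sA tA].
      move=> /= e; apply: val_inj => /=.
      by have := ltn_ord i; have := ltn_ord j; move: e; clear; lia.
    have [hs ps] := same _ sA; have [ht pt] := same _ tA.
    rewrite inE => /andP[j1 j2] st; rewrite -!extendE.
    apply: (popped_unique H SF (g0 := g0) (g := g) (k := k)) => //.
    - by move=> n nk; rewrite -/(piv s n) -/(piv t n) ps // pt.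
    - by move=> n nk; rewrite -/(psh s n) -/(psh t n) hs // ht.
    - move=> i /andP[ji ik]; have := st (Ordinal ik); rewrite -!extendE; apply => /=.
      by move: ji ik; clear; lia.
    - by rewrite -/(psh s j) hs.
    - by rewrite -/(piv s k) ps.
  have cJ : (#|J1| + #|J2| + size (piv s0 k) = k)%N.
    pose J3 := [set i : 'I_k | val i \in piv s0 k].
    have -> : size (piv s0 k) = #|J3|.
      rewrite cardE -(size_map val); apply/perm_size/uniq_perm.
      - exact: uniq_pivots.
      - by rewrite map_inj_uniq ?enum_uniq //; apply: val_inj.
      move=> n; apply/idP/mapP => [np'|[i]]; last by rewrite mem_enum inE => h ->.
      have /andP[nk _] := mem_pivots np'.
      by exists (Ordinal nk); rewrite // mem_enum inE.
    have d23 : [disjoint J2 & J3] by rewrite finset.disjoints_subset; apply/fintype.subsetP => i; rewrite !inE => /andP[].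
    have d1 : [disjoint J1 & J2 :|: J3].
      rewrite finset.disjoints_subset; apply/fintype.subsetP => i; rewrite !inE => /negPf n1.
      by rewrite n1 /=; apply/negP => /mem_pivots; rewrite -/(psh s0 i) n1 andbF.
    rewrite -addnA -cardsUI (eqP (_ : #|J2 :&: J3| == 0)%N) ?addn0; last first.
      by rewrite cards_eq0 finset.setI_eq0.
    rewrite -cardsUI (eqP (_ : #|J1 :&: _| == 0)%N) ?addn0; last first.
      by rewrite cards_eq0 finset.setI_eq0.
    rewrite -[RHS](card_ord k) -finset.cardsT; congr #|pred_of_set _|; apply/finset.setP => i.
    by rewrite !inE; case: (psh s0 i); case: (_ \in _).
  have small : (3 * size (piv s0 k) <= k)%N.
    by move: s0A; rewrite !inE => /andP[].
  have K0 : (0 < K)%N by case: i0 => [m mK]; apply: leq_ltn_trans mK.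
  have [b|b] : (k <= 3 * #|J1|)%N \/ (k <= 3 * #|J2|)%N by move: cJ small; clear; lia.
    apply: (@leq_trans ((K ^ (k - #|J1|)) ^ 3)%N); first by rewrite leq_exp2r.
    by rewrite -expnM leq_pexp2l //; move: b; clear; lia.
  apply: (@leq_trans ((K ^ (k - #|J2|)) ^ 3)%N); first by rewrite leq_exp2r.
  by rewrite -expnM leq_pexp2l //; move: b; clear; lia.
pose T := [set tau : {ffun 'I_k -> bool} * {ffun 'I_k -> 'I_k.+1} | (\sum_i tau.2 i <= k)%N].
have cT : (#|T| <= 8 ^ k)%N.
  have -> : T = finset.setX finset.setT [set c : {ffun 'I_k -> 'I_k.+1} | (\sum_i c i <= k)%N].
    by apply/finset.setP => -[a c]; rewrite !inE.
  rewrite finset.cardsX finset.cardsT card_ffun card_bool card_ord -[8%N]/(2 * 4)%N expnMn.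
  by rewrite leq_mul2l card_bounded_sum orbT.
have sT s : shape s \in T.
  rewrite inE /=; apply: leq_trans (snp s); apply: leq_sum => i _.
  by rewrite ffunE inordK.
have [N NP Nmax] : exists2 N, (N ^ 3 <= K ^ (2 * k))%N &
    forall tau, (#|[set s in A | shape s == tau]| <= N)%N.
  pose f (tau : {ffun 'I_k -> bool} * {ffun 'I_k -> 'I_k.+1}) := #|[set s in A | shape s == tau]|.
  exists (\max_tau f tau); last by move=> tau; exact: (@bigop.leq_bigmax _ f tau).
  have [|tau ->] := @bigop.eq_bigmax _ f; last exact: one.
  by apply/card_gt0P; exists ([ffun=> false], [ffun=> ord0]).
apply: (@leq_trans ((8 ^ k * N) ^ 3)%N); last by rewrite expnMn leq_mul2l NP orbT.
rewrite leq_exp2r //; apply: (@leq_trans (#|T| * N)%N); last by rewrite leq_mul2r cT orbT.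
rewrite -sum1_card (partition_big shape (mem T)) //=.
rewrite -sum_nat_const leq_sum // => tau _; rewrite sum1dep_card.
by apply: leq_trans (Nmax tau); rewrite leq_eqVlt; apply/orP; left; apply/eqP/eq_card => s; rewrite !inE.
Qed.

(** More than [k / 3] pivots, each worth [D / 2], displace by at least [k * D / 6]. The exceptional
    set is counted by [8 ^ k * K ^ (2 * k / 3)]; multiplying by the gain [2 ^ k] gives [16 ^ k], and
    [2 ^ 12 = 16 ^ 3] makes this at most [K ^ (k / 3)]. *)
Theorem few_short_products k : (2 ^ 12 <= K)%N ->
  (#|[set s : {ffun 'I_k -> 'I_K} |
      (l (pos F g0 g (extend s) k) < k%:R * D / 6)%R]|%N * 2 ^ k <= K ^ k)%N.
Proof.
move=> bigK; have K0 : (0 < K)%N by apply: leq_trans bigK.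
rewrite -(@leq_exp2r _ _ 3) // expnMn.
apply: (@leq_trans (((8 ^ k) ^ 3 * K ^ (2 * k)) * (2 ^ k) ^ 3)%N).
  rewrite leq_mul2r; apply/orP; right; apply: leq_trans (few_pivots k).
  rewrite leq_exp2r //; apply/subset_leq_card/fintype.subsetP => s; rewrite !inE.
  apply: contraTT; rewrite -ltnNge -leNgt => many.
  have [h _ _] := len_well_stacked H SF C0 D0 (well_stacked_pivots l delta F C g0 g (extend s) k).
  apply: le_trans h; have : (k.+1)%:R <= (3 * size (pivots l delta F C g0 g (extend s) k))%:R :> R.
    by rewrite ler_nat.
  rewrite natrM -(natr1 k); move: (size _)%:R => x kx.
  have D0' := D0; have : k%:R * D <= 3 * x * D by rewrite ler_wpM2r //; lra.
  by lra.
rewrite -[8%N]/(2 ^ 3)%N -!expnM mulnAC -expnD.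
rewrite (_ : 3 * (k * 3) + k * 3 = 12 * k)%N; last by lia.
rewrite expnM (_ : k * 3 = k + 2 * k)%N; last by lia.
by rewrite expnD leq_mul2r; apply/orP; right; case: (k) => // k'; rewrite leq_exp2r.
Qed.
End PivotCount.

Local Open Scope classical_set_scope.

(** * Loops and swap families *)

(** The entry [e] stands for [A ^ (e + 1) * B], so [pairs (iota N N)] is the word u. *)
Definition pairs (es : seq nat) : seq (bool * nat) :=
  flatten [seq [:: (true, e); (false, 0%N)] | e <- es].

Lemma pairs_cat es es' : pairs (es ++ es') = pairs es ++ pairs es'.
Proof. by rewrite /pairs map_cat flatten_cat. Qed.

Lemma pairs_rcons es e : pairs (rcons es e) = rcons (rcons (pairs es) (true, e)) (false, 0%N).
Proof. by rewrite -cats1 pairs_cat -!cats1 -catA. Qed.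

Lemma last_pairs x e es : last x (pairs (e :: es)) = (false, 0%N).
Proof. by rewrite lastI pairs_rcons last_rcons. Qed.

Section Pairs.
Variables (R : realType) (G : groupType) (l : G -> R) (delta : R).
Hypothesis H : hyplen l delta.
Variables (A B : G) (P D : R).
Hypothesis S : schottky l A B P D.
Hypotheses (P0 : 0 <= P) (PD : 4 * P + 20 * delta < D).
Local Notation W es := (sylp A B (pairs es)).

Lemma sylp1 x : sylp A B [:: x] = syl A B x.
Proof. by rewrite /sylp /= gprod_cons gprod_nil mulg1. Qed.

Lemma gp_branch h k u v : D - P - delta <= gp l h u -> D - P - delta <= gp l k v ->
  gp l h k <= P -> gp l u v <= P + 2 * delta.
Proof.
have d0 := delta_ge0 H; have P0' := P0; have PD' := PD => hu kv hk.
have h1 : gp l u k <= P + delta by apply: (hyp4_lt H _ hk); lra.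
rewrite (gpC H); apply: (@le_trans _ _ (P + delta + delta)); last by lra.
by apply: (@hyp4_lt _ _ _ _ H k); [lra|rewrite (gpC H)].
Qed.

Lemma len_powA_le m e : (e <= m)%N -> l (A ^+ e)%g <= m%:R * l A.
Proof.
move=> em; apply: (le_trans (lenX H _ _)).
by rewrite ler_wpM2r ?(len_ge0 H) // ler_nat.
Qed.

(** After the common [A ^ (e + 1)], for [e] the smaller exponent, one word continues with [B] and
    the other with [A], and [sch_pos] separates them. *)
Lemma gp_pairs_fwd m e t e' t' : (e < m)%N -> (e' < m)%N -> e != e' ->
  gp l (W (e :: t)) (W (e' :: t')) <= m%:R * l A + P + 2 * delta.
Proof.
wlog ee : e t e' t' / (e < e')%N => [th em e'm|em e'm _].
  case: ltngtP => // h _; first by apply: th => //; rewrite neq_ltn h.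
  by rewrite (gpC H); apply: th => //; rewrite neq_ltn h.
have -> : W (e :: t) = (A ^+ e.+1 * sylp A B ((false, 0%N) :: pairs t))%g.
  by rewrite /= !sylp_cons.
have -> : W (e' :: t') =
    (A ^+ e.+1 * sylp A B ((true, (e' - e.+1)%N) :: (false, 0%N) :: pairs t'))%g.
  rewrite /= !sylp_cons [RHS]mulgA; congr (_ * _)%g; rewrite /syl /= -expgnDr.
  by congr (A ^+ _)%g; move: ee; clear; lia.
apply: (le_trans (gpMl H _ _ _)); rewrite -addrA lerD ?len_powA_le //.
apply: gp_branch (gp_sylp_head H S P0 PD _ _) (gp_sylp_head H S P0 PD _ _) _.
by rewrite (gpC H); exact: (sch_pos S).
Qed.

(** The same from the right end, past the common [A ^ (e + 1) * B]. Since [t] is nonempty, the word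
    with the smaller exponent has a [B] in front of this piece, and [sch_neg] applies. *)
Lemma gp_pairs_bwd m e t e' t' : (e < m)%N -> (e' < m)%N -> e != e' ->
  ~~ nilp t -> ~~ nilp t' ->
  gp l (W (rcons t e))^-1 (W (rcons t' e'))^-1 <= m%:R * l A + l B + P + 2 * delta.
Proof.
wlog ee : e t e' t' / (e < e')%N => [th em e'm|em e'm _].
  case: ltngtP => // h _ n n'; first by apply: th => //; rewrite neq_ltn h.
  by rewrite (gpC H); apply: th => //; rewrite neq_ltn h.
case: t => // e1 t _; case: t' => // e1' t' _.
have -> : ((W (rcons (e1 :: t) e))^-1 =
    B^-1 * ((A ^+ e.+1)^-1 * (W (e1 :: t))^-1))%g.
  rewrite pairs_rcons -!cats1 !sylp_cat -!invgM; congr (_^-1)%g.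
  by rewrite !sylp1 /syl /= expg1.
have -> : ((W (rcons (e1' :: t') e'))^-1 = B^-1 * ((A ^+ e.+1)^-1 *
    (sylp A B (rcons (pairs (e1' :: t')) (true, (e' - e.+1)%N)))^-1))%g.
  rewrite pairs_rcons; move: (pairs (e1' :: t')) => Y.
  rewrite -!cats1 !sylp_cat -!invgM; congr (_^-1)%g.
  rewrite !sylp1 /syl /= expg1; congr (_ * _)%g; rewrite -mulgA -expgnDr; congr (_ * _)%g.
  by congr (A ^+ _)%g; move: ee; clear; lia.
apply: (le_trans (gpMl H _ _ _)); rewrite (lenV H).
apply: (@le_trans _ _ (l B + (l (A ^+ e.+1)%g + (P + 2 * delta)))); last first.
  by have := len_powA_le em; lra.
rewrite lerD2l; apply: (le_trans (gpMl H _ _ _)); rewrite (lenV H) lerD2l.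
apply: (@gp_branch (B ^+ 1)^-1%g (A ^+ (e' - e.+1).+1)^-1%g).
- have := gp_sylp_last H S P0 PD (true, e1) ((false, 0%N) :: pairs t).
  by rewrite (gpC H) -/(last (false, 0%N) _) -[last _ _]/(last (true, e1) (pairs (e1 :: t))) last_pairs.
- have := gp_sylp_last H S P0 PD (true, e1') (rcons ((false, 0%N) :: pairs t') (true, (e' - e.+1)%N)).
  by rewrite last_rcons (gpC H).
- by rewrite (gpC H); exact: (sch_neg S).
Qed.

Lemma len_pairs_ge tau N es : (forall n, tau * n%:R <= l (A ^+ n)%g) -> 0 <= tau ->
  all (leq N) es -> (size es)%:R * (tau * N%:R) / 2 <= l (W es).
Proof.
move=> At tau0 esN; apply: le_trans (len_sylp_ge H S P0 PD _).
rewrite ler_pM2r ?invr_gt0 //; elim: es esN => [|e es IH /= /andP[eN /IH{}IH]].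
  by rewrite mul0r big_nil.
rewrite !big_cons -natr1 mulrDl mul1r addrC lerD //; last first.
  by rewrite -[leLHS]add0r lerD ?(len_ge0 H).
apply: le_trans (At _); rewrite ler_wpM2l // ler_nat.
exact: leq_trans eN (leqnSn _).
Qed.
End Pairs.

Lemma monochromatic_subsequence (T : finType) (col : nat -> T) K N : (K * #|T| <= N)%N ->
  exists js : seq nat, [/\ size js = K.+1, sorted ltn js, all (leq^~ N) js &
    exists c, all (fun j => col j == c) js].
Proof.
move=> KN; pose cl c := [seq j <- iota 0 N.+1 | col j == c].
have [c cK] : exists c, (K < size (cl c))%N.
  apply/existsP; apply: contraLR KN; rewrite negb_exists => /forallP no.
  rewrite -ltnNge; have <- : (\sum_c size (cl c) = N.+1)%N.
    rewrite -[RHS](size_iota 0) -sum1_size.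
    rewrite (partition_big col xpredT) //=; apply: eq_bigr => c _.
    by rewrite sum1_count size_filter.
  apply: (@leq_trans (\sum_(c : T) K)%N); last by rewrite sum_nat_const mulnC.
  by apply: leq_sum => c _; rewrite leqNgt no.
exists (take K.+1 (cl c)); split.
- by rewrite size_takel.
- by apply: take_sorted; apply: sorted_filter; [exact: ltn_trans|exact: iota_ltn_sorted].
- by apply/allP => j /mem_take; rewrite mem_filter mem_iota => /andP[_ /andP[_]]; rewrite add0n ltnS.
- by exists c; apply/allP => j /mem_take; rewrite mem_filter => /andP[].
Qed.

Section Loops.
Variables (R : realType) (G : groupType) (M : marking G) (delta : R).
Local Notation l := (fun g => (wlen M g)%:R : R).
Local Notation word := (seq 'I_(rank M)).
Hypothesis H : hyplen l delta.
Variables (A B : G) (P D : R) (r : nat).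
Hypothesis S : schottky l A B P D.
Hypotheses (P0 : 0 <= P) (PD : 4 * P + 20 * delta + 4 * r%:R < D).
Local Notation W es := (sylp A B (pairs es)).

Let d0 := delta_ge0 H.
Let PD' : 4 * P + 20 * delta < D.
Proof. by have h := PD; have := ler0n R r; lra. Qed.

Let Q : R := P + 2 * delta + 2 * r%:R.
Let r2 : nat := (Num.truncn (2 * Q + 2 * delta)).+1.

Lemma btw_prefix N j a b : (j <= N)%N -> (wlen M a <= r)%N -> (wlen M b <= r)%N ->
  btw l (a * W (iota N j))%g (a * W (iota N N) * b)%g <= Q.
Proof.
move=> jN ar br; have d0' := d0; have P0' := P0.
have ar' : l a <= r%:R by rewrite ler_nat.
have br' : l b <= r%:R by rewrite ler_nat.
have e : W (iota N N) = (W (iota N j) * W (iota (N + j) (N - j)))%g.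
  by rewrite -sylp_cat -pairs_cat -iotaD subnKC.
set x := W (iota N j) in e *; set y := W (iota (N + j) (N - j)) in e.
suff xy : gp l x^-1 y <= P + 2 * delta.
  rewrite /btw e (_ : (a * x)^-1 * (a * (x * y) * b) = y * b)%g; last first.
    by rewrite (_ : a * (x * y) * b = a * x * (y * b))%g ?mulKg // !mulgA.
  rewrite invgM; have := gp_perturb H x^-1%g (y * b)%g a^-1%g.
  by have := gp_perturbr H x^-1%g y b; rewrite (lenV H) /Q; lra.
rewrite /x /y; clear e x y; case: j jN => [_|j jN].
  by rewrite /sylp /= gprod_nil invg1; have := gp_lel H 1%g (W (iota (N + 0) (N - 0)));
    rewrite (len1 H) /sylp; lra.
have [jN0|jN0] := posnP (N - j.+1).
  rewrite jN0 /= /sylp gprod_nil.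
  by have := gp_ler H (gprod [seq syl A B x | x <- pairs (iota N j.+1)])^-1%g 1%g; rewrite (len1 H); lra.
have := @chain_split _ _ _ _ H P D 1%g (syl A B (true, N))
  [seq syl A B x | x <- (false, 0%N) :: pairs (iota N.+1 j)]
  [seq syl A B x | x <- pairs (iota (N + j.+1) (N - j.+1))].
rewrite mul1g -gprod_cons; apply=> //.
- by move: PD'; lra.
- by rewrite invg1; have := gp_lel H 1%g (syl A B (true, N)); rewrite (len1 H); lra.
- exact: (sch_len S).
- by rewrite -map_cat; apply: (chain_syl0 S).
- by case: (N - j.+1)%N jN0.
Qed.

(** Makes the cutting times below monotone. Here the term [4 * r] in the bound on [D] is spent: a
    nonempty piece of u is longer than the error [2 * r] caused by [a]. *)
Lemma wlen_prefix_mono N i j a : (i <= j <= N)%N -> (wlen M a <= r)%N ->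
  (wlen M (a * W (iota N i)) <= wlen M (a * W (iota N j)))%N.
Proof.
move=> /andP[ij jN] ar; have [->//|] := eqVneq i j => inj.
have {ij inj} ij : (i < j)%N by rewrite ltn_neqAle inj.
have d0' := d0; have P0' := P0; have PD'' := PD; have ar' : l a <= r%:R by rewrite ler_nat.
have e : W (iota N j) = (W (iota N i) * W (iota (N + i) (j - i)))%g.
  by rewrite -sylp_cat -pairs_cat -iotaD subnKC // ltnW.
have long : D / 2 <= l (W (iota (N + i) (j - i))).
  case: (j - i)%N (subn_gt0 i j) => [|m _]; first by rewrite ij.
  apply: le_trans (len_sylp_ge H S P0 PD' _); rewrite ler_pM2r ?invr_gt0 //=.
  rewrite big_cons -[D]addr0 lerD ?(sch_len S) // sumr_ge0 // => *; exact: (len_ge0 H).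
suff xy : gp l (W (iota N i))^-1 (W (iota (N + i) (j - i))) <= P + 2 * delta.
  rewrite -(ler_nat R) e.
  have := lenM H a (W (iota N i)).
  have := len_subl H a (W (iota N i) * W (iota (N + i) (j - i)))%g.
  by rewrite (lenD H (W (iota N i))); lra.
case: i ij e {long} => [|i] ij e.
  by rewrite /sylp /= gprod_nil invg1; have := gp_lel H 1%g (W (iota (N + 0) (j - 0)));
    rewrite (len1 H) /sylp; lra.
have := @chain_split _ _ _ _ H P D 1%g (syl A B (true, N))
  [seq syl A B x | x <- (false, 0%N) :: pairs (iota N.+1 i)]
  [seq syl A B x | x <- pairs (iota (N + i.+1) (j - i.+1))].
rewrite mul1g -gprod_cons; apply=> //.
- by move: PD'; lra.
- by rewrite invg1; have := gp_lel H 1%g (syl A B (true, N)); rewrite (len1 H); lra.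
- exact: (sch_len S).
- by rewrite -map_cat; apply: (chain_syl0 S).
- by case: (j - i.+1)%N (subn_gt0 i.+1 j) => [|m _ //]; rewrite ij.
Qed.

Lemma parallel_times N (f p : word) a b : slex (p ++ f) -> ev f = (a * W (iota N N) * b)%g ->
  (wlen M a <= r)%N -> (wlen M b <= r)%N ->
  exists t : nat -> nat, [/\ forall i, (t i <= size f)%N,
    forall i j, (i <= j <= N)%N -> (t i <= t j)%N &
    forall j, (j <= N)%N ->
      (wlen M ((a * W (iota N j))^-1 * ev (take (t j) f))%g <= r2)%N].
Proof.
move=> lf fe ar br; exists (fun j => minn (wlen M (a * W (iota N j))%g) (size f)); split.
- by move=> i; apply: geq_minr.
- by move=> i j ij; rewrite leq_min geq_minr andbT (leq_trans (geq_minl _ _)) // wlen_prefix_mono.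
- move=> j jN; apply: (btw_near H (slex_catr lf)); first by rewrite fe; apply: btw_prefix.
  by rewrite ltW // truncnS_gt.
Qed.

(** The times at which [f] passes the prefixes of the translate are coloured by the automaton state
    and by the offset between the two paths. Equal states turn the subwords between chosen times
    into loops; equal offsets make one and the same [c] conjugate all of them into pieces of u. *)
Lemma loops K : exists N0, forall N, (N0 <= N)%N -> forall (p f : word) a b,
  slex (p ++ f) -> ev f = (a * W (iota N N) * b)%g -> (wlen M a <= r)%N -> (wlen M b <= r)%N ->
  exists (j : nat -> nat) (v : word) (beta : nat -> word) (c : G) (q : word),
   [/\ forall m n : nat, (m < n <= K)%N -> (j m < j n)%N, (j K <= N)%N, (wlen M c <= r2)%N,
     p ++ f = v ++ flatten [seq beta i | i <- iota 0 K] ++ q /\ (size p <= size v)%N &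
     forall i, (i < K)%N ->
       ev (beta i) = (c^-1 * W (iota (N + j i) (j i.+1 - j i)) * c)%g /\
       forall z, slex (v ++ beta i ++ z) = slex (v ++ z)].
Proof.
pose T : finType := ((size (ball M (Num.truncn (2 * delta + 6)).+1)).-tuple bool *
  'I_(size (ball M r2)).+1)%type.
exists (K * #|T|)%N => N KN p f a b lf fe ar br.
have [t [tf tmono tclose]] := parallel_times lf fe ar br.
pose cj j := ((a * W (iota N j))^-1 * ev (take (t j) f))%g.
pose col j : T := (state delta (p ++ take (t j) f), inord (index (cj j) (ball M r2))).
have [js [sj js_sorted jsN [c0 jsc]]] := monochromatic_subsequence col KN.
pose j i := nth 0%N js i.
have jmono m n : (m < n <= K)%N -> (j m < j n)%N.
  move=> /andP[mn nK]; apply: (sorted_ltn_nth ltn_trans 0%N js_sorted) => //.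
  - by rewrite inE sj (leq_ltn_trans (ltnW mn)).
  - by rewrite inE sj.
have jN i : (i <= K)%N -> (j i <= N)%N.
  by move=> iK; apply: (allP jsN); rewrite mem_nth // sj.
have colE i : (i <= K)%N -> col (j i) = c0.
  by move=> iK; apply/eqP; apply: (allP jsc); rewrite mem_nth // sj.
have tj m n : (m <= n <= K)%N -> (t (j m) <= t (j n))%N.
  move=> /andP[mn nK]; apply: tmono; rewrite jN // andbT.
  by case: ltngtP mn => // [mn _|-> //]; rewrite ltnW // jmono // mn.
pose v := p ++ take (t (j 0)) f; pose c := cj (j 0).
pose beta i := drop (t (j i)) (take (t (j i.+1)) f).
have iS i : iota 0 i.+1 = rcons (iota 0 i) i by rewrite -cats1 -addn1 iotaD.
have vi i : (i <= K)%N -> v ++ flatten [seq beta i | i <- iota 0 i] = p ++ take (t (j i)) f.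
  elim: i => [|i IH] iK; first by rewrite /= cats0.
  rewrite iS map_rcons flatten_rcons catA IH ?(ltnW iK) // -catA; congr (_ ++ _).
  rewrite /beta -{2}(cat_take_drop (t (j i)) (take (t (j i.+1)) f)) take_takel //.
  by apply: tj; rewrite leqnSn.
have ci i : (i <= K)%N -> cj (j i) = c.
  move=> iK; have : (col (j i)).2 = (col (j 0)).2 by rewrite !colE.
  have inb k : (k <= K)%N -> cj (j k) \in ball M r2 by move=> kK; rewrite mem_ball tclose // jN.
  move=> /(congr1 val); rewrite /= !inordK ?ltnS ?index_size // => e.
  by rewrite -(nth_index 1%g (inb i iK)) e nth_index // inb.
have lvi i : (i <= K)%N -> slex (p ++ take (t (j i)) f).
  move=> iK; move: lf; rewrite -{1}(cat_take_drop (t (j i)) f) catA.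
  exact: slex_catl.
have res i z : (i <= K)%N -> slex ((p ++ take (t (j i)) f) ++ z) = slex (v ++ z).
  move=> iK; apply: (state_residual H) (lvi _ iK) (lvi _ (leq0n _)) _.
  by have : (col (j i)).1 = (col (j 0)).1 by rewrite !colE.
exists j, v, beta, c, (drop (t (j K)) f); split=> //.
- exact: jN.
- by rewrite -(ci _ (leq0n K)) tclose // jN.
- split; last by rewrite size_cat leq_addr.
  by rewrite catA vi // -catA cat_take_drop.
move=> i iK; split.
  have e : ev (take (t (j i.+1)) f) = (ev (take (t (j i)) f) * ev (beta i))%g.
    rewrite -ev_cat; congr ev; rewrite /beta -{1}(cat_take_drop (t (j i)) (take _ f)).
    by rewrite take_takel // tj // leqnSn.
  have h1 := ci _ (ltnW iK); have h2 := ci _ iK.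
  have e1 : ev (take (t (j i)) f) = (a * W (iota N (j i)) * c)%g by rewrite -h1 /cj mulVKg.
  have e2 : ev (take (t (j i.+1)) f) = (a * W (iota N (j i.+1)) * c)%g by rewrite -h2 /cj mulVKg.
  have e3 : W (iota N (j i.+1)) = (W (iota N (j i)) * W (iota (N + j i) (j i.+1 - j i)))%g.
    by rewrite -sylp_cat -pairs_cat -iotaD subnKC // ltnW // jmono // leqnn.
  have -> : ev (beta i) = ((ev (take (t (j i)) f))^-1 * ev (take (t (j i.+1)) f))%g.
    by rewrite e mulKg.
  by rewrite e1 e2 e3 !invgM -!mulgA !mulKg.
move=> z; rewrite -(res i _ (ltnW iK)) -(vi _ (ltnW iK)) -(res i.+1 _ iK) -(vi _ iK).
by rewrite iS map_rcons flatten_rcons -!catA.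
Qed.
End Loops.

Lemma rot_iota_head K i : (i < K)%N -> exists s, rot i (iota 0 K) = i :: s.
Proof.
move=> iK; exists (drop i.+1 (iota 0 K) ++ take i (iota 0 K)).
by rewrite /rot (drop_nth 0%N) ?size_iota // nth_iota.
Qed.

Lemma rot_iota_last K i : (i < K)%N ->
  exists s, rot i (iota 0 K) = rcons s (if i is i'.+1 then i' else K.-1).
Proof.
case: i => [|i] iK.
  case: K iK => // K _; exists (iota 0 K).
  by rewrite rot0 -[K.+1.-1]/K -cats1 -[in LHS]addn1 iotaD.
exists (drop i.+1 (iota 0 K) ++ take i (iota 0 K)).
rewrite /rot (take_nth 0%N) ?size_iota ?(ltnW iK) // nth_iota ?(ltnW iK) //.
by rewrite add0n rcons_cat.
Qed.

Section SwapFamily.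
Variables (R : realType) (G : groupType) (M : marking G) (delta : R).
Local Notation l := (fun g => (wlen M g)%:R : R).
Local Notation word := (seq 'I_(rank M)).
Hypothesis H : hyplen l delta.
Variables (A B : G) (P D : R) (r : nat).
Hypothesis S : schottky l A B P D.
Hypotheses (P0 : 0 <= P) (PD : 4 * P + 20 * delta + 4 * r%:R < D).
Variables (lX : G -> R) (deltaX PX DX tau kappa : R).
Hypothesis HX : hyplen lX deltaX.
Hypothesis SX : schottky lX A B PX DX.
Hypotheses (PX0 : 0 <= PX) (PDX : 4 * PX + 20 * deltaX < DX).
Hypotheses (tau0 : 0 < tau) (A_tau : forall n, tau * n%:R <= lX (A ^+ n)%g).
Hypothesis lX_le : forall g, lX g <= kappa * (wlen M g)%:R.
Local Notation W es := (sylp A B (pairs es)).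

(** Equal sizes keep exchanges inside a sphere. The bound [1 <= E] makes each pivot gain an absolute
    amount, uniformly over all families. *)
Definition swap_family (K : nat) (Fam : 'I_K -> word) : Prop :=
  (forall i j, size (Fam i) = size (Fam j)) /\
  exists C E, [/\ 0 <= C, 1 <= E & separated lX deltaX (fun i => ev (Fam i)) C E].

(** The rotation by [i] starts with loop [i] and ends with the cyclically preceding loop, so
    distinct rotations differ both in their first and in their last exponent of [A]. *)
Theorem occurrence_swap_family (K0 : nat) : exists K N, (K0 <= K)%N /\
  forall (p f : word) a b, slex (p ++ f) -> ev f = (a * W (iota N N) * b)%g ->
    (wlen M a <= r)%N -> (wlen M b <= r)%N ->
    exists (Fam : 'I_K -> word) (v q : word) (i0 : 'I_K), [/\ swap_family Fam,
      p ++ f = v ++ Fam i0 ++ q, (size p <= size v)%N &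
      forall i z, slex (v ++ Fam i ++ z) = slex (v ++ z)].
Proof.
have dX0 := delta_ge0 HX; have PX0' := PX0.
have lA0 : 0 <= lX A by apply: (len_ge0 HX).
have lB0 : 0 <= lX B by apply: (len_ge0 HX).
(* [K] is fixed before [N]: then [K * tau * N / 2] exceeds [20 * (2 * N) * lX A] by at least [N],
   and this surplus absorbs the constant [c1]. *)
have [K1 K1P] : exists n : nat, 2 * (40 * lX A + 1) / tau < n%:R.
  by exists (Num.truncn (2 * (40 * lX A + 1) / tau)).+1; rewrite truncnS_gt.
pose K := maxn K0 (maxn K1 2); exists K.
have K2 : (1 < K)%N by rewrite !leq_max leqnn !orbT.
have KA : 40 * lX A + 1 <= K%:R * tau / 2.
  have : K1%:R <= K%:R :> R by rewrite ler_nat !leq_max leqnn !orbT.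
  move: K1P; rewrite ltr_pdivrMr // => h1 h2.
  by have := ler_wpM2r (ltW tau0) h2; lra.
have [N0 loopsP] := loops H S P0 PD K.
have [c0 c0P] : exists c0 : R, forall c, (wlen M c <=
    (Num.truncn (2 * (P + 2 * delta + 2 * r%:R) + 2 * delta)).+1)%N -> lX c <= c0.
  exists (`|kappa| * (Num.truncn (2 * (P + 2 * delta + 2 * r%:R) + 2 * delta)).+1%:R) => c cr.
  apply: (le_trans (lX_le c)); apply: (@le_trans _ _ (`|kappa| * (wlen M c)%:R)).
    by rewrite ler_wpM2r // ler_norm.
  by rewrite ler_wpM2l // ler_nat.
have c00 : 0 <= c0.
  apply: le_trans (c0P 1%g _); first exact: (len_ge0 HX).
  by rewrite (_ : wlen M 1 = 0)%N //; apply/eqP; have := wlen_ev (M := M) [::]; rewrite ev_nil leqn0.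
pose c1 := 20 * (lX B + PX + 2 * deltaX + 3 * c0 + deltaX) + 2 * c0 + 1.
have [N1 N1P] : exists n : nat, c1 < n%:R by exists (Num.truncn c1).+1; rewrite truncnS_gt.
pose N := maxn N0 N1; exists N; split; first by rewrite leq_max leqnn.
have Nc1 : c1 <= N%:R.
  by apply: (le_trans (ltW N1P)); rewrite ler_nat leq_max leqnn orbT.
move=> p f a b lf fe ar br.
have [j [v [beta [c [q [jmono jN cr [pf pv] betaP]]]]]] :=
  loopsP N (leq_maxl _ _) p f a b lf fe ar br.
have {}cr := c0P c cr; have lc0 := len_ge0 HX c.
pose E i := iota (N + j i) (j i.+1 - j i).
pose Fam (i : 'I_K) : word := flatten [seq beta k | k <- rot i (iota 0 K)].
have evF s : all (ltn^~ K) s -> 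
    ev (flatten [seq beta k | k <- s]) = (c^-1 * W (flatten [seq E k | k <- s]) * c)%g.
  elim: s => [|k s IH] /=; first by rewrite ev_nil /sylp gprod_nil mulg1 mulVg.
  move=> /andP[/betaP[bk _] /IH{}IH].
  by rewrite ev_cat bk IH pairs_cat sylp_cat !mulgA mulgK.
have rotK i : all (ltn^~ K) (rot i (iota 0 K)).
  by apply/allP => k; rewrite mem_rot mem_iota add0n => /andP[].
have loopF s z : all (ltn^~ K) s -> slex (v ++ flatten [seq beta k | k <- s] ++ z) = slex (v ++ z).
  elim: s => [//|k s IH] /= /andP[/betaP[_ bk] /IH{}IH].
  by rewrite -catA bk IH.
pose es (i : 'I_K) := flatten [seq E k | k <- rot i (iota 0 K)].
have evFam i : ev (Fam i) = (c^-1 * W (es i) * c)%g by apply: evF.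
have jle i : (i <= K)%N -> (j i <= N)%N.
  rewrite leq_eqVlt => /orP[/eqP->//|iK]; apply: leq_trans jN; apply: ltnW.
  by apply: jmono; rewrite iK leqnn.
have Ecut i : (i < K)%N -> exists t, E i = (N + j i)%N :: t.
  move=> iK; rewrite /E; have := jmono i i.+1; rewrite ltnSn iK => /(_ isT).
  by rewrite -subn_gt0; case: (_ - _)%N => // m _; exists (iota (N + j i).+1 m).
have Ecut' i : (i < K)%N -> exists t, E i = rcons t (N + (j i.+1).-1)%N.
  move=> iK; rewrite /E; have jj := jmono i i.+1; rewrite ltnSn iK in jj.
  have {jj} := jj isT; move: (j i) (j i.+1) => x y xy.
  exists (iota (N + x) (y - x).-1).
  have -> : (y - x = (y - x).-1 + 1)%N by move: xy; clear; lia.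
  rewrite iotaD -cats1 /=; congr (_ ++ [:: _]); first by rewrite addn1.
  by move: xy; clear; lia.
have esN i : all (leq N) (es i).
  apply/allP => e /flattenP[_ /mapP[k _ ->]]; rewrite mem_iota => /andP[h _].
  exact: leq_trans (leq_addr _ _) h.
have esK i : (K <= size (es i))%N.
  have : perm_eq (es i) (flatten [seq E k | k <- iota 0 K]).
    by apply/perm_flatten/perm_map; rewrite perm_rot.
  move=> /perm_size ->; rewrite -[leqLHS](size_iota 0) -sum1_size size_flatten /shape -map_comp.
  rewrite sumnE big_map big_seq [leqRHS]big_seq leq_sum // => k.
  rewrite mem_iota add0n => /andP[_ kK].
  by rewrite /= size_iota subn_gt0 jmono // ltnSn.
have es_head i : exists t, es i = (N + j i)%N :: t.
  have [s sE] := rot_iota_head (ltn_ord i); have [t tE] := Ecut _ (ltn_ord i).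
  by exists (t ++ flatten [seq E k | k <- s]); rewrite /es sE /= tE.
pose e' (i : 'I_K) := (N + (j (if nat_of_ord i is i'.+1 then i' else K.-1).+1).-1)%N.
have es_last i : exists2 t, ~~ nilp t & es i = rcons t (e' i).
  have [s sE] := rot_iota_last (ltn_ord i).
  set m := (if _ is _.+1 then _ else _) in sE.
  have mK : (m < K)%N.
    by rewrite /m; case: (i) => -[|i'] /= h; [rewrite ltn_predL|exact: ltnW].
  have [t tE] := Ecut' _ mK.
  exists (flatten [seq E k | k <- s] ++ t); last first.
    by rewrite /es sE map_rcons flatten_rcons tE rcons_cat.
  have : size (rot i (iota 0 K)) = K by rewrite size_rot size_iota.
  have := rotK i; rewrite sE size_rcons all_rcons; case: s {sE} => [_ K1'|k s].
    by rewrite -K1' in K2.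
  move=> /andP[_ /= /andP[kK _]] _; have [t' ->] := Ecut _ kK.
  by rewrite /nilp.
have e'_inj i i' : i != i' -> e' i != e' i'.
  have jpos n : (0 < n <= K)%N -> (0 < j n)%N.
    by move=> /andP[n0 nK]; apply: leq_ltn_trans (jmono 0%N n _); rewrite ?n0.
  pose pred' n := (if n is n'.+1 then n' else K.-1).
  have key x y : (x < y)%N -> (y < K)%N ->
      (N + (j (pred' x).+1).-1 != N + (j (pred' y).+1).-1)%N.
    rewrite eqn_add2l; case: y => // y; case: x => [|x] /= xy yK.
      rewrite prednK ?(ltn_trans _ K2) //.
      have h1 : (0 < j y.+1)%N by apply: jpos; rewrite /= ltnW.
      have h2 : (j y.+1 < j K)%N by apply: jmono; rewrite yK leqnn.
      by move: h1 h2; clear; lia.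
    have h1 : (0 < j x.+1)%N by apply: jpos; move: xy yK; clear; lia.
    have h2 : (j x.+1 < j y.+1)%N by apply: jmono; move: xy yK; clear; lia.
    by move: h1 h2; clear; lia.
  rewrite -val_eqE neq_ltn => /orP[h|h]; first exact: key h (ltn_ord i').
  by rewrite eq_sym; exact: key h (ltn_ord i).
have jK2 i : (N + j i < 2 * N)%N = (j i < N)%N by rewrite mul2n -addnn ltn_add2l.
have conj_gp x y : gp lX (c^-1 * x * c)%g (c^-1 * y * c)%g <= gp lX x y + 3 * c0.
  have := gpMl HX c^-1%g (x * c)%g (y * c)%g; rewrite !mulgA.
  have := gp_perturb HX x (y * c)%g c; have := gp_perturbr HX x y c.
  by rewrite (lenV HX); lra.
pose C := (2 * N)%:R * lX A + lX B + PX + 2 * deltaX + 3 * c0.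
pose E' := K%:R * (tau * N%:R) / 2 - 2 * c0.
have NR0 := ler0n R N.
have E'big : 20 * (C + deltaX) <= E' /\ 1 <= E'.
  have h := ler_wpM2r NR0 KA; rewrite /E' /C natrM.
  have nA : 0 <= N%:R * lX A by rewrite mulr_ge0.
  by move: Nc1; rewrite /c1 => Nc1; split; lra.
(* Rotation by 0 is the subword actually present in [p ++ f]. *)
exists Fam, v, q, (Ordinal (ltnW K2)); split=> //.
- split.
    move=> i i'; rewrite /Fam; apply/perm_size/perm_flatten/perm_map.
    by rewrite perm_rot perm_sym perm_rot.
  exists C, E'; split; [|by case: E'big|split].
  + by rewrite /C !addr_ge0 // ?mulr_ge0.
  + move=> i i' ii'; rewrite !evFam (le_trans (conj_gp _ _)) // lerD2r.
    have [t ->] := es_head i; have [t' ->] := es_head i'.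
    have key (x : 'I_K) : (N + j x < 2 * N)%N.
      by rewrite jK2; apply: leq_trans jN; apply: jmono; rewrite ltn_ord leqnn.
    apply: le_trans (gp_pairs_fwd HX SX PX0 PDX t t' (key i) (key i') _) _.
      rewrite eqn_add2l; move: ii'; rewrite -val_eqE neq_ltn => /orP[]h.
        by rewrite ltn_eqF // jmono // h ltnW.
      by rewrite eq_sym ltn_eqF // jmono // h ltnW.
    by lra.
  + move=> i i' ii'; rewrite !evFam.
    have inv x : (c^-1 * x * c)^-1%g = (c^-1 * x^-1 * c)%g by rewrite !invgM invgK mulgA.
    rewrite !inv (le_trans (conj_gp _ _)) // lerD2r.
    have [t nt ->] := es_last i; have [t' nt' ->] := es_last i'.
    have key (x : 'I_K) : (e' x < 2 * N)%N.
      rewrite /e' mul2n -addnn ltn_add2l; set m := (if _ is _.+1 then _ else _).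
      have mK : (m < K)%N.
        by rewrite /m; case: (x) => -[|x'] /= h; [rewrite ltn_predL|exact: ltnW].
      have := jle m.+1 mK; have := jmono m m.+1; rewrite ltnSn mK => /(_ isT).
      by clear; lia.
    exact: (gp_pairs_bwd HX SX PX0 PDX (key i) (key i') (e'_inj _ _ ii') nt nt').
  + move=> i; rewrite evFam.
    have := len_pairs_ge HX SX PX0 PDX A_tau (ltW tau0) (esN i).
    have := len_sub HX (c^-1 * W (es i))%g c; have := len_subl HX c^-1%g (W (es i)).
    have : K%:R * (tau * N%:R) <= (size (es i))%:R * (tau * N%:R).
      by rewrite ler_wpM2r ?ler_nat // mulr_ge0 // ltW.
    by rewrite (lenV HX) /E'; lra.
  + by case: E'big.
- by rewrite pf /Fam rot0.
- by move=> i z; apply: loopF.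
Qed.
End SwapFamily.

(** * Swapping factors of normal forms *)

Lemma pos_mull (G : groupType) K (F : 'I_K -> G) h g0 g s n :
  pos F (h * g0)%g g s n = (h * pos F g0 g s n)%g.
Proof. by elim: n => //= n ->; rewrite !mulgA. Qed.

Lemma pos_shift (G : groupType) K (F : 'I_K -> G) g0 g s n :
  pos F g0 g s n.+1 =
  (g0 * F (s 0%N) * pos F (g 0%N) (fun i => g i.+1) (fun i => s i.+1) n)%g.
Proof.
elim: n => [//|n IH].
by rewrite -[pos F g0 g s n.+2]/(pos F g0 g s n.+1 * F (s n.+1) * g n.+1)%g IH /= !mulgA.
Qed.

Lemma count_fibres (T U : eqType) (f : T -> U) (p : pred T) (s : seq T) :
  (\sum_(u <- undup (map f s)) count (fun x => p x && (f x == u)) s = count p s)%N.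
Proof.
under eq_bigr do rewrite -sum1_count big_mkcond /=.
rewrite exchange_big -sum1_count [RHS]big_mkcond /=.
rewrite big_seq [RHS]big_seq; apply: eq_bigr => x xs.
case: (p x) => /=; last by rewrite big1.
rewrite -big_mkcond sum1_count (eq_count (a2 := pred1 (f x))); last first.
  by move=> u; rewrite /= eq_sym.
by rewrite count_uniq_mem ?undup_uniq // mem_undup map_f.
Qed.

Section Swaps.
Variables (G : groupType) (M : marking G).
Local Notation word := (seq 'I_(rank M)).
Variables (K : nat) (Fam : 'I_K -> word) (i0 : 'I_K) (b o : nat).
Hypotheses (Fam_inj : injective Fam) (Fam_size : forall i j, size (Fam i) = size (Fam j)).
Implicit Types (X w : word) (s : nat -> 'I_K).
Let m := size (Fam i0).

Definition loopy X : bool := `[< forall i z, slex (X ++ Fam i ++ z) = slex (X ++ z) >].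

(** A block carries at most one exchangeable factor, at the fixed offset [o]; the loop condition
    involves everything read before it. *)
Definition active X blk : option 'I_K :=
  if (o + m <= size blk)%N && loopy (X ++ take o blk)
  then [pick i | take m (drop o blk) == Fam i] else None.

(* The position of the swappable factors in the first n blocks, together with
   everything else: None marks a block without such a factor. *)
Fixpoint skel n X w : seq (word * option word) :=
  if n is n'.+1 then
    let blk := take b w in
    (if active X blk is Some i then (take o blk, Some (drop (o + m) blk)) else (blk, None))
      :: skel n' (X ++ blk) (drop b w)
  else [::].

Fixpoint factors n X w : seq 'I_K :=
  if n is n'.+1 then
    let blk := take b w in
    let l := factors n' (X ++ blk) (drop b w) in
    if active X blk is Some i then i :: l else l
  else [::].

Fixpoint build (it : seq (word * option word)) rem s : word :=
  match it with
  | [::] => rem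
  | (p, Some q) :: it' => p ++ Fam (s 0%N) ++ q ++ build it' rem (fun i => s i.+1)
  | (p, None) :: it' => p ++ build it' rem s
  end.

Definition nact (it : seq (word * option word)) := count (fun x => isSome x.2) it.

Lemma activeP X blk i : active X blk = Some i ->
  [/\ blk = take o blk ++ Fam i ++ drop (o + m) blk, (o + m <= size blk)%N &
      loopy (X ++ take o blk)].
Proof.
rewrite /active; case: andP => // -[om lp]; case: pickP => // j /eqP tj [ji].
split=> //; rewrite -ji -tj -{1}(cat_take_drop o blk); congr (_ ++ _).
by rewrite addnC -drop_drop cat_take_drop.
Qed.

Lemma size_factors n X w : size (factors n X w) = nact (skel n X w).
Proof. by elim: n X w => //= n IH X w; case: (active _ _) => [i|] /=; rewrite IH. Qed.

Lemma build_skel n X w :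
  build (skel n X w) (drop (n * b) w) (nth i0 (factors n X w)) = w.
Proof.
elim: n X w => [|n IH] X w; first by rewrite /= drop0.
rewrite [skel _ _ _]/= [factors _ _ _]/=.
have e : drop (n.+1 * b) w = drop (n * b) (drop b w) by rewrite drop_drop mulSn addnC.
have IH' := IH (X ++ take b w) (drop b w).
case a : (active _ _) => [i|]; rewrite e; last first.
  by rewrite [build _ _ _]/= IH' cat_take_drop.
have [blkE _ _] := activeP a.
transitivity ((take o (take b w) ++ Fam i ++ drop (o + m) (take b w)) ++ drop b w).
  by rewrite -!catA [build _ _ _]/=; congr (_ ++ (_ ++ (_ ++ _))); exact: IH'.
by rewrite -blkE cat_take_drop.
Qed.

Lemma ev_build it rem : exists g0 g, forall s,
  ev (build it rem s) = pos (fun i => ev (Fam i)) g0 g s (nact it).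
Proof.
elim: it => [|[p [q|]] it [g0 [g IH]]]; first by exists (ev rem), (fun=> 1%g).
  exists (ev p), (fun n => if n is n'.+1 then g n' else (ev q * g0)%g) => s.
  by rewrite [LHS]/= !ev_cat IH -[nact (_ :: it)]/(nact it).+1 pos_shift pos_mull !mulgA.
by exists (ev p * g0)%g, g => s; rewrite /= ev_cat IH pos_mull.
Qed.

(** [X] and [X'] are the prefixes before and after the exchanges already made; accepting the same
    continuations is all that the induction needs. Together with [build_skel] this parametrises the
    normal forms with given skeleton and remainder by arbitrary sequences of factors. *)
Lemma skel_build n X X' w s : (forall z, slex (X ++ z) = slex (X' ++ z)) ->
  slex (X ++ w) -> (n * b <= size w)%N ->
  let w' := build (skel n X w) (drop (n * b) w) s in
  [/\ slex (X' ++ w'), size w' = size w, skel n X' w' = skel n X w,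
      drop (n * b) w' = drop (n * b) w &
      factors n X' w' = [seq s i | i <- iota 0 (nact (skel n X w))]].
Proof.
elim: n X X' w s => [|n IH] X X' w s XX' lw nb.
  by rewrite /= !drop0 -XX'.
have bw : (b <= size w)%N by apply: leq_trans nb; rewrite mulSn leq_addr.
have sb : size (take b w) = b by rewrite size_takel.
have nb' : (n * b <= size (drop b w))%N by rewrite size_drop leq_subRL // -mulSn.
have e : drop (n.+1 * b) w = drop (n * b) (drop b w) by rewrite drop_drop mulSn addnC.
have lw' : slex ((X ++ take b w) ++ drop b w) by rewrite -catA cat_take_drop.
have lpE Y : loopy (X ++ Y) = loopy (X' ++ Y).
  by apply: asbool_equiv_eq; split=> h i z; have := h i z; rewrite -!catA !XX'.
rewrite e [skel n.+1 X w]/=; case a : (active X (take b w)) => [i|]; last first.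
  have XX1 z : slex ((X ++ take b w) ++ z) = slex ((X' ++ take b w) ++ z).
    by rewrite -!catA XX'.
  have [h1 h2 h3 h4 h5] := IH _ _ _ s XX1 lw' nb'.
  have a' : active X' (take b w) = None by move: a; rewrite /active lpE.
  rewrite [build _ _ _]/=; set w1 := build _ _ _ in h1 h2 h3 h4 h5 *.
  have t1 : take b (take b w ++ w1) = take b w by rewrite take_size_cat.
  have d1 : drop b (take b w ++ w1) = w1 by rewrite drop_size_cat.
  split.
  - by rewrite catA.
  - by rewrite size_cat h2 -size_cat cat_take_drop.
  - by rewrite /= t1 d1 a' h3.
  - by rewrite mulSn addnC -drop_drop d1 h4.
  - by rewrite /= t1 d1 a' h5.
have [blkE om lp] := activeP a; set p := take o (take b w) in blkE lp *.
set q := drop (o + m) (take b w) in blkE *.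
have XX1 z : slex ((X ++ take b w) ++ z) = slex ((X' ++ p ++ Fam (s 0%N) ++ q) ++ z).
  have := lp; rewrite lpE => lp'; move/asboolP: lp => lp; move/asboolP: lp' => lp'.
  rewrite {1}blkE -!catA; have := lp i (q ++ z); rewrite -!catA => ->.
  by rewrite XX'; have := lp' (s 0%N) (q ++ z); rewrite -!catA => ->.
have [h1 h2 h3 h4 h5] := IH _ _ _ (fun i => s i.+1) XX1 lw' nb'.
rewrite [build _ _ _]/=; set w1 := build _ _ _ in h1 h2 h3 h4 h5 *.
have szp : size p = o by rewrite size_takel // (leq_trans _ om) ?leq_addr.
have szb : size (p ++ Fam (s 0%N) ++ q) = b.
  by rewrite -[RHS]sb {1}blkE !size_cat (Fam_size _ i).
have wE : p ++ Fam (s 0%N) ++ q ++ w1 = (p ++ Fam (s 0%N) ++ q) ++ w1 by rewrite -!catA.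
have t1 : take b (p ++ Fam (s 0%N) ++ q ++ w1) = p ++ Fam (s 0%N) ++ q.
  by rewrite wE take_size_cat.
have d1 : drop b (p ++ Fam (s 0%N) ++ q ++ w1) = w1 by rewrite wE drop_size_cat.
have sm : size (Fam (s 0%N)) = m by apply: Fam_size.
have to : take o (p ++ Fam (s 0%N) ++ q) = p by rewrite take_size_cat.
have dm : drop (o + m) (p ++ Fam (s 0%N) ++ q) = q.
  by rewrite addnC -drop_drop drop_size_cat // drop_size_cat.
have a' : active X' (p ++ Fam (s 0%N) ++ q) = Some (s 0%N).
  rewrite /active to szb -sb om -lpE lp drop_size_cat // take_size_cat //.
  by case: pickP => [j /eqP/Fam_inj->//|/(_ (s 0%N))]; rewrite eqxx.
split.
- by move: h1; rewrite -!catA.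
- by rewrite wE size_cat szb h2 size_drop subnKC.
- by rewrite /= t1 d1 a' to dm h3.
- by rewrite mulSn addnC -drop_drop d1 h4.
- by rewrite /= t1 d1 a' h5 -[iota 1 _]/(iota (1 + 0) _) iotaDl -map_comp.
Qed.
End Swaps.

Section SwapCount.
Variables (R : realType) (G : groupType) (M : marking G).
Variables (lX : G -> R) (deltaX : R).
Hypothesis HX : hyplen lX deltaX.
Local Notation word := (seq 'I_(rank M)).
Variables (K : nat) (Fam : 'I_K -> word) (i0 : 'I_K) (b o : nat).
Hypotheses (SF : swap_family lX deltaX Fam) (bigK : (2 ^ 12 <= K)%N).
Local Notation sk n w := (skel Fam i0 b o n [::] w).

Lemma swap_family_inj : injective Fam.
Proof.
have [_ [C [E [C0 E1 sep]]]] := SF => i j ij; apply/eqP; apply: contraT => neq.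
have := sep_fwd sep neq; rewrite ij /gp mulVg (len1 HX).
by have := sep_len sep j; have := sep_big sep; have := delta_ge0 HX; lra.
Qed.

(** Each fibre of [f], the words with a given skeleton and remainder, has at least [K ^ k] members
    obtained by [bd], and [ev_build] writes their values as the products of [few_short_products].
    The inequality is summed over the fibres. *)
Lemma swap_count_eq n p k :
  (count (fun w => (nact (sk n w) == k) && (lX (ev w) < k%:R / 6)%R) (lw M (n * b + p)) * 2 ^ k
     <= count (fun w => nact (sk n w) == k) (lw M (n * b + p)))%N.
Proof.
have [sz [C [E [C0 E1 sep]]]] := SF.
pose f w := (sk n w, drop (n * b) w).
pose L := [seq w <- lw M (n * b + p) | nact (sk n w) == k].
have -> : count (fun w => (nact (sk n w) == k) && (lX (ev w) < k%:R / 6)%R) (lw M (n * b + p)) =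
    count (fun w => (lX (ev w) < k%:R / 6)%R) L.
  by rewrite /L count_filter; apply: eq_count => w; rewrite /= andbC.
rewrite -[leqRHS]size_filter -/L -(count_predT L) -(count_fibres f predT).
rewrite -(count_fibres f (fun w => (lX (ev w) < k%:R / 6)%R)).
rewrite big_distrl /= big_seq [leqRHS]big_seq leq_sum // => u.
rewrite mem_undup => /mapP[w wL ->] {u}.
have [/eqP nk lw' sw] : [/\ nact (sk n w) == k, slex w & (size w = n * b + p)%N].
  by move: wL; rewrite mem_filter mem_lw => /andP[-> /andP[-> /eqP->]].
have nbw : (n * b <= size w)%N by rewrite sw leq_addr.
have E0 : 0 < E by apply: lt_le_trans E1.
pose bd (s : {ffun 'I_k -> 'I_K}) := build Fam (sk n w) (drop (n * b) w) (extend i0 s).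
have bdP (s : {ffun 'I_k -> 'I_K}) := skel_build i0 o swap_family_inj sz (extend i0 s)
  (fun z => erefl (slex ([::] ++ z))) lw' nbw.
have [g0 [g evE]] := ev_build Fam (sk n w) (drop (n * b) w).
have few := few_short_products HX sep C0 E0 g0 g i0 k bigK.
set Bad := [set s | _]%SET in few.
apply: (@leq_trans (K ^ k)%N).
  apply: leq_trans few; rewrite leq_mul2r; apply/orP; right.
  pose cd v : {ffun 'I_k -> 'I_K} := [ffun i : 'I_k => nth i0 (factors Fam i0 b o n [::] v) i].
  rewrite -size_filter -(size_map cd) cardE; apply: uniq_leq_size.
    rewrite map_inj_in_uniq; first by rewrite filter_uniq // filter_uniq // uniq_lw.
    move=> v v'; rewrite !mem_filter /= => /andP[/andP[_ /eqP[vs vd]] /andP[/eqP vk _]].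
    move=> /andP[/andP[_ /eqP[vs' vd']] /andP[/eqP vk' _]] cdE.
    rewrite -(build_skel Fam i0 b o n [::] v) -(build_skel Fam i0 b o n [::] v').
    rewrite vs vd vs' vd'; congr (build _ _ _ (nth _ _)).
    apply: (@eq_from_nth _ i0); first by rewrite !size_factors vk vk'.
    move=> i; rewrite size_factors vk => ik.
    have := congr1 (fun h : {ffun 'I_k -> 'I_K} => h (Ordinal ik)) cdE.
    by rewrite !ffunE.
  move=> s; rewrite mem_enum => /mapP[v]; rewrite !mem_filter /=.
  move=> /andP[/andP[vb /eqP[vs vd]] /andP[/eqP vk _]] ->.
  rewrite inE; apply: (@lt_le_trans _ _ (k%:R / 6)); last first.
    by rewrite ler_pM2r ?invr_gt0 // ler_peMr.
  rewrite (_ : pos _ _ _ _ _ = ev v) // -[in RHS](build_skel Fam i0 b o n [::] v) vs vd evE nk.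
  apply: pos_local => i ik; rewrite /extend insubT /= ffunE.
  by [].
have -> : (K ^ k = size [seq bd s | s <- enum {: {ffun 'I_k -> 'I_K}}])%N.
  by rewrite size_map -cardE card_ffun !card_ord.
rewrite -size_filter; apply: uniq_leq_size.
  rewrite map_inj_uniq ?enum_uniq // => s s' ss'; apply/ffunP => i.
  have [_ _ _ _ h] := bdP s; have [_ _ _ _ h'] := bdP s'.
  rewrite -/(bd s) -/(bd s') in h h'; move: h; rewrite ss' h' nk => /eq_in_map/(_ (val i)).
  by rewrite mem_iota add0n ltn_ord -!(extendE i0) => /(_ isT) ->.
move=> v /mapP[s _ ->]; have [h1 h2 h3 h4 _] := bdP s.
rewrite -/(bd s) in h1 h2 h3 h4.
by rewrite !mem_filter /= /f h3 h4 eqxx nk eqxx mem_words h2 sw eqxx h1.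
Qed.

Lemma swap_count n p k0 :
  (count (fun w => (k0 <= nact (sk n w))%N && (lX (ev w) < k0%:R / 6)%R) (lw M (n * b + p)) * 2 ^ k0
     <= nu M (n * b + p))%N.
Proof.
rewrite /nu -(count_predT (lw M _)) -(count_fibres (fun w => nact (sk n w)) predT).
rewrite -(count_fibres (fun w => nact (sk n w)) (fun w => (k0 <= nact (sk n w))%N && _)).
rewrite big_distrl /= leq_sum // => k _; have [k0k|kk0] := leqP k0 k; last first.
  rewrite [X in (X * _)%N](_ : _ = 0)%N ?mul0n //; apply/eqP.
  rewrite -leqn0 leqNgt -has_count; apply/hasPn => w _ /=.
  apply/negP => /andP[/andP[h _] /eqP e]; move: h; rewrite e leqNgt kk0 //.
apply: leq_trans (swap_count_eq n p k); apply: leq_mul; last by rewrite leq_pexp2l.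
apply: sub_count => w /= /andP[/andP[_ h] ->] /=; apply: lt_le_trans h _.
by rewrite ler_pM2r ?invr_gt0 // ler_nat.
Qed.
End SwapCount.

(** * Independent loxodromic elements *)

Record independent (R : realType) (G : groupType) (l : G -> R) (a b : G) (C tau : R) : Prop :=
  Independent {
    ind_turn : forall x y i j, x \in [:: a; b] -> y \in [:: a; b] ->
      gp l (x ^+ i)^-1%g (y ^+ j)%g <= C;
    ind_pos : forall i j, gp l (a ^+ i)%g (b ^+ j)%g <= C;
    ind_neg : forall i j, gp l (a ^+ i)^-1%g (b ^+ j)^-1%g <= C;
    ind_growth : forall x n, x \in [:: a; b] -> tau * n%:R <= l (x ^+ n)%g }.

(** Passing to powers leaves the bound [C] unchanged while lengths grow linearly in [m], so the
    ratio of [D] to [C] becomes as large as desired. *)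
Lemma independent_schottky (R : realType) (G : groupType) (l : G -> R) (a b : G) (C tau : R) m :
  0 <= tau -> independent l a b C tau ->
  schottky l (a ^+ m)%g (b ^+ m)%g C (tau * m%:R).
Proof.
move=> tau0 ind; have sylE x : syl (a ^+ m)%g (b ^+ m)%g x = ((if x.1 then a else b) ^+ (m * x.2.+1))%g.
  by rewrite /syl; case: x.1; rewrite expgnA.
have memab (c : bool) : (if c then a else b) \in [:: a; b].
  by case: c; rewrite !inE eqxx ?orbT.
split.
- by move=> x y; rewrite !sylE; apply: (ind_turn ind).
- by move=> i j; rewrite -!expgnA; apply: (ind_pos ind).
- by move=> i j; rewrite -!expgnA; apply: (ind_neg ind).
- move=> x; rewrite sylE; apply: le_trans (ind_growth ind _ (memab _)).
  by rewrite ler_wpM2l // ler_nat leq_pmulr.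
Qed.

Section Transfer.
Variables (R : realType) (G : groupType) (l lX : G -> R) (delta deltaX kappa tau : R).
Hypotheses (H : hyplen l delta) (HX : hyplen lX deltaX).
Hypotheses (kappa0 : 0 < kappa) (tau0 : 0 < tau) (lX_le : forall g, lX g <= kappa * l g).

Lemma growth_transfer a : (forall n, tau * n%:R <= lX (a ^+ n)%g) ->
  forall n, tau / kappa * n%:R <= l (a ^+ n)%g.
Proof.
move=> gr n; rewrite mulrAC ler_pdivrMr // mulrC [leRHS]mulrC mulrC.
exact: le_trans (gr n) (lX_le _).
Qed.

Lemma first_passage e i t : 0 < t -> t <= l (e ^+ i)%g ->
  exists k, [/\ (k <= i)%N, t <= l (e ^+ k)%g & l (e ^+ k)%g <= t + l e].
Proof.
move=> t0 ti; have ex : exists k, t <= l (e ^+ k)%g by exists i.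
case: (ex_minnP ex) => k tk kmin; exists k; split=> //; first exact: kmin.
case: k tk kmin => [|k] tk kmin; first by move: tk; rewrite expg0 (len1 H) leNgt t0.
have : l (e ^+ k)%g < t by rewrite ltNge; apply/negP => /kmin; rewrite ltnn.
by rewrite expgSr; have := lenM H (e ^+ k)%g e; lra.
Qed.

(** If powers of [e] and [f] followed each other in [G] up to distance [t], some [e ^+ k] and
    [f ^+ m] at that distance would be within a constant [C2], hence within [kappa * C2] in [X].
    Their forking in [X] bounds [k], and [t <= k * l e]. *)
Lemma gp_transfer e f C : (forall n, tau * n%:R <= lX (e ^+ n)%g) ->
  (forall n, tau * n%:R <= lX (f ^+ n)%g) ->
  (forall i j, gp lX (e ^+ i)%g (f ^+ j)%g <= C) ->
  exists C', forall i j, gp l (e ^+ i)%g (f ^+ j)%g <= C'.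
Proof.
move=> ge gf gpX; have d0 := delta_ge0 H.
have tk0 : 0 < tau / kappa by rewrite divr_gt0.
have [Ce Ce0 Cee] := power_gp H tk0 (growth_transfer ge).
have [Cf Cf0 Cff] := power_gp H tk0 (growth_transfer gf).
have le0 : 0 < l e.
  by have := growth_transfer ge 1; rewrite mulr1 expg1; apply: lt_le_trans.
have lf0 := len_ge0 H f.
pose C2 := l e + l f + 2 * (Ce + Cf) + 4 * delta.
have C20 : 0 <= C2 by rewrite /C2; lra.
pose T := (kappa * C2 + 2 * `|C|) * l e / tau.
have T0 : 0 <= T.
  apply: divr_ge0; last exact: ltW.
  apply: mulr_ge0; last exact: ltW.
  by apply: addr_ge0; apply: mulr_ge0 => //; apply: ltW.
exists T => i j; rewrite leNgt; apply/negP => big.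
set t := gp l _ _ in big; have t0 : 0 < t by apply: le_lt_trans big.
have [k [ki tk kt]] := first_passage t0 (gp_lel H (e ^+ i)%g (f ^+ j)%g).
have [m [mj tm mt]] := first_passage t0 (gp_ler H (e ^+ i)%g (f ^+ j)%g).
have h1 : t - Ce <= gp l (e ^+ k)%g (e ^+ i)%g.
  by rewrite -(subnKC ki) expgnDr (gpK H); have := Cee k (i - k)%N; lra.
have h2 : t - Cf <= gp l (f ^+ j)%g (f ^+ m)%g.
  by rewrite (gpC H) -{1}(subnKC mj) expgnDr (gpK H); have := Cff m (j - m)%N; lra.
have h3 : t - Ce - Cf - 2 * delta <= gp l (e ^+ k)%g (f ^+ m)%g.
  case: (hyp4 H (e ^+ k)%g (e ^+ i)%g (f ^+ m)%g) => [|h]; first by lra.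
  by case: (hyp4 H (e ^+ i)%g (f ^+ j)%g (f ^+ m)%g); rewrite -/t; lra.
have h4 : l ((e ^+ k)^-1 * f ^+ m)%g <= C2.
  have : l ((e ^+ k)^-1 * f ^+ m)%g =
    l (e ^+ k)%g + l (f ^+ m)%g - 2 * gp l (e ^+ k)%g (f ^+ m)%g by rewrite /gp; lra.
  by rewrite /C2; lra.
have h5 : tau * k%:R - 2 * `|C| <= kappa * C2.
  have := lX_le ((e ^+ k)^-1 * f ^+ m)%g; have := ler_wpM2l (ltW kappa0) h4.
  have := gpX k m; have := ge k; have := len_ge0 HX (f ^+ m)%g; have := ler_norm C.
  by rewrite {1}/gp; lra.
have h6 : t <= k%:R * l e by apply: le_trans tk (lenX H _ _).
have : t * tau <= (kappa * C2 + 2 * `|C|) * l e.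
  apply: (@le_trans _ _ (k%:R * l e * tau)); first by rewrite ler_wpM2r // ltW.
  by rewrite mulrAC ler_wpM2r ?(ltW le0) //; move: h5; rewrite mulrC; lra.
by rewrite -ler_pdivlMr // -/T leNgt big.
Qed.

Lemma independent_transfer a b C : independent lX a b C tau ->
  exists2 C', 0 <= C' & independent l a b C' (tau / kappa).
Proof.
move=> ind; have ga n := ind_growth ind n (mem_head _ _).
have mb : b \in [:: a; b] by rewrite !inE eqxx orbT.
have gb n := ind_growth ind n mb.
have inv e : (forall n, tau * n%:R <= lX (e ^+ n)%g) -> forall n, tau * n%:R <= lX (e^-1 ^+ n)%g.
  by move=> ge n; rewrite expVgn (lenV HX).
have [C1 h1] := gp_transfer ga gb (ind_pos ind).
have [|C2 h2] := @gp_transfer a^-1%g b^-1%g C (inv _ ga) (inv _ gb).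
  by move=> i j; rewrite !expVgn; apply: (ind_neg ind).
have turn x y : x \in [:: a; b] -> y \in [:: a; b] ->
    exists C', forall i j, gp l (x ^+ i)^-1%g (y ^+ j)%g <= C'.
  move=> xab yab; have gx n := ind_growth ind n xab; have gy n := ind_growth ind n yab.
  have [|C' h] := @gp_transfer x^-1%g y C (inv _ gx) gy.
    by move=> i j; rewrite expVgn; apply: (ind_turn ind).
  by exists C' => i j; rewrite -expVgn.
have [C3 h3] := turn a a (mem_head _ _) (mem_head _ _).
have [C4 h4] := turn a b (mem_head _ _) mb.
have [C5 h5] := turn b a mb (mem_head _ _).
have [C6 h6] := turn b b mb mb.
pose C' := `|C1| + `|C2| + `|C3| + `|C4| + `|C5| + `|C6|.
have n1 := ler_norm C1; have n2 := ler_norm C2; have n3 := ler_norm C3.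
have n4 := ler_norm C4; have n5 := ler_norm C5; have n6 := ler_norm C6.
have p1 := normr_ge0 C1; have p2 := normr_ge0 C2; have p3 := normr_ge0 C3.
have p4 := normr_ge0 C4; have p5 := normr_ge0 C5; have p6 := normr_ge0 C6.
exists C'; first by rewrite /C' !addr_ge0.
split.
- move=> x y i j; rewrite !inE => /orP[]/eqP-> /orP[]/eqP->.
  + by apply: (le_trans (h3 i j)); rewrite /C'; lra.
  + by apply: (le_trans (h4 i j)); rewrite /C'; lra.
  + by apply: (le_trans (h5 i j)); rewrite /C'; lra.
  + by apply: (le_trans (h6 i j)); rewrite /C'; lra.
- by move=> i j; apply: (le_trans (h1 i j)); rewrite /C'; lra.
- by move=> i j; have := h2 i j; rewrite !expVgn /C'; lra.
- by move=> x n xab; apply: growth_transfer => k; apply: (ind_growth ind).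
Qed.
End Transfer.

(** * Displacement, orbits and boundary fixed points *)

Section Action.
Variables (R : realType) (G : groupType) (X : metricType R) (act : G -> X -> X) (x : X).
Hypotheses (hX : gromov_hyperbolic (@mdist R X)) (isom : isometric_action act).
Local Notation d := (@mdist R X).

Definition displacement g : R := d (act g x) x.

Let act1 y : act 1%g y = y. Proof. by case: isom. Qed.
Let actM g h y : act (g * h)%g y = act g (act h y). Proof. by case: isom. Qed.
Let act_isom g y z : d (act g y) (act g z) = d y z. Proof. by case: isom. Qed.

Lemma mdist_act g h : d (act g x) (act h x) = displacement (g^-1 * h)%g.
Proof. by rewrite /displacement -(act_isom g^-1%g (act g x)) -!actM mulVg act1 metric_sym. Qed.

Lemma displacement_hyplen : exists delta, hyplen displacement delta.
Proof.
have [delta d0 hyp] := hX; exists delta; split=> //.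
- by rewrite /displacement act1 mdistxx.
- by move=> g; rewrite /displacement -[in LHS](act_isom g) -actM mulgV act1 metric_sym.
- move=> g h; apply: (le_trans (metric_triangle _ (act g x) _)).
  by rewrite actM act_isom addrC.
- move=> g h k; have := hyp x (act g x) (act h x) (act k x).
  by rewrite /gromov_product !mdist_act.
Qed.

Lemma iter_act g n y : iter n (act g) y = act (g ^+ n)%g y.
Proof. by elim: n y => [|n IH] y; rewrite ?expg0 ?act1 //= IH -actM expgS. Qed.

(** By subadditivity along the multiples of [n], the translation length is a lower bound for the
    displacement of [a ^+ n] divided by [n]. *)
Lemma loxodromic_growth a : loxodromic (act a) ->
  exists2 tau, 0 < tau & forall n, tau * n%:R <= displacement (a ^+ n)%g.
Proof.
move=> [tau tau0 /(_ x) tl]; exists tau => // n; have [delta H] := displacement_hyplen.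
case: n => [|n]; first by rewrite mulr0; apply: (len_ge0 H).
rewrite leNgt; apply/negP => lt; set c := displacement _ in lt.
have eps0 : 0 < tau - c / n.+1%:R by rewrite subr_gt0 ltr_pdivrMr.
have /cvgrPdist_lt/(_ _ eps0) [N _ NP] := tl.
have := NP (N.+1 * n.+1)%N.
have NN : (N <= N.+1 * n.+1)%N by rewrite (leq_trans (leqnSn N)) // leq_pmulr.
move=> /(_ NN); rewrite iter_act mulnC expgnA metric_sym -/(displacement _).
have h := lenX H (a ^+ n.+1)%g N.+1; rewrite -/c in h.
move: h; set e := displacement _; move=> h.
have : e / (n.+1 * N.+1)%:R <= c / n.+1%:R.
  rewrite natrM invfM mulrA ler_pdivrMr // mulrAC ler_pM2r ?invr_gt0 //.
  by rewrite mulrC.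
clearbody e c; move: (e / _) (c / _) => u w h1 h2.
by have := ler_norm (tau - u); lra.
Qed.

Let gpx y z : R := gromov_product d x y z.

Lemma asymptoticP u v : @asymptotic R X u v <->
  forall T, exists N, forall i j, (N <= i)%N -> (N <= j)%N -> T <= gpx (u i) (v j).
Proof.
split=> [as_uv T|uv o].
  have /cvgryPge/(_ T) := as_uv x; case=> -[A B] /= [[NA _ NAP] [NB _ NBP]] AB.
  exists (maxn NA NB) => i j; rewrite !geq_max => /andP[i1 _] /andP[_ j2].
  by apply: (AB (i, j)); split; [exact: NAP|exact: NBP].
apply/cvgryPge => T; have [N NP] := uv (T + d x o).
exists ([set i | (N <= i)%N], [set j | (N <= j)%N]); first by split; exists N.
move=> [i j] /= [iN jN]; have := NP i j iN jN; rewrite /gpx /gromov_product.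
have := metric_triangle (u i) o x; have := metric_triangle (v j) o x.
by rewrite !(metric_sym o x); lra.
Qed.

Lemma asymptotic_sym u v : @asymptotic R X u v -> asymptotic v u.
Proof.
move=> /asymptoticP uv; apply/asymptoticP => T; have [N NP] := uv T.
exists N => i j iN jN; have := NP j i jN iN.
by rewrite /gpx /gromov_product (metric_sym (u j) (v i)); lra.
Qed.

Lemma asymptotic_trans v u w : @asymptotic R X u v -> asymptotic v w -> asymptotic u w.
Proof.
have [delta _ hyp] := hX.
move=> /asymptoticP uv /asymptoticP vw; apply/asymptoticP => T.
have [N NP] := uv (T + delta); have [N' NP'] := vw (T + delta).
exists (maxn N N') => i j; rewrite !geq_max => /andP[iN iN'] /andP[jN jN'].
have := hyp x (u i) (v (maxn N N')) (w j).
have := NP i (maxn N N') iN (leq_maxl _ _); have := NP' (maxn N N') j (leq_maxr _ _) jN'.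
by rewrite /gpx minEle; case: ifP => _; lra.
Qed.

(* If g moves every point of u by a bounded amount then it preserves asymptoticity to u. *)
Lemma asymptotic_act g u v c : (forall i, d (act g (u i)) (u i) <= c) ->
  asymptotic u v -> asymptotic u (act g \o v).
Proof.
move=> gc /asymptoticP uv; apply/asymptoticP => T.
have [N NP] := uv (T + c + displacement g); exists N => i j iN jN.
have := NP i j iN jN; rewrite /gpx /gromov_product /=.
have := gc i; have := metric_triangle (u i) (act g (u i)) (act g (v j)).
have := metric_triangle (act g (v j)) x (act g x).
have := mdist_ge0 (act g x) x; have := mdist_ge0 (act g (u i)) (u i).
by rewrite !act_isom /displacement (metric_sym x (act g x)) (metric_sym (u i) (act g (u i))); lra.
Qed.

Variables (e g : G) (tau : R).
Hypotheses (tau0 : 0 < tau) (growth : forall n, tau * n%:R <= displacement (e ^+ n)%g).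
Hypothesis eg : (g * e = e * g)%g.

Let orb n := act (e ^+ n)%g x.

Lemma orbit_gp : exists C, forall i j, tau * (minn i j)%:R - C <= gpx (orb i) (orb j).
Proof.
have [delta H] := displacement_hyplen; have [C C0 CP] := power_gp H tau0 growth.
exists C; have gpE i j : gpx (orb i) (orb j) = gp displacement (e ^+ i)%g (e ^+ j)%g.
  by rewrite /gpx /gromov_product /gp !mdist_act.
have le i j : (i <= j)%N -> tau * i%:R - C <= gp displacement (e ^+ i)%g (e ^+ j)%g.
  move=> ij; rewrite -(subnKC ij) expgnDr (gpK H).
  by have := CP i (j - i)%N; have := growth i; lra.
move=> i j; rewrite gpE; case: (leqP i j) => [ij|/ltnW ji]; first exact: le.
by rewrite (gpC H); exact: le.
Qed.

Lemma orbit_converges : converges_to_infinity orb.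
Proof.
apply/asymptoticP => T; have [C CP] := orbit_gp.
have [N NP] : exists N : nat, (T + C) / tau < N%:R.
  by exists (Num.truncn ((T + C) / tau)).+1; rewrite truncnS_gt.
exists N => i j iN jN; have := CP i j; move: NP; rewrite ltr_pdivrMr // mulrC => NP.
have : tau * N%:R <= tau * (minn i j)%:R by rewrite ler_wpM2l ?(ltW tau0) // ler_nat leq_min iN.
lra.
Qed.

(** Assuming commutation instead of [g = e] yields two fixed points of a loxodromic [g], from the
    orbits of [g] and of its inverse. *)
Lemma orbit_boundary_fix : boundary_fix (act g) (boundary_class orb).
Proof.
have comm n : (g * e ^+ n = e ^+ n * g)%g.
  by elim: n => [|n IH]; rewrite ?expg0 ?mulg1 ?mul1g // expgS mulgA eg -!mulgA IH.
have moved h n : (h * e ^+ n = e ^+ n * h)%g -> d (act h (orb n)) (orb n) <= displacement h.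
  by move=> he; rewrite /orb -actM he actM act_isom.
have commV n : (g^-1 * e ^+ n = e ^+ n * g^-1)%g.
  by apply: (@mulgI _ g); rewrite mulVKg mulgA comm mulgK.
have pres h v : (forall n, h * e ^+ n = e ^+ n * h)%g -> boundary_class orb v ->
    boundary_class orb (act h \o v).
  move=> hc [vv ov]; have ohv := asymptotic_act (fun n => moved h n (hc n)) ov.
  split=> //; exact: asymptotic_trans (asymptotic_sym ohv) ohv.
split; first by exists orb => //; exact: orbit_converges.
apply/seteqP; split=> [_ [v ov <-]|v ov]; first exact: pres comm ov.
exists (act g^-1%g \o v); first exact: pres commV ov.
by apply/funext => n; rewrite /= -actM mulgV act1.
Qed.
End Action.

Section Independence.
Variables (R : realType) (G : groupType) (X : metricType R) (act : G -> X -> X) (x : X).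
Hypotheses (hX : gromov_hyperbolic (@mdist R X)) (isom : isometric_action act).
Local Notation lX := (displacement act x).

(** Were the products unbounded, the two orbits would be asymptotic and define one boundary point
    fixed by both [a] and [b]. A single large product propagates to all large exponents because each
    orbit converges. *)
Lemma disjoint_fix_gp a b e f tau : 0 < tau ->
  (forall n, tau * n%:R <= lX (e ^+ n)%g) -> (forall n, tau * n%:R <= lX (f ^+ n)%g) ->
  (a * e = e * a)%g -> (b * f = f * b)%g ->
  boundary_fix (act a) `&` boundary_fix (act b) = set0 ->
  exists C, forall i j, gp lX (e ^+ i)%g (f ^+ j)%g <= C.
Proof.
move=> tau0 ge gf ae bf dis; have [delta H] := displacement_hyplen x hX isom.
have d0 := delta_ge0 H; apply: contrapT => unb.
have big C : exists i j, C < gp lX (e ^+ i)%g (f ^+ j)%g.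
  apply: contrapT => no; apply: unb; exists C => i j; rewrite leNgt; apply/negP => h.
  by apply: no; exists i, j.
pose u n := act (e ^+ n)%g x; pose v n := act (f ^+ n)%g x.
have gpE h k : gromov_product (@mdist R X) x (act h x) (act k x) = gp lX h k.
  by rewrite /gromov_product /gp !(mdist_act _ isom).
have [Ce CeP] := orbit_gp hX isom tau0 ge; have [Cf CfP] := orbit_gp hX isom tau0 gf.
have le0 : 0 < lX e by have := ge 1%N; rewrite mulr1 expg1; apply: lt_le_trans.
have lf0 : 0 < lX f by have := gf 1%N; rewrite mulr1 expg1; apply: lt_le_trans.
have uv : asymptotic u v.
  apply/(asymptoticP x) => T.
  have [N NP] : exists N : nat, (`|T| + `|Ce| + `|Cf| + 2 * delta) / tau < N%:R.
    by exists (Num.truncn ((`|T| + `|Ce| + `|Cf| + 2 * delta) / tau)).+1; rewrite truncnS_gt.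
  rewrite ltr_pdivrMr // mulrC in NP.
  exists N => m n mN nN; have [i [j ij]] := big (`|T| + 2 * delta + N%:R * lX e + N%:R * lX f).
  have p1 : 0 <= N%:R * lX e by rewrite mulr_ge0 // ltW.
  have p2 : 0 <= N%:R * lX f by rewrite mulr_ge0 // ltW.
  have t0 := normr_ge0 T; have tT := ler_norm T; have ce0 := normr_ge0 Ce.
  have ceC := ler_norm Ce; have cf0 := normr_ge0 Cf; have cfC := ler_norm Cf.
  have iN : (N <= i)%N.
    rewrite leqNgt; apply/negP => iN; have := gp_lel H (e ^+ i)%g (f ^+ j)%g.
    have := lenX H e i; have : i%:R * lX e <= N%:R * lX e.
      by rewrite ler_wpM2r ?(ltW le0) // ler_nat ltnW.
    by lra.
  have jN : (N <= j)%N.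
    rewrite leqNgt; apply/negP => jN; have := gp_ler H (e ^+ i)%g (f ^+ j)%g.
    have := lenX H f j; have : j%:R * lX f <= N%:R * lX f.
      by rewrite ler_wpM2r ?(ltW lf0) // ler_nat ltnW.
    by lra.
  have h1 : tau * N%:R <= tau * (minn m i)%:R by rewrite ler_wpM2l ?(ltW tau0) // ler_nat leq_min mN.
  have h2 : tau * N%:R <= tau * (minn j n)%:R by rewrite ler_wpM2l ?(ltW tau0) // ler_nat leq_min jN.
  have := CeP m i; have := CfP j n; rewrite !gpE => g2 g1.
  case: (hyp4 H (e ^+ m)%g (e ^+ i)%g (f ^+ n)%g) => [|h3]; first by lra.
  by case: (hyp4 H (e ^+ i)%g (f ^+ j)%g (f ^+ n)%g); lra.
have cl : boundary_class u = boundary_class v.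
  have vu := asymptotic_sym x uv.
  by apply/seteqP; split=> w [ww uw]; split=> //; apply: (asymptotic_trans x hX) uw.
have fa := orbit_boundary_fix hX isom tau0 ge ae.
have fb := orbit_boundary_fix hX isom tau0 gf bf.
have : (boundary_fix (act a) `&` boundary_fix (act b)) (boundary_class u).
  by split=> //; rewrite cl.
by rewrite dis.
Qed.

(** The four choices of signs for powers of [a] and [b] each use one pair of fixed points; turns of
    an element against its own powers come from [power_gp]. *)
Lemma nonelementary_independent : nonelementary act ->
  exists a b C tau, [/\ 0 <= C, 0 < tau & independent lX a b C tau].
Proof.
move=> [a [b [la lb dis]]]; have [delta H] := displacement_hyplen x hX isom.
have [ta ta0 ga'] := loxodromic_growth x hX isom la.
have [tb tb0 gb'] := loxodromic_growth x hX isom lb.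
pose tau := Num.min ta tb; have tau0 : 0 < tau by rewrite lt_min ta0.
have ga n : tau * n%:R <= lX (a ^+ n)%g.
  by apply: le_trans (ga' n); rewrite ler_wpM2r // ge_min lexx.
have gb n : tau * n%:R <= lX (b ^+ n)%g.
  by apply: le_trans (gb' n); rewrite ler_wpM2r // ge_min lexx orbT.
have gaV n : tau * n%:R <= lX (a^-1 ^+ n)%g by rewrite expVgn (lenV H).
have gbV n : tau * n%:R <= lX (b^-1 ^+ n)%g by rewrite expVgn (lenV H).
have cV (h : G) : (h * h^-1 = h^-1 * h)%g by rewrite mulgV mulVg.
have [C1 h1] := disjoint_fix_gp tau0 ga gb erefl erefl dis.
have [C2 h2] := disjoint_fix_gp tau0 gaV gbV (cV a) (cV b) dis.
have [C3 h3] := disjoint_fix_gp tau0 gaV gb (cV a) erefl dis.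
have [C4 h4] := disjoint_fix_gp tau0 ga gbV erefl (cV b) dis.
have [C5 C50 h5] := power_gp H tau0 ga; have [C6 C60 h6] := power_gp H tau0 gb.
pose C := `|C1| + `|C2| + `|C3| + `|C4| + C5 + C6.
have n1 := ler_norm C1; have n2 := ler_norm C2; have n3 := ler_norm C3; have n4 := ler_norm C4.
have p1 := normr_ge0 C1; have p2 := normr_ge0 C2; have p3 := normr_ge0 C3; have p4 := normr_ge0 C4.
exists a, b, C, tau; split=> //; first by rewrite /C !addr_ge0.
split.
- move=> y z i j; rewrite !inE => /orP[]/eqP-> /orP[]/eqP->.
  + by apply: (le_trans (h5 i j)); rewrite /C; lra.
  + by have := h3 i j; rewrite expVgn /C; lra.
  + by rewrite (gpC H); have := h4 j i; rewrite expVgn /C; lra.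
  + by apply: (le_trans (h6 i j)); rewrite /C; lra.
- by move=> i j; apply: (le_trans (h1 i j)); rewrite /C; lra.
- by move=> i j; have := h2 i j; rewrite !expVgn /C; lra.
- by move=> y n; rewrite !inE => /orP[]/eqP->.
Qed.
End Independence.

(** * Positive drift *)

Section Drift.
Variables (R : realType) (G : groupType) (M : marking G) (delta : R).
Local Notation l := (fun g => (wlen M g)%:R : R).
Local Notation word := (seq 'I_(rank M)).
Hypothesis H : hyplen l delta.

Definition avoids (r : nat) (u : G) (w : word) : bool := ~~ `[< occurs r u w >].

Section OccurrenceGrowth.
Variables (A B : G) (P D : R) (s : seq (bool * nat)) (r : nat).
Hypothesis S : schottky l A B P D.
Hypotheses (P0 : 0 <= P) (PD : 4 * P + 20 * delta < D).
Hypothesis rP : 2 * (P + 3 * delta) + 4 * delta <= r%:R.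
Hypothesis unb : forall n, exists g, (n <= wlen M g)%N.
Local Notation u := (sylp A B s).

(** [kraft] is used twice: with a sphere, where equal lengths allow [conn_step], to bound the terms
    of the growth series at [zs], and with the words avoiding [u], to bound their whole series. *)
Lemma kraft_bound : exists zs C : R, [/\ 0 < zs <= 1, 1 <= C,
  forall n, 1 <= (nu M n)%:R * zs ^+ n,
  forall n, (nu M n)%:R * zs ^+ n <= C &
  forall N, \sum_(b < N) (count (avoids r u) (lw M b))%:R * zs ^+ b <= C].
Proof.
have [zs [/andP[z0 z1] nuz zT]] := critical_exponent R unb.
have [n2 step] := conn_step H S P0 PD s rP.
pose cs := connectors A B s; pose c0 := (\max_(c <- cs) wlen M c)%N.
have cs_le c : c \in cs -> (wlen M c <= c0)%N by move=> cin; apply: leq_bigmax_seq.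
pose m := (size (ball M n2) * size cs)%N.
have bound (E : seq word) : uniq E -> all (@slex G M) E ->
    (forall w v, w \in E -> v \in E -> size w = size v \/ (~ occurs r u w /\ ~ occurs r u v)) ->
    \sum_(w <- E) zs ^+ size w <= m%:R / zs ^+ c0.
  move=> uE lE stepE; rewrite ler_pdivlMr ?exprn_gt0 // mulrC.
  (* The growth sums are bounded only strictly below [zs]. As [E] is finite, its weight at
     [zs * (1 - x)] is at least [1 - J * x] times the weight at [zs], and [x] can be taken small. *)
  pose J := (c0 + \max_(w <- E) size w)%N; set T := _ * _.
  have T0 : 0 <= T.
    by rewrite mulr_ge0 ?exprn_ge0 ?(ltW z0) // sumr_ge0 // => w _; rewrite exprn_ge0 // ltW.
  have small x : 0 < x <= 1 -> (1 - J%:R * x) * T <= m%:R.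
    move=> /andP[x0 x1]; pose z := zs * (1 - x).
    have z01 : 0 <= z <= 1.
      by rewrite /z mulr_ge0 ?subr_ge0 ?(ltW z0) //= mulr_ile1 ?subr_ge0 ?(ltW z0) // gerBl ltW.
    have zz : 0 <= z < zs by rewrite (andP z01).1 /= gtr_pMr // gtrBl.
    have [T' T'P] := zT z zz.
    have := @kraft R G M (conn H S s) cs n2 c0 (connE H S s) cs_le E uE lE _ z T' z01 T'P.
    rewrite -/m => k; apply: le_trans (k _); last first.
      by move=> w v g h wE vE; apply: step => //; [exact: (allP lE)|exact: (allP lE)|exact: stepE].
    rewrite /T mulrCA mulr_sumr !mulr_sumr big_seq [leRHS]big_seq ler_sum // => w wE.
    rewrite mulrCA -exprD -exprD /z exprMn mulrC ler_wpM2l ?exprn_ge0 ?(ltW z0) //.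
    apply: le_trans (bernoulli _ x1); rewrite lerD2l lerN2 ler_wpM2r ?(ltW x0) // ler_nat.
    by rewrite leq_add2l leq_bigmax_seq.
  clearbody T; rewrite leNgt; apply/negP => mT; have T1 : 0 < T by apply: le_lt_trans mT.
  pose x := (T - m%:R) / (2 * (J%:R + 1) * T).
  have J0 := ler0n R J; have m0 := ler0n R m.
  have den : 0 < 2 * (J%:R + 1) * T by rewrite !mulr_gt0 //; lra.
  have x0 : 0 < x by rewrite divr_gt0 // subr_gt0.
  have xT : x * (2 * (J%:R + 1) * T) = T - m%:R by rewrite /x divfK // gt_eqF.
  have x1 : x <= 1.
    rewrite /x ler_pdivrMr // mul1r.
    by have : 0 <= J%:R * T by [rewrite mulr_ge0]; lra.
  have := small x; rewrite x0 x1 => /(_ isT).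
  have xT0 : 0 < x * T by rewrite mulr_gt0.
  by have : 0 <= J%:R * (x * T) by [rewrite mulr_ge0 // ltW]; move: xT xT0; lra.
have mz : 0 <= m%:R / zs ^+ c0 by rewrite divr_ge0 // exprn_ge0 // ltW.
exists zs, (m%:R / zs ^+ c0 + 1); split=> //; rewrite ?z0 ?z1 //; first by lra.
  move=> n; apply: (@le_trans _ _ (m%:R / zs ^+ c0)); last by rewrite lerDl.
  apply: le_trans (bound (lw M n) (uniq_lw M n) _ _).
  - rewrite big_seq (eq_bigr (fun=> zs ^+ n)); last by move=> w; rewrite mem_lw => /andP[_ /eqP->].
    by rewrite -big_seq big_const_seq count_predT iter_addr_0 -[leRHS]mulr_natl.
  - by apply/allP => w; rewrite mem_lw => /andP[].
  - by move=> w v; rewrite !mem_lw => /andP[_ /eqP->] /andP[_ /eqP->]; left.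
move=> N; apply: (@le_trans _ _ (m%:R / zs ^+ c0)); last by rewrite lerDl.
pose E n := flatten [seq [seq w <- lw M b | avoids r u w] | b <- iota 0 n].
have ES n : E n.+1 = E n ++ [seq w <- lw M n | avoids r u w].
  by rewrite /E -addn1 iotaD map_cat flatten_cat /= cats0.
have memE n w : (w \in E n) = [&& (size w < n)%N, slex w & avoids r u w].
  elim: n => [|n IH]; first by rewrite ltn0.
  rewrite ES mem_cat IH mem_filter mem_lw [in RHS]ltnS [in RHS]leq_eqVlt.
  by case: (size w < n)%N; case: (size w == n); case: (slex w); case: (avoids r u w).
have uE n : uniq (E n).
  elim: n => // n IH; rewrite ES cat_uniq IH filter_uniq ?uniq_lw //= andbT.
  apply/hasPn => w; rewrite mem_filter mem_lw => /and3P[_ _ /eqP wn] /=.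
  by rewrite memE wn ltnn.
apply: le_trans (bound (E N) (uE N) _ _).
- elim: N => [|n IH]; first by rewrite big_ord0 big_nil.
  rewrite big_ord_recr /= ES big_cat /= lerD //.
  rewrite -size_filter big_seq (eq_bigr (fun=> zs ^+ n)); last first.
    by move=> w; rewrite mem_filter mem_lw => /and3P[_ _ /eqP->].
  by rewrite -big_seq big_const_seq count_predT iter_addr_0 -[leRHS]mulr_natl.
- by apply/allP => w; rewrite memE => /and3P[].
- move=> w v; rewrite !memE => /and3P[_ _ /negP aw] /and3P[_ _ /negP av]; right.
  by split=> h; [apply: aw|apply: av]; apply/asboolP.
Qed.
End OccurrenceGrowth.
End Drift.

Lemma count_le_cover (W : eqType) (T : finType) (s : seq W) (q q0 : pred W) (P : pred T)
    (p : T -> pred W) :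
  (forall w, w \in s -> q w -> q0 w \/ exists2 t, P t & p t w) ->
  (count q s <= count q0 s + \sum_(t | P t) count (p t) s)%N.
Proof.
elim: s => [//|w s IH] cover; rewrite /= big_split /= addnACA leq_add //; last first.
  by apply: IH => v vs; apply: cover; rewrite inE vs orbT.
case qw : (q w) => //; have [->|[t Pt pt]] := cover w (mem_head _ _) qw.
  by rewrite leq_addr.
by rewrite (bigD1 t) //= pt addnCA leq_addr.
Qed.

Section GenericDrift.
Variables (R : realType) (G : groupType) (M : marking G) (delta : R).
Local Notation l := (fun g => (wlen M g)%:R : R).
Local Notation word := (seq 'I_(rank M)).
Hypothesis H : hyplen l delta.
Variables (lX : G -> R) (deltaX : R).
Hypothesis HX : hyplen lX deltaX.

Section Counting.
Variables (u : G) (r b K : nat) (i0 : 'I_K).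
Hypothesis bigK : (2 ^ 12 <= K)%N.
Hypothesis families : forall (p f : word) v1 v2, slex (p ++ f) -> ev f = (v1 * u * v2)%g ->
  (wlen M v1 <= r)%N -> (wlen M v2 <= r)%N ->
  exists (Fam : 'I_K -> word) (v q : word) (i : 'I_K), [/\ swap_family lX deltaX Fam,
    p ++ f = v ++ Fam i ++ q, (size p <= size v)%N &
    forall i z, slex (v ++ Fam i ++ z) = slex (v ++ z)].

(** The family found in a block depends on the block; encoding offset and family within length [b]
    in a finite type prepares a pigeonhole over all of them. *)
Let T : finType := ('I_b.+1 * {ffun 'I_K -> b.-bseq 'I_(rank M)})%type.
Let fam (t : T) : 'I_K -> word := fun i => t.2 i.
Let good (t : T) : bool := `[< swap_family lX deltaX (fam t) >].

Lemma occurrence_active X w : slex (X ++ w) -> size w = b -> ~~ avoids r u w ->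
  exists2 t, good t & active (fam t) i0 t.1 X w.
Proof.
move=> lw wb; rewrite negbK => /asboolP[f [v1 [v2 [/infixP[p1 [p2 wE]] r1 r2 fE]]]].
have lf : slex ((X ++ p1) ++ f).
  by move: lw; rewrite wE !catA => /slex_catl.
have [Fam [v [q [i [SF vE pv loops]]]]] := families lf fE r1 r2.
have Xv : (size X <= size v)%N by apply: leq_trans pv; rewrite size_cat leq_addr.
pose v' := drop (size X) v.
have vX : v = X ++ v'.
  rewrite -{1}(cat_take_drop (size X) v) -/v'; congr (_ ++ _).
  have := congr1 (take (size X)) vE; rewrite -catA take_size_cat // => e.
  by rewrite [RHS]e takel_cat.
have wE' : w = v' ++ Fam i ++ q ++ p2.
  have := congr1 (drop (size X)) vE; rewrite vX -!catA !drop_size_cat // => e.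
  by rewrite wE catA e -!catA.
have szF j : (size (Fam j) <= b)%N.
  rewrite (SF.1 j i) -wb wE' !size_cat addnCA leq_addr //.
have ov : (size v' < b.+1)%N by rewrite ltnS -wb wE' size_cat leq_addr.
pose t : T := (Ordinal ov, [ffun j => Bseq (szF j)]).
have famE : fam t = Fam by apply/funext => j; rewrite /fam ffunE.
exists t; first by apply/asboolP; rewrite famE.
rewrite /active famE /=.
have -> : take (size v') w = v' by rewrite wE' take_size_cat.
have -> : (size v' + size (Fam i0) <= size w)%N.
  by rewrite wE' !size_cat leq_add2l (SF.1 i0 i) leq_addr.
have -> : loopy Fam (X ++ v') by apply/asboolP; rewrite -vX.
rewrite /= {1}wE' drop_size_cat // (SF.1 i0 i) take_size_cat //.
by case: pickP => // /(_ i); rewrite eqxx.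
Qed.

Lemma sum_active_ge m X w : slex (X ++ w) -> (m * b <= size w)%N ->
  (m <= fcount (avoids r u) b m w + \sum_(t | good t) nact (skel (fam t) i0 b t.1 m X w))%N.
Proof.
elim: m X w => // m IH X w lw mb; rewrite [fcount _ _ _ _]/=.
have bw : (b <= size w)%N by apply: leq_trans mb; rewrite mulSn leq_addr.
have mb' : (m * b <= size (drop b w))%N by rewrite size_drop leq_subRL // -mulSn.
have lw' : slex ((X ++ take b w) ++ drop b w) by rewrite -catA cat_take_drop.
have {}IH := IH _ _ lw' mb'.
have -> : (\sum_(t | good t) nact (skel (fam t) i0 b t.1 m.+1 X w) =
  \sum_(t | good t) (active (fam t) i0 t.1 X (take b w) : bool) +
  \sum_(t | good t) nact (skel (fam t) i0 b t.1 m (X ++ take b w) (drop b w)))%N.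
  by rewrite -big_split; apply: eq_bigr => t _ /=; case: (active _ _ _ _ _).
have [a|na] := boolP (avoids r u (take b w)).
  by rewrite add1n addSn ltnS (leq_trans IH) // leq_add2l leq_addl.
have [t tg ta] := occurrence_active (slex_catl lw') (size_takel bw) na.
by rewrite add0n [X in (_ + (X + _))%N](bigD1 t) //= ta -!addnA add1n addnS
  ltnS (leq_trans IH) // leq_add2l leq_addl.
Qed.

(** Outside the first exceptional set more than half of the blocks are active for some family, so
    one family is active at least [k0] times. For each single family [swap_count] applies, and there
    are [c] pairs of offset and family to sum over. *)
Lemma bad_count : (0 < b)%N -> exists c : nat, forall (C : R) m p k0,
  (k0 * (2 * c.+1) <= m)%N ->
  (count (fun w => m <= 2 * fcount (avoids r u) b m w)%N (lw M (m * b + p)))%:R * 2 ^+ m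
    <= C * (nu M (m * b + p))%:R ->
  (count (fun w => (lX (ev w) < k0%:R / 6)%R) (lw M (m * b + p)))%:R <=
    (C / 2 ^+ m + c%:R / 2 ^+ k0) * (nu M (m * b + p))%:R.
Proof.
move=> b0; exists #|T| => C m p k0 k0m' few.
have k0m : (k0 * (2 * #|T|) <= m)%N by apply: leq_trans k0m'; rewrite !leq_mul.
set N := (m * b + p)%N in few *.
have bound : (count (fun w => (lX (ev w) < k0%:R / 6)%R) (lw M N) <=
    count (fun w => m <= 2 * fcount (avoids r u) b m w)%N (lw M N) +
    \sum_(t | good t) count (fun w => (k0 <= nact (skel (fam t) i0 b t.1 m [::] w))%N &&
         (lX (ev w) < k0%:R / 6)%R) (lw M N))%N.
  apply: count_le_cover => w; rewrite mem_lw => /andP[lw' /eqP sw] bad.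
  have [|few'] := leqP m (2 * fcount (avoids r u) b m w); [by left|right].
  have := @sum_active_ge m [::] w lw'; rewrite sw leq_addr => /(_ isT) h.
  have [t tg tk] : exists2 t, good t & (k0 <= nact (skel (fam t) i0 b t.1 m [::] w))%N.
    apply: contrapT => no.
    have up : (\sum_(t | good t) nact (skel (fam t) i0 b t.1 m [::] w) <= #|T| * k0.-1)%N.
      apply: (@leq_trans (\sum_(t | good t) k0.-1)%N).
        apply: leq_sum => t tg; have [//|lt] := leqP (nact (skel (fam t) i0 b t.1 m [::] w)) k0.-1.
        case: no; exists t => //; move: lt; clear; lia.
      by rewrite sum_nat_const leq_mul2r max_card orbT.
    have k00 : (0 < k0)%N.
      rewrite lt0n; apply/eqP => k00; apply: no.
      have [t tg _] : exists2 t, good t & True.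
        apply: contrapT => no'; move: h; rewrite big1; last by move=> t tg; case: no'; exists t.
        by rewrite addn0; move: few'; clear; lia.
      by exists t; rewrite // k00.
    have T0 : (#|T| * k0.-1 <= #|T| * k0)%N by rewrite leq_mul2l leq_pred orbT.
    have [T00|T1] := posnP #|T|.
      by move: up h few'; rewrite T00 mul0n; clear; lia.
    have T2 : (#|T| * k0.-1 < #|T| * k0)%N by rewrite ltn_pmul2l // prednK.
    by move: up h few' T2 k0m; move: (#|T| * k0.-1)%N (\sum_(t | good t) _)%N => x y; clear; nia.
  by exists t => //; rewrite tk bad.
have one t : good t -> (count (fun w => (k0 <= nact (skel (fam t) i0 b t.1 m [::] w))%N &&
         (lX (ev w) < k0%:R / 6)%R) (lw M N))%:R <= (nu M N)%:R / 2 ^+ k0 :> R.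
  move=> /asboolP tg; rewrite ler_pdivlMr ?exprn_gt0 // -natrX -natrM ler_nat.
  exact: (swap_count HX i0 b t.1 tg bigK).
apply: (@le_trans _ _ (count (fun w => m <= 2 * fcount (avoids r u) b m w)%N (lw M N) +
    \sum_(t | good t) count (fun w => (k0 <= nact (skel (fam t) i0 b t.1 m [::] w))%N &&
         (lX (ev w) < k0%:R / 6)%R) (lw M N))%:R); first by rewrite ler_nat.
rewrite natrD mulrDl lerD //.
  by rewrite mulrAC ler_pdivlMr ?exprn_gt0.
rewrite natr_sum; apply: (@le_trans _ _ (\sum_(t : T | good t) (nu M N)%:R / 2 ^+ k0)).
  by apply: ler_sum => t; apply: one.
rewrite sumr_const -[leLHS]mulr_natl mulrAC -mulrA ler_wpM2r ?ler_nat ?max_card //.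
by rewrite divr_ge0 // exprn_ge0.
Qed.
End Counting.

Lemma positive_drift (kappa : R) a b (C tau : R) : (forall g, lX g <= kappa * (wlen M g)%:R) ->
  0 < tau -> independent lX a b C tau ->
  exists2 L : R, 0 < L & forall eps : R, 0 < eps -> exists N0, forall N, (N0 <= N)%N ->
    (count (fun w => lX (ev w) < L * N%:R) (lw M N))%:R <= eps * (nu M N)%:R.
Proof.
move=> lX_le' tau0 indX; pose ka := Num.max kappa 1.
have ka0 : 0 < ka by rewrite /ka lt_max ltr01 orbT.
have lX_le g : lX g <= ka * (wlen M g)%:R.
  by apply: le_trans (lX_le' g) _; rewrite ler_wpM2r // /ka le_max lexx.
have [C' C'0 ind] := independent_transfer H HX ka0 tau0 lX_le indX.
have t'0 : 0 < tau / ka by rewrite divr_gt0.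
have natP (x : R) : exists n : nat, x < n%:R.
  by exists (Num.truncn x).+1; rewrite truncnS_gt.
have [r rP] := natP (2 * (C' + 3 * delta) + 4 * delta).
have [m1 m1P] := natP ((4 * C' + 20 * delta + 4 * r%:R) / (tau / ka)).
have [m2 m2P] := natP ((4 * Num.max C 0 + 20 * deltaX) / tau).
(* One and the same power of [a] and [b] has to give a Schottky pair for word length and for
   displacement. *)
pose m := (maxn m1 m2).+1; pose P := Num.max C 0.
have P0 : 0 <= P by rewrite /P le_max lexx orbT.
have mP1 : 4 * C' + 20 * delta + 4 * r%:R < tau / ka * m%:R.
  rewrite [ltRHS]mulrC -ltr_pdivrMr //; apply: (lt_le_trans m1P); rewrite ler_nat.
  by rewrite ltnW // ltnS leq_maxl.
have mP2 : 4 * P + 20 * deltaX < tau * m%:R.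
  rewrite [ltRHS]mulrC -ltr_pdivrMr //; apply: (lt_le_trans m2P); rewrite ler_nat.
  by rewrite ltnW // ltnS leq_maxr.
have S := independent_schottky m (ltW t'0) ind.
have SX : schottky lX (a ^+ m)%g (b ^+ m)%g P (tau * m%:R).
  have [s1 s2 s3 s4] := independent_schottky m (ltW tau0) indX.
  by split=> // x y; rewrite /P le_max ?(s1, s2, s3).
have A_tau n : tau * n%:R <= lX ((a ^+ m) ^+ n)%g.
  rewrite -expgnA; apply: le_trans (ind_growth indX _ (mem_head _ _)).
  by rewrite ler_wpM2l ?ler_nat ?leq_pmull // ltW.
have [K [n [bigK families]]] := occurrence_swap_family H S C'0 mP1 HX SX P0 mP2 tau0 A_tau lX_le (2 ^ 12).
have unb k : exists g, (k <= wlen M g)%N.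
  have [i iP] := natP (k%:R / (tau / ka)); exists (a ^+ i)%g.
  rewrite -(ler_nat R); apply: le_trans (ind_growth ind i (mem_head _ _)).
  by rewrite mulrC -ler_pdivrMr // ltW.
have d0 := delta_ge0 H; have r0 := ler0n R r.
have PD : 4 * C' + 20 * delta < tau / ka * m%:R by move: mP1; lra.
have [zs [C1 [zs0 C11 nuz nuC freeC]]] := kraft_bound H (pairs (iota n n)) S C'0 PD (ltW rP) unb.
have [B B0 few] := few_occurrences zs0 nuz C11 nuC freeC.
have K0 : (0 < K)%N by apply: leq_trans bigK; rewrite expn_gt0.
have [c bad] := bad_count (Ordinal K0) bigK families B0.
pose q := (B * (2 * c.+1))%N; have q0 : (0 < q)%N by rewrite muln_gt0 B0.
(* With [k0 = N %/ q] at least 1 one has [N <= 2 * (k0 * q)], hence [N / (12 * q) <= k0 / 6]. *)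
exists (12 * q%:R)^-1; first by rewrite invr_gt0 mulr_gt0 // ltr0n.
move=> eps eps0; have [n0 n0P] := natP ((C1 + c%:R) / eps).
exists (q * n0.+1)%N => N NN; pose k0 := (N %/ q)%N.
have k0n : (n0.+1 <= k0)%N by rewrite leq_divRL // mulnC.
have e : (N = N %/ B * B + N %% B)%N by apply: divn_eq.
have k0m : (k0 * (2 * c.+1) <= N %/ B)%N by rewrite /k0 divnMA leq_trunc_div.
have := bad C1 (N %/ B)%N (N %% B)%N k0 k0m (few _ _); rewrite -e => h.
apply: (@le_trans _ _ (count (fun w => lX (ev w) < k0%:R / 6) (lw M N))%:R).
  rewrite ler_nat; apply: sub_count => w /= lt; apply: lt_le_trans lt _.
  rewrite [leLHS]mulrC ler_pdivrMr ?mulr_gt0 ?ltr0n //.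
  have : (N <= 2 * (k0 * q))%N.
    apply: (leq_trans (ltnW (ltn_ceil N q0))).
    by rewrite mulnA leq_mul2r mul2n -addnn -add1n leq_add2r (leq_ltn_trans _ k0n) ?orbT.
  by rewrite -(ler_nat R) !natrM; lra.
apply: le_trans h _; rewrite ler_wpM2r //.
have p20 j : 0 < 2 ^+ j :> R by rewrite exprn_gt0.
apply: (@le_trans _ _ ((C1 + c%:R) / 2 ^+ k0)).
  rewrite mulrDl lerD2r ler_wpM2l ?lef_pV2 ?posrE //; first by move: C11; lra.
  by rewrite ler_weXn2l ?ler1n // (leq_trans _ k0m) // leq_pmulr.
rewrite ler_pdivrMr // mulrC -ler_pdivrMr //; apply/ltW/(lt_le_trans n0P).
by rewrite -natrX ler_nat ltnW // (leq_trans (ltn_expl n0 (ltnSn 1))) // leq_pexp2l // ltnW.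
Qed.
End GenericDrift.

(** * Word metrics *)

Section WordMetric.
Variables (R : realType) (G : groupType).

Lemma sublinear_wlen (M : marking G) (f : G -> R) : f 1%g = 0 ->
  (forall g h, f (g * h)%g <= f g + f h) ->
  exists2 kappa, 0 <= kappa & forall g, f g <= kappa * (wlen M g)%:R.
Proof.
move=> f1 fM; pose kappa : R := \sum_i `|f (@letter G M i)|; exists kappa.
  by rewrite sumr_ge0.
move=> g; have [w <- <-] := wlen_ex M g; elim: w => [|i w IH].
  by rewrite gprod_nil f1 mulr0.
rewrite /= gprod_cons -(natr1 (size w)) mulrDr mulr1 addrC; apply: le_trans (fM _ _) _.
rewrite lerD // /kappa (bigD1 i) //=; apply: le_trans (ler_norm _) _.
by rewrite lerDl sumr_ge0.
Qed.

Section Generators.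
Variable S : {fset G}.
Hypothesis genS : generates S.
Local Notation wl := (word_length S).

Lemma word_length_ex g : exists w, [/\ is_word S w, gprod w = g & size w = wl g].
Proof. by have [[w [wS wg] sw] _] := word_lengthP g genS; exists w. Qed.

Lemma word_length_le w : is_word S w -> (wl (gprod w) <= size w)%N.
Proof. by move=> wS; apply: (word_lengthP _ genS).2; exists w. Qed.

Lemma word_length1 : wl 1%g = 0%N.
Proof. by apply/eqP; rewrite -leqn0 -[X in wl X]gprod_nil word_length_le. Qed.

Lemma word_lengthM g h : (wl (g * h)%g <= wl g + wl h)%N.
Proof.
have [v [vS <- <-]] := word_length_ex g; have [w [wS <- <-]] := word_length_ex h.
by rewrite -gprod_cat -size_cat word_length_le // /is_word all_cat; apply/andP.
Qed.

Lemma word_lengthV g : wl g^-1%g = wl g.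
Proof.
suff le h : (wl h^-1%g <= wl h)%N by apply/eqP; rewrite eqn_leq le -{1}[g]invgK le.
have [w [wS <- <-]] := word_length_ex h.
elim: w wS => [|s w IH] /=; first by rewrite gprod_nil invg1 word_length1.
move=> /andP[sS wS]; rewrite gprod_cons invgM (leq_trans (word_lengthM _ _)) // -addn1 leq_add ?IH //.
rewrite -[s^-1%g]mulg1 -[X in (_ * X)%g]gprod_nil -gprod_cons word_length_le //.
by rewrite /= invgK orbC sS.
Qed.

Lemma word_dist_pseudometric : pseudometric (@word_dist R G S).
Proof.
split=> [g|g h|h g k]; rewrite /word_dist.
- by rewrite mulVg word_length1.
- by rewrite -word_lengthV invgM invgK.
- by rewrite -natrD ler_nat (leq_trans _ (word_lengthM _ _)) // mulgA mulgK.
Qed.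

Lemma word_dist_geod_connected : geod_connected (@word_dist R G S).
Proof.
move=> g h; have [w [wS wgh sw]] := word_length_ex (g^-1 * h)%g.
exists (fun i => g * gprod (take i w))%g, (size w); split.
- by rewrite take0 gprod_nil mulg1.
- by rewrite take_size wgh mulVKg.
move=> i j /andP[ij jw]; rewrite /word_dist; congr (_%:R).
pose u := drop i (take j w).
have tj : take j w = take i w ++ u.
  by rewrite -{1}(cat_take_drop i (take j w)) take_takel.
have -> : ((g * gprod (take i w))^-1 * (g * gprod (take j w)) = gprod u)%g.
  by rewrite invgM -mulgA mulKg tj gprod_cat mulKg.
have su : size u = (j - i)%N by rewrite size_drop size_takel.
have wE : w = take i w ++ u ++ drop j w by rewrite catA -tj cat_take_drop.
have /and3P[w1 w2 w3] : [&& is_word S (take i w), is_word S u & is_word S (drop j w)].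
  by move: wS; rewrite {1}wE /is_word !all_cat.
apply/eqP; rewrite eqn_leq -{1}su word_length_le //=.
have := word_lengthM (gprod (take i w)) (gprod u * gprod (drop j w)).
rewrite -!gprod_cat -wE wgh -sw gprod_cat => h1.
have h2 := word_lengthM (gprod u) (gprod (drop j w)).
have := word_length_le w1; have := word_length_le w3.
rewrite size_drop size_takel ?(leq_trans ij) // => h3 h4.
move: ij jw h1 h2 h3 h4; clear.
by move: (wl _) (wl _) (wl _) (wl _) => a b c d; lia.
Qed.

Lemma marking_word_length : exists M : marking G, wlen M = wl.
Proof.
pose A : seq G := (S `|` [fset s^-1%g | s in S])%fset.
have AP s : (s \in A) = (s \in S) || (s^-1%g \in S).
  rewrite !inE; congr (_ || _); apply/imfsetP/idP => [[t tS ->]|sS]; first by rewrite invgK.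
  by exists s^-1%g; rewrite ?invgK.
pose letter (i : 'I_(size A)) := nth 1%g A i.
have wordP w : is_word S w -> exists v, map letter v = w.
  elim: w => [|s w IH] /=; first by exists [::].
  move=> /andP[sS /IH[v <-]]; have sA : (index s A < size A)%N by rewrite index_mem AP.
  by exists (Ordinal sA :: v); rewrite /= /letter /= nth_index ?AP.
have ex g : exists2 w, gprod (map letter w) = g & size w = wl g.
  have [w [/wordP[v <-] wg sw]] := word_length_ex g.
  by exists v; rewrite // -sw size_map.
have le w : (wl (gprod (map letter w)) <= size w)%N.
  rewrite -(size_map letter) word_length_le //; apply/allP => _ /mapP[i _ ->].
  by rewrite -AP mem_nth.
by exists (Marking ex le).
Qed.
End Generators.

Lemma word_dist_bilipschitz (S S' : {fset G}) : generates S -> generates S' ->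
  exists2 c, 1 <= c & forall g h, @word_dist R G S g h <= c * @word_dist R G S' g h.
Proof.
move=> gS gS'; have [M MS'] := marking_word_length gS'.
have [||k k0 kP] := @sublinear_wlen M (fun g => (word_length S g)%:R).
- by rewrite word_length1.
- by move=> g h; rewrite -natrD ler_nat word_lengthM.
exists (Num.max 1 k); first by rewrite le_max lexx.
move=> g h; rewrite /word_dist; have := kP (g^-1 * h)%g; rewrite MS' => /le_trans; apply.
by rewrite ler_wpM2r // le_max lexx orbT.
Qed.

(** Hyperbolicity is given for one generating set; its word metric and that of [S] are bilipschitz
    and geodesic, so the property carries over. *)
Lemma hyperbolic_group_hyplen (S : {fset G}) : hyperbolic_group R G -> generates S ->
  exists delta, hyplen (fun g => (word_length S g)%:R : R) delta.
Proof.
move=> [S' gS' [delta d0 hyp]] gS.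
have [c c1 cP] := word_dist_bilipschitz gS gS'; have [c' c'1 c'P] := word_dist_bilipschitz gS' gS.
pose C := Num.max c c'.
have C1 : 1 <= C by rewrite /C le_max c1.
have m S0 (g0 : generates S0) := word_dist_pseudometric g0.
have [| |delta' d'0 hyp'] := quasi_isometry_hyperbolic (m S gS) (m S' gS') (c := C) _ _ C1 d0 hyp
  (word_dist_geod_connected gS') (word_dist_geod_connected gS).
- by move=> g h; apply: le_trans (cP g h) _; rewrite ler_wpM2r // le_max lexx.
- by move=> g h; apply: le_trans (c'P g h) _; rewrite ler_wpM2r // le_max lexx orbT.
exists delta'; split=> //.
- by rewrite word_length1.
- by move=> g; rewrite word_lengthV.
- by move=> g h; rewrite -natrD ler_nat word_lengthM.
- move=> g h k; have := hyp' 1%g g h k.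
  by rewrite /gromov_product /word_dist !mulg1 !word_lengthV.
Qed.
End WordMetric.

(** * From spheres to balls *)

Lemma card_fset_set_seq (T : choiceType) (A : set T) (s : seq T) :
  uniq s -> (forall x, x \in s <-> A x) -> #|` fset_set A| = size s.
Proof.
move=> us sA; have -> : A = [set` s] by apply/seteqP; split=> x /=; rewrite sA.
rewrite (_ : fset_set _ = [fset x in s]%fset) ?card_fseq ?undup_id //.
by apply/fsetP => x; rewrite in_fset_set ?finite_seq // mem_setE !inE.
Qed.

(** A Cesaro argument: all [nu i] are positive, so the denominators tend to infinity and outweigh
    the constant [c] contributed by the first [N] terms. *)
Lemma ratio_of_sums_cvg1 (R : realType) (good nu : nat -> nat) :
  (forall i, (good i <= nu i)%N) -> (forall i, (0 < nu i)%N) ->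
  (forall eps : R, 0 < eps -> exists N, forall i, (N <= i)%N ->
     (1 - eps) * (nu i)%:R <= (good i)%:R) ->
  ((\sum_(i < n.+1) good i)%:R / (\sum_(i < n.+1) nu i)%:R : R) @[n --> \oo] --> (1 : R).
Proof.
move=> le nu0 ev; apply/cvgrPdist_le => e e0.
have [N NP] := ev (e / 2) (divr_gt0 e0 (ltr0Sn _ _)).
pose c := (\sum_(i < N) nu i)%N.
have low j : (1 - e / 2) * (\sum_(i < N + j) nu i)%:R <= (\sum_(i < N + j) good i)%:R + c%:R :> R.
  elim: j => [|j IH].
    rewrite addn0 -/c; apply: (@le_trans _ _ c%:R); last by rewrite lerDr.
    by rewrite ler_piMl // gerBl divr_ge0 // ltW.
  rewrite addnS !big_ord_recr /= !natrD; have := NP (N + j)%N (leq_addr _ _).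
  by move: IH; lra.
have nuS n : (n <= \sum_(i < n) nu i)%N.
  elim: n => // n IH; rewrite big_ord_recr /= -addn1 leq_add //.
have [K KP] : exists K : nat, c%:R / (e / 2) < K%:R :> R.
  by exists (Num.truncn (c%:R / (e / 2))).+1; rewrite truncnS_gt.
exists (maxn N K) => // n /=; rewrite geq_max => /andP[Nn Kn].
have := low (n.+1 - N)%N; rewrite subnKC; last by rewrite (leq_trans Nn).
set g := (\sum_(i < n.+1) good i)%N; set b := (\sum_(i < n.+1) nu i)%N => h.
have gb : (g <= b)%N by apply: leq_sum.
have Kb : (K <= b)%N by rewrite (leq_trans Kn) // (leq_trans (leqnSn n)) // nuS.
have b0 : 0 < b%:R :> R by rewrite ltr0n (leq_trans _ (nuS _)).
rewrite ger0_norm; last by rewrite subr_ge0 ler_pdivrMr // mul1r ler_nat.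
rewrite lerBlDr -lerBlDl ler_pdivlMr //.
have : c%:R <= e / 2 * b%:R.
  rewrite mulrC -ler_pdivrMr ?divr_gt0 //; apply/ltW/(lt_le_trans KP).
  by rewrite ler_nat.
by move: h; lra.
Qed.

Section BallCount.
Variables (G : groupType) (M : marking G).

Lemma card_ball_filter (P : pred G) n :
  #|` fset_set [set g | (wlen M g <= n)%N /\ P g]| =
  (\sum_(i < n.+1) count (fun w => P (ev w)) (lw M i))%N.
Proof.
pose s n := flatten [seq [seq w <- lw M i | P (ev w)] | i <- iota 0 n].
have sS j : s j.+1 = s j ++ [seq w <- lw M j | P (ev w)].
  by rewrite /s -addn1 iotaD map_cat flatten_cat /= cats0.
have mem_s j w : (w \in s j) = [&& slex w, (size w < j)%N & P (ev w)].
  elim: j => [|j IH]; first by rewrite ltn0 andbF.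
  rewrite sS mem_cat IH mem_filter mem_lw [in RHS]ltnS [in RHS]leq_eqVlt.
  by case: (slex w); case: (size w == j); case: (size w < j)%N; case: (P _).
have us j : uniq (s j).
  elim: j => // j IH; rewrite sS cat_uniq IH filter_uniq ?uniq_lw //= andbT.
  apply/hasPn => w; rewrite mem_filter mem_lw mem_s => /and3P[_ _ /eqP->].
  by rewrite ltnn andbF.
rewrite (@card_fset_set_seq _ _ (map (@ev G M) (s n.+1))).
- rewrite size_map; elim: (n.+1) => [|j IH]; first by rewrite big_ord0.
  by rewrite big_ord_recr /= sS size_cat IH size_filter.
- rewrite map_inj_in_uniq // => v w; rewrite !mem_s => /andP[lv _] /andP[lw' _].
  exact: slex_inj.
move=> g; split=> [/mapP[w + ->]|[gn Pg]].
  by rewrite mem_s ltnS => /and3P[lw' sw Pw]; split=> //=; rewrite -size_slex.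
by apply/mapP; exists (nf M g); rewrite ?ev_nf // mem_s slex_nf size_nf ltnS gn ev_nf.
Qed.
End BallCount.

Theorem theorem1p5 (R : realType) (G : groupType) (S : {fset G})
    (X : metricType R) (act : G -> X -> X) (x : X) :
  hyperbolic_group R G ->
  generates S ->
  hyperbolic_space X ->
  separable X ->
  isometric_action act ->
  nonelementary act ->
  exists2 L1 : R, 0 < L1 &
    (#|` fset_set [set g | word_ball S n g /\
                     L1 * (word_length S g)%:R <= mdist (act g x) x]|%:R
     / #|` fset_set (word_ball S n)|%:R : R) @[n --> \oo] --> (1 : R).
Proof.
move=> hG genS [_ hX] _ isom nonel.
have [delta H] := hyperbolic_group_hyplen hG genS.
have [deltaX HX] := displacement_hyplen x hX isom.
have [a [b [C [tau [_ tau0 ind]]]]] := nonelementary_independent x hX isom nonel.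
have [M MS] := marking_word_length genS; rewrite -MS in H.
have [kappa k0 kP] := sublinear_wlen M (len1 HX) (lenM HX).
have [L L0 few] := positive_drift H HX kP tau0 ind.
(* Powers of [a] have unbounded displacement, which word length controls from above; hence every
   sphere is nonempty. *)
have unb n : exists g, (n <= wlen M g)%N.
  have kap0 : 0 < kappa + 1 by rewrite ltr_wpDl.
  have [i iP] : exists i : nat, (kappa + 1) * n%:R / tau < i%:R.
    by exists (Num.truncn ((kappa + 1) * n%:R / tau)).+1; rewrite truncnS_gt.
  exists (a ^+ i)%g; rewrite -(ler_nat R) -(ler_pM2l kap0).
  apply: (@le_trans _ _ (tau * i%:R)); first by rewrite [leRHS]mulrC -ler_pdivrMr // ltW.
  have [_ _ _ /(_ a i (mem_head _ _)) h] := ind.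
  apply: le_trans h (le_trans (kP _) _).
  by rewrite ler_wpM2r // lerDl.
exists L => //.
pose P g := L * (wlen M g)%:R <= displacement act x g.
have -> : (fun n => #|` fset_set [set g | word_ball S n g /\
      L * (word_length S g)%:R <= mdist (act g x) x]|%:R / #|` fset_set (word_ball S n)|%:R : R) =
    (fun n => (\sum_(i < n.+1) count (fun w => P (ev w)) (lw M i))%:R /
      (\sum_(i < n.+1) nu M i)%:R).
  apply/funext => n; rewrite -card_ball_filter /P MS /word_ball; congr (_ / _%:R).
  rewrite (_ : [set g | _] = [set g | (wlen M g <= n)%N /\ xpredT g]).
    rewrite card_ball_filter; apply: eq_bigr => i _; exact: count_predT.
  by apply/seteqP; split=> g /=; rewrite MS => // -[].
apply: (@ratio_of_sums_cvg1 R (fun i => count (fun w => P (ev w)) (lw M i)) (nu M)) =>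
  [i|i|eps eps0]; first exact: count_size.
  exact: nu_ge1.
have [N NP] := few eps eps0; exists N => i /NP.
rewrite -[nu M i]/(size (lw M i)) -(count_predC (fun w => P (ev w)) (lw M i)).
set bad := count _ (lw M i); rewrite (_ : count (predC _) _ = bad); last first.
  apply: eq_in_count => w; rewrite mem_lw => /andP[lw' /eqP sw] /=.
  by rewrite /P -ltNge -size_slex // sw.
by rewrite natrD; lra.
Qed.
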